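(* Let $W\in\{S_n,W^{\mathsf{BC}}_n,W^{\mathsf D}_n\}$ with $n\ge 2$, and let $\mathcal M,\mathcal N$ be the $\mathcal H$-modules described in the context. There are unique $\mathcal H$-compatible bar operators on $\mathcal M$ and on $\mathcal N$ satisfying $\overline{M_z}=M_z$ and $\overline{N_z}=N_z$ for all $z\in\mathcal G$ with $\mathrm{Des}^<(z)=\varnothing$; each is an involution. Moreover $\mathcal M$ has a unique basis $\{\underline M_z:z\in\mathcal G\}$ with $\overline{\underline M_z}=\underline M_z\in M_z+\sum_{y\in\mathcal G,\ \ell(y)<\ell(z)}x^{-1}\mathbb Z[x^{-1}]M_y$, and $\mathcal N$ has a unique basis $\{\underline N_z:z\in\mathcal G\}$ with $\overline{\underline N_z}=\underline N_z\in N_z+\sum_{y\in\mathcal G,\ \ell(y)<\ell(z)}x^{-1}\mathbb Z[x^{-1}]N_y$.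
   Context: For $i>0$ let $s_i=(i,i+1)(-i,-i-1)$, $s_0=(-1,1)$, $s_{-1}=(1,-2)(-1,2)$. $W^{\mathsf{BC}}_N$ is the group of permutations $w$ of $\{\pm1,\dots,\pm N\}$ with $w(-i)=-w(i)$ (Coxeter generators $s_0,\dots,s_{N-1}$); $W^{\mathsf D}_N$ its subgroup with $|\{i\in[N]:w(i)<0\}|$ even (generators $s_{-1},s_1,\dots,s_{N-1}$); $S_N=\langle s_1,\dots,s_{N-1}\rangle$. $\ell$ is Coxeter length. $\mathcal F^{\mathsf A}_{n-1}=\{z\in S_{2n}:z=z^{-1},z(i)\ne i\ \forall i\in[2n]\}$; $\mathcal F^{\mathsf{BC}}_n=\{z\in W^{\mathsf{BC}}_{2n}:z=z^{-1},|z(i)|\ne i\ \forall i\in[2n]\}$; $\mathcal F^{\mathsf D}_n=\{z\in\mathcal F^{\mathsf{BC}}_n:|\{i\in[n]:z(i)<-i\}|\text{ even}\}$. $i>0$ is a visible descent of $z$ if $z(i+1)<\min\{i,z(i)\}$ or $z(i)<-i$. $\mathcal G=\mathcal G(W)$ is the subset of $\mathcal F^{\mathsf A}_{n-1}$, $\mathcal F^{\mathsf{BC}}_n$, $\mathcal F^{\mathsf D}_n$ (for $W=S_n,W^{\mathsf{BC}}_n,W^{\mathsf D}_n$) of elements with no visible descent $>n$; $\ell(z)$ for $z\in\mathcal G$ is length in $S_{2n}$, $W^{\mathsf{BC}}_{2n}$, $W^{\mathsf D}_{2n}$ respectively. For $z\in\mathcal G$: $\mathrm{Des}^=(z)=\{s\in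 S:sz=zs\}$, $\mathrm{Asc}^=(z)=\{s\in S:zsz\in\{s_i:i>n\}\}$, $\mathrm{Des}^<(z)=\{s\in S:\ell(sz)<\ell(z)\}\setminus(\mathrm{Des}^=(z)\sqcup\mathrm{Asc}^=(z))$, $\mathrm{Asc}^<(z)=\{s\in S:\ell(sz)>\ell(z)\}\setminus(\mathrm{Des}^=(z)\sqcup\mathrm{Asc}^=(z))$. $\mathcal H$ is the Iwahori–Hecke algebra of $W$: free $\mathbb Z[x,x^{-1}]$-module with basis $H_w$, $H_sH_w=H_{sw}$ if $\ell(sw)>\ell(w)$, else $H_{sw}+(x-x^{-1})H_w$. A map is antilinear if $\phi(pa)=\bar p\phi(a)$ where $\bar{\ }$ is the ring automorphism of $\mathbb Z[x,x^{-1}]$ with $x\mapsto x^{-1}$. The bar operator of $\mathcal H$ is the antilinear ring involution with $\overline{H_w}=(H_{w^{-1}})^{-1}$. An $\mathcal H$-compatible bar operator on an $\mathcal H$-module $\mathcal A$ is an antilinear map with $\overline{HA}=\overline H\,\overline A$. $\mathcal M$ (resp. $\mathcal N$) is the free $\mathbb Z[x,x^{-1}]$-module with basis $M_z$ (resp. $N_z$), $z\in\mathcal G$, with the $\mathcal H$-module structure: $H_sM_z=M_{szs}$ if $s\in\mathrm{Asc}^<(z)$, $M_{szs}+(x-x^{-1})M_z$ if $s\in\mathrm{Des}^<(z)$, $-x^{-1}M_z$ if $s\in\mathrm{Asc}^=(z)$, $xM_z$ if $s\in\mathrm{Des}^=(z)$; and $H_sN_z=N_{szs}$, $N_{szs}+(x-x^{-1})N_z$,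 $xN_z$, $-x^{-1}N_z$ in the same four cases respectively. *)

(* Defs.v *)
From HB Require Import structures.
From mathcomp Require Import all_boot all_order all_algebra all_fingroup.
From mathcomp Require Import fraction.
From mathcomp Require Import boolp.
Set Implicit Arguments. Unset Strict Implicit. Unset Printing Implicit Defensive.
Import GRing.Theory Num.Theory.
Local Open Scope ring_scope.

Definition Kx := {fraction {poly int}}.
Notation "x %:F" := (@FracField.tofrac _ x) (format "x %:F").
Notation tofrac_eq := (@tofrac_eq _).
Definition Xf : Kx := ('X : {poly int})%:F.
Lemma Xf_neq0 : Xf != 0.
Proof. by rewrite /Xf tofrac_eq polyX_eq0. Qed.

Definition is_laurent (f : Kx) : Prop :=
  exists (k : nat) (p : {poly int}), f * Xf ^+ k = p%:F.
Definition laurent_pred : Kx -> bool := fun f => `[< is_laurent f >].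

Lemma laurent_subring_closed : subring_closed laurent_pred.
Proof.
split.
- by apply/asboolP; exists 0%N, 1; rewrite expr0 mulr1 tofrac1.
- move=> f g /asboolP[k [p hp]] /asboolP[j [q hq]]; apply/asboolP.
  exists (k + j)%N, (p * 'X^j - q * 'X^k).
  rewrite tofracB !tofracM !tofracXn -/Xf exprD mulrBl -hp -hq.
  by rewrite !mulrA; congr (_ - _); rewrite -!mulrA; congr (_ * _); rewrite mulrC.
- move=> f g /asboolP[k [p hp]] /asboolP[j [q hq]]; apply/asboolP.
  exists (k + j)%N, (p * q).
  rewrite tofracM exprD -hp -hq.
  by rewrite -!mulrA; congr (_ * _); rewrite mulrCA.
Qed.

HB.instance Definition _ := GRing.isSubringClosed.Build _ laurent_pred
  laurent_subring_closed.

Record laurent := Laurent { lval : Kx; lvalP : laurent_pred lval }.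
HB.instance Definition _ := [isSub for lval].
HB.instance Definition _ := [Choice of laurent by <:].
HB.instance Definition _ := [SubChoice_isSubComNzRing of laurent by <:].


Lemma laurent_X : laurent_pred Xf.
Proof. by apply/asboolP; exists 0%N, 'X; rewrite expr0 mulr1. Qed.

Lemma laurent_Xinv : laurent_pred Xf^-1.
Proof.
apply/asboolP; exists 1%N, 1; rewrite expr1 mulVf; last exact: Xf_neq0.
by rewrite tofrac1.
Qed.

Definition lx : laurent := Laurent laurent_X.
Definition lxi : laurent := Laurent laurent_Xinv.

Lemma laurent_ex (f : laurent) :
  exists kp : nat * {poly int}, lval f * Xf ^+ kp.1 = kp.2%:F.
Proof. by case: f => v /= /asboolP [k [p hp]]; exists (k, p). Qed.

Definition evalXinv (p : {poly int}) : Kx :=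
  (map_poly (fun c : int => c%:~R) p : {poly Kx}).[Xf^-1].

(* the ring automorphism of Z[x,x^-1] with x |-> x^-1:
   if f = p(x) x^-k then bar f = p(x^-1) x^k *)
Definition lbar (f : laurent) : laurent :=
  let kp := projT1 (cid (laurent_ex f)) in
  insubd (0 : laurent) (evalXinv kp.2 * Xf ^+ kp.1).

Definition in_negpart (f : laurent) : Prop :=
  exists p : {poly int}, p`_0 = 0 /\ lval f = evalXinv p.

(* Signed permutations.  For a rank parameter n, everything lives in the
   ambient type of permutations of {-2n,...,2n} (encoded as 'I_(4n+1),
   index k standing for the integer k - 2n).  Signed permutations of
   {+-1,...,+-N} (N <= 2n) are those permutations w with w(-i) = -w(i)
   fixing everything outside {+-1..+-N}; they fix 0. *)

Definition Amb (n : nat) := 'I_((4 * n).+1).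
Definition Perm (n : nat) := {perm Amb n}.

Definition ival (n : nat) (k : Amb n) : int := (k : nat)%:Z - (2 * n)%:Z.
Definition idx (n : nat) (v : int) : Amb n := inord (absz (v + (2 * n)%:Z)).
Definition sapp (n : nat) (w : Perm n) (i : int) : int := ival (w (idx n i)).

(* composition: cmp a b = a o b  (mathcomp's product is (b * a) x = a (b x)) *)
Definition cmp (n : nat) (a b : Perm n) : Perm n := (b * a)%g.

Definition tr (n : nat) (a b : int) : Perm n := tperm (idx n a) (idx n b).

Definition gen (n : nat) (i : int) : Perm n :=
  if i == 0 then tr n 1 (-1)
  else if i == -1 then (tr n 1 (-2) * tr n (-1) 2)%g
  else (tr n i (i + 1) * tr n (- i) (- i - 1))%g.

Inductive ctype := TA | TBC | TD.

Definition gen_idx (t : ctype) (m : nat) : seq int :=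
  match t with
  | TA => [::]
  | TBC => [:: 0]
  | TD => [:: -1]
  end ++ [seq (i%:Z) | i <- iota 1 m.-1].

Definition gens (n : nat) (t : ctype) (m : nat) : {set Perm n} :=
  [set g in [seq gen n i | i <- gen_idx t m]].

Definition Wgrp (n : nat) (t : ctype) (m : nat) : {set Perm n} :=
  <<gens n t m>>%g.

Fixpoint prods (n : nat) (S : {set Perm n}) (k : nat) : {set Perm n} :=
  match k with
  | 0 => [set 1%g]
  | k'.+1 => [set cmp s w | s in S, w in prods S k']
  end.

Definition clen (n : nat) (S : {set Perm n}) (w : Perm n) : nat :=
  find (fun k => w \in prods S k) (iota 0 #|{: Perm n}|.+1).

Definition involution (n : nat) (z : Perm n) : bool := (z * z == 1)%g.

Definition FA (n : nat) : {set Perm n} :=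
  [set z in Wgrp n TA (2 * n) | involution z &
     all (fun i : nat => sapp z i != i%:Z) (iota 1 (2 * n))].

Definition FBC (n : nat) : {set Perm n} :=
  [set z in Wgrp n TBC (2 * n) | involution z &
     all (fun i : nat => (absz (sapp z i)) != i) (iota 1 (2 * n))].

Definition FD (n : nat) : {set Perm n} :=
  [set z in FBC n |
     ~~ odd (count (fun i : nat => sapp z i < - (i%:Z)) (iota 1 n))].

Definition Fset (n : nat) (t : ctype) : {set Perm n} :=
  match t with TA => FA n | TBC => FBC n | TD => FD n end.

Definition vdes (n : nat) (z : Perm n) (i : nat) : bool :=
  ((i < 2 * n)%N && (sapp z (i.+1) < Num.min (i%:Z) (sapp z i)))
  || (sapp z i < - (i%:Z)).

Definition Gset (n : nat) (t : ctype) : {set Perm n} :=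
  [set z in Fset n t | all (fun i => ~~ vdes z i) (iota n.+1 n)].

Definition glen (n : nat) (t : ctype) (z : Perm n) : nat :=
  clen (gens n t (2 * n)) z.

Definition wlen (n : nat) (t : ctype) (w : Perm n) : nat :=
  clen (gens n t n) w.

Definition bigS (n : nat) : {set Perm n} :=
  [set g in [seq gen n (i%:Z) | i <- iota n.+1 n.-1]].

Definition DesEq (n : nat) (t : ctype) (z : Perm n) : {set Perm n} :=
  [set s in gens n t n | cmp s z == cmp z s].
Definition AscEq (n : nat) (t : ctype) (z : Perm n) : {set Perm n} :=
  [set s in gens n t n | cmp z (cmp s z) \in bigS n].
Definition DesLt (n : nat) (t : ctype) (z : Perm n) : {set Perm n} :=
  [set s in gens n t n | (glen t (cmp s z) < glen t z)%N]
    :\: (DesEq t z :|: AscEq t z).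
Definition AscLt (n : nat) (t : ctype) (z : Perm n) : {set Perm n} :=
  [set s in gens n t n | (glen t z < glen t (cmp s z))%N]
    :\: (DesEq t z :|: AscEq t z).

Inductive mkind := KM | KN.

Definition Gidx (n : nat) (t : ctype) := {z : Perm n | z \in Gset n t}.
Definition Widx (n : nat) (t : ctype) := {w : Perm n | w \in Wgrp n t n}.

Definition Mod (n : nat) (t : ctype) := {ffun Gidx n t -> laurent}.
Definition Hecke (n : nat) (t : ctype) := {ffun Widx n t -> laurent}.

Definition basisv (n : nat) (t : ctype) (z : Gidx n t) : Mod n t :=
  [ffun y => (y == z)%:R].

Definition msc (n : nat) (t : ctype) (c : laurent) (m : Mod n t) : Mod n t :=
  [ffun y => c * m y].

(* coefficient of the basis vector indexed by y in H_s M_z (resp. H_s N_z) *)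
Definition coefH (n : nat) (t : ctype) (k : mkind) (s z y : Perm n) : laurent :=
  if s \in AscLt t z then (y == cmp s (cmp z s))%:R
  else if s \in DesLt t z then
    (y == cmp s (cmp z s))%:R + (lx - lxi) * (y == z)%:R
  else if s \in AscEq t z then
    (if k is KM then - lxi else lx) * (y == z)%:R
  else if s \in DesEq t z then
    (if k is KM then lx else - lxi) * (y == z)%:R
  else 0.

Definition actS (n : nat) (t : ctype) (k : mkind) (s : Perm n) (m : Mod n t)
  : Mod n t :=
  [ffun y => \sum_(z : Gidx n t) m z * coefH t k s (val z) (val y)].

Definition actSinv (n : nat) (t : ctype) (k : mkind) (s : Perm n) (m : Mod n t)
  : Mod n t :=
  actS k s m - msc (lx - lxi) m.

(* a reduced word of w in W: w = s_1 o s_2 o ... o s_k *)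
Fixpoint redw_fuel (n : nat) (t : ctype) (fuel : nat) (w : Perm n)
  : seq (Perm n) :=
  match fuel with
  | 0 => [::]
  | f.+1 =>
      match [pick s in gens n t n | (wlen t (cmp s w) < wlen t w)%N] with
      | Some s => s :: redw_fuel t f (cmp s w)
      | None => [::]
      end
  end.
Definition redw (n : nat) (t : ctype) (w : Perm n) : seq (Perm n) :=
  redw_fuel t (wlen t w) w.

Definition actHw (n : nat) (t : ctype) (k : mkind) (w : Perm n) (m : Mod n t)
  : Mod n t :=
  foldr (actS k) m (redw t w).

(* action of bar(H_w) = (H_{w^-1})^-1 = H_{s_1}^-1 ... H_{s_k}^-1 *)
Definition actbarHw (n : nat) (t : ctype) (k : mkind) (w : Perm n)
  (m : Mod n t) : Mod n t :=
  foldr (actSinv k) m (redw t w).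

Definition actH (n : nat) (t : ctype) (k : mkind) (h : Hecke n t)
  (m : Mod n t) : Mod n t :=
  \sum_(w : Widx n t) msc (h w) (actHw k (val w) m).

Definition actbarH (n : nat) (t : ctype) (k : mkind) (h : Hecke n t)
  (m : Mod n t) : Mod n t :=
  \sum_(w : Widx n t) msc (lbar (h w)) (actbarHw k (val w) m).

Definition is_bar_op (n : nat) (t : ctype) (k : mkind) (beta : Mod n t -> Mod n t)
  : Prop :=
  [/\ (forall a b : Mod n t, beta (a + b) = beta a + beta b),
      (forall (c : laurent) (a : Mod n t), beta (msc c a) = msc (lbar c) (beta a)),
      (forall (h : Hecke n t) (a : Mod n t),
          beta (actH k h a) = actbarH k h (beta a))
    & (forall z : Gidx n t, DesLt t (val z) = set0 ->
          beta (basisv z) = basisv z)].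

Definition is_basis (n : nat) (t : ctype) (b : Gidx n t -> Mod n t) : Prop :=
  forall m : Mod n t, exists! c : Gidx n t -> laurent,
    m = \sum_(z : Gidx n t) msc (c z) (b z).

Definition canonical_fam (n : nat) (t : ctype) (beta : Mod n t -> Mod n t)
  (b : Gidx n t -> Mod n t) : Prop :=
  forall z : Gidx n t,
    [/\ beta (b z) = b z,
        b z z = 1
      & forall y : Gidx n t, y != z ->
          if (glen t (val y) < glen t (val z))%N then in_negpart (b z y)
          else b z y = 0].

(* Main.v *)
From mathcomp Require Import all_boot all_order all_algebra all_fingroup.
From mathcomp Require Import fraction boolp zify ring.
Require Import Defs.

(** Let X be the set of fixed-point-free involutions of the big group of rank
    2n (in type D, those with an even number of negative pairs).  For z in X and
    a simple reflection s, the elements s and zsz commute; this is what makes the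
    formulas defining M and N on the free module with basis X satisfy the braid
    relations, and by Matsumoto's theorem T_w is defined there for every w.  The
    bar operator of this big module sends M_z to a scalar multiple of
    T_{z^-1}^-1 M_z, where z plays both roles: conjugating z upwards by s
    multiplies T_z by T_s on both sides and M_z by T_s on the left, and s
    commutes with z only if T_s commutes with T_z.

    The set G sits inside X.  Let U be generated by those s_j, j > n, that
    exchange two upper points which z in G pairs with lower points.  Taking
    coinvariants of the big module under U, for the character by which Asc^= acts,
    gives the module indexed by G, and the big bar operator descends to it.  A
    minimal z in G is the only shortest element of its piece, so triangularity of
    the big operator shows that the descended one fixes M_z.  Since every M_z is
    obtained from a minimal one by applying generators, uniqueness and
    involutivity follow, and triangularity yields the canonical basis by
    Lusztig's lemma. *)

Set Implicit Arguments. Unset Strict Implicit. Unset Printing Implicit Defensive.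
Import Order.TTheory GRing.Theory Num.Theory.

(** * Coxeter combinatorics from descents *)

(** Vectors are stored as coordinate functions: an operator is given by the value of its image at a
    point [x], which involves only [x] and one conjugate, and passing to coinvariants becomes a
    weighted sum of coordinates. The scalar in the big bar operator is fixed by the minimal
    involutions. Such an [x] is a product of simple reflections commuting with it, so [T_{x^-1}^-1]
    multiplies [M_x] by [c] to the power minus the length of [x], where [c] is the eigenvalue of
    commuting reflections. All minimal elements have the same length [e], whence the single factor
    [c^e]. The group U varies with z, but only through the set of upper points paired with lower
    ones. Generators of rank n preserve this set whenever they move z inside G, so the module on G
    splits into pieces; coordinates outside the piece of z are discarded, and on the rest U contains
    the generator needed for Asc^=. If [z s z = v] is an upper generator, then [s z s = v z v] is a
    longer involution, so [T_s^-1] and [T_v^-1] agree on the bar image of [M_z], and [T_v] is a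
    scalar on coinvariants. *)

Definition wprod (gT : finGroupType) (l : seq gT) : gT := (\prod_(s <- l) s)%g.

(** [D s w] reads: [s] is a left descent of [w]. The axiom [cox_exchange] is the folding condition:
    appending a letter changes the side of the wall of [s] only by crossing that wall. It stands in
    for a presentation by generators and relations. *)
Record coxeter_axioms (gT : finGroupType) (S : {set gT}) (D : gT -> gT -> bool)
    (len : gT -> nat) : Prop := CoxeterAxioms {
  cox_invol : forall s, s \in S -> (s * s = 1)%g;
  cox_D1 : forall s, s \in S -> ~~ D s 1%g;
  cox_DM : forall s w, s \in S -> w \in <<S>>%g -> D s (s * w)%g = ~~ D s w;
  cox_exchange : forall s t w, s \in S -> t \in S -> w \in <<S>>%g ->
    D s (w * t)%g != D s w -> (s * w = w * t)%g;
  cox_word : forall w, w \in <<S>>%g ->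
    exists l, [/\ all (mem S) l, wprod l = w & size l = len w];
  cox_len_le : forall l, all (mem S) l -> len (wprod l) <= size l }.

(* [lia] would treat convertible but syntactically different group elements
   as distinct arguments of [len]. *)
Ltac lenlia len :=
  repeat match goal with
  | H : @eq nat _ _ |- _ => revert H
  | H : is_true (leq _ _) |- _ => revert H
  end;
  repeat match goal with |- context [len ?x] => move: (len x) => ? end;
  repeat match goal with |- context [size ?x] => move: (size x) => ? end;
  clear; lia.

Section Coxeter.

Variables (gT : finGroupType) (S : {set gT}) (D : gT -> gT -> bool).
Variables (len : gT -> nat) (cox : coxeter_axioms S D len).
Implicit Types (s t u v w : gT) (l : seq gT) (J : {set gT}).
Local Open Scope group_scope.
Local Notation W := <<S>>.

Let S_invol := cox_invol cox.
Let memSW s : s \in S -> s \in W. Proof. exact: mem_gen. Qed.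

Let SW s w : s \in S -> w \in W -> s * w \in W.
Proof. by move=> sS wW; rewrite groupM // memSW. Qed.
Let WS s w : s \in S -> w \in W -> w * s \in W.
Proof. by move=> sS wW; rewrite groupM // memSW. Qed.

Lemma wprod_nil : wprod [::] = 1 :> gT. Proof. by rewrite /wprod big_nil. Qed.

Lemma wprod_cons s l : wprod (s :: l) = s * wprod l.
Proof. by rewrite /wprod big_cons. Qed.

Lemma wprod_cat l1 l2 : wprod (l1 ++ l2) = wprod l1 * wprod l2.
Proof. by rewrite /wprod big_cat. Qed.

Lemma wprod_rcons l s : wprod (rcons l s) = wprod l * s.
Proof. by rewrite -cats1 wprod_cat wprod_cons wprod_nil mulg1. Qed.

Lemma wprod_gen J l : all (mem J) l -> wprod l \in <<J>>.
Proof.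
elim: l => [|s l IH] /=; first by rewrite wprod_nil group1.
by case/andP=> sJ lJ; rewrite wprod_cons groupM ?IH // mem_gen.
Qed.

Lemma invS s : s \in S -> s^-1 = s.
Proof. by move=> sS; apply/eqP; rewrite eq_invg_mul S_invol. Qed.

Lemma mulSK s w : s \in S -> s * (s * w) = w.
Proof. by move=> sS; rewrite mulgA S_invol // mul1g. Qed.

Lemma mulKS s w : s \in S -> w * s * s = w.
Proof. by move=> sS; rewrite -mulgA S_invol // mulg1. Qed.

Lemma wprod_rev l : all (mem S) l -> wprod (rev l) = (wprod l)^-1.
Proof.
elim: l => [|s l IH] /=; first by rewrite wprod_nil invg1.
case/andP=> sS lS; rewrite rev_cons wprod_rcons wprod_cons invMg IH //.
by rewrite (invS sS).
Qed.

Lemma sub_all J l : J \subset S -> all (mem J) l -> all (mem S) l.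
Proof. by move=> JS; apply: sub_all => x /=; apply: (subsetP JS). Qed.

Lemma sub_W J w : J \subset S -> w \in <<J>> -> w \in W.
Proof. by move=> JS; apply: (subsetP (genS JS)). Qed.

(** [D s] is false on the empty prefix and true on the whole word, so it flips at some letter [x];
    there folding says that multiplying by [s] on the left cancels [x]. *)
Lemma exchange s l : s \in S -> all (mem S) l -> D s (wprod l) ->
  exists l1 x l2, l = l1 ++ x :: l2 /\ s * wprod l = wprod (l1 ++ l2).
Proof.
move=> sS; elim/last_ind: l => [|l x IH].
  by rewrite wprod_nil (negbTE (cox_D1 cox sS)).
rewrite all_rcons => /andP[xS lS]; rewrite wprod_rcons => Dlx.
have [Dl|Dl] := boolP (D s (wprod l)).
  have [l1 [y [l2 [-> E]]]] := IH lS Dl.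
  exists l1, y, (rcons l2 x); split; first by rewrite rcons_cat.
  by rewrite mulgA E -rcons_cat wprod_rcons.
exists l, x, [::]; split; first by rewrite cats1.
rewrite mulgA cats0 (@cox_exchange _ _ _ _ cox s x) ?wprod_gen //.
  by rewrite mulKS.
by rewrite Dlx (negbTE Dl).
Qed.

Lemma len1 : len 1 = 0%N.
Proof. by have := cox_len_le cox (l := [::]) isT; rewrite wprod_nil; case: (len 1). Qed.

Lemma len_mulS s w : s \in S -> w \in W -> len (s * w) <= (len w).+1.
Proof.
move=> sS /(cox_word cox) [l [lS <- <-]].
by rewrite -wprod_cons; apply: (cox_len_le cox (l := s :: l)); rewrite /= sS.
Qed.

Lemma lenD s w : s \in S -> w \in W -> D s w -> len w = (len (s * w)).+1.
Proof.
move=> sS wW Dsw; apply/eqP; rewrite eqn_leq; apply/andP; split.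
  by rewrite -{1}(mulSK w sS) len_mulS ?SW.
have [l [lS lw <-]] := cox_word cox wW.
have [l1 [x [l2 [E Esw]]]] : exists l1 x l2, l = l1 ++ x :: l2 /\
  s * wprod l = wprod (l1 ++ l2) by apply: exchange; rewrite ?lw.
rewrite -lw Esw; move: lS; rewrite E all_cat /= => /and3P[l1S xS l2S].
apply: leq_ltn_trans (cox_len_le cox _) _; first by rewrite all_cat l1S.
by rewrite !size_cat /= addnS.
Qed.

Lemma lenN s w : s \in S -> w \in W -> ~~ D s w -> len (s * w) = (len w).+1.
Proof.
move=> sS wW Dsw; have swW : s * w \in W by apply: SW.
by rewrite (lenD sS swW) ?mulSK ?(cox_DM cox).
Qed.

Lemma D_len s w : s \in S -> w \in W -> D s w = (len (s * w) < len w).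
Proof.
move=> sS wW; have [Dsw|Dsw] := boolP (D s w).
  by rewrite (lenD sS wW Dsw) ltnSn.
by rewrite (lenN sS wW Dsw) ltnNge leqnSn.
Qed.

Lemma len_inv w : w \in W -> len w^-1 = len w.
Proof.
have le w' : w' \in W -> len w'^-1 <= len w'.
  move=> /(cox_word cox) [l [lS <- <-]]; rewrite -wprod_rev //.
  by rewrite -(size_rev l); apply: (cox_len_le cox); rewrite all_rev.
by move=> wW; apply/eqP; rewrite eqn_leq le //= -{1}(invgK w) le ?groupV.
Qed.

Lemma len_eq0 w : w \in W -> len w = 0%N -> w = 1.
Proof. by move=> /(cox_word cox) [l [_ <- <-]]; case: l => //; rewrite wprod_nil. Qed.

Lemma D_lenr s w : s \in S -> w \in W -> (len (w * s) < len w) = D s w^-1.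
Proof.
move=> sS wW; rewrite D_len ?groupV // (len_inv wW) -[s in RHS](invS sS).
by rewrite -invMg len_inv ?WS.
Qed.

Lemma len_mul u v : u \in W -> v \in W -> len (u * v) <= len u + len v.
Proof.
move=> /(cox_word cox) [l [lS <- <-]] /(cox_word cox) [l' [l'S <- <-]].
by rewrite -wprod_cat -size_cat; apply: (cox_len_le cox); rewrite all_cat lS.
Qed.

Lemma exists_descent w : w \in W -> w != 1 -> exists2 s, s \in S & D s w.
Proof.
move=> wW; have [l [lS lw sl]] := cox_word cox wW.
case: l lS lw sl => [_ <-|s l /= /andP[sS lS] lw sl _]; first by rewrite wprod_nil eqxx.
exists s => //; rewrite D_len // -lw wprod_cons mulSK // -wprod_cons lw -sl.
by rewrite ltnS; apply: (cox_len_le cox lS).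
Qed.

(** * Parabolic subgroups and shortest coset representatives *)

Section Parabolic.

Variables (J : {set gT}) (JS : J \subset S).
Let memJS s : s \in J -> s \in S. Proof. exact: subsetP JS s. Qed.
Let WJW w : w \in <<J>> -> w \in W. Proof. exact: sub_W. Qed.

Lemma word_gen w : w \in <<J>> -> exists2 l, all (mem J) l & wprod l = w.
Proof.
case/gen_prodgP => k [c cJ ->]; exists [seq c i | i <- index_enum 'I_k].
  by apply/allP => _ /mapP[i _ ->]; apply: cJ.
by rewrite /wprod big_map.
Qed.

(** Exchange only deletes letters, so a word over [J] can be reduced without leaving [J]; hence
    length inside the parabolic subgroup is the ambient length. *)
Lemma reduced_word l : all (mem J) l ->
  exists l', [/\ all (mem J) l', wprod l' = wprod l & size l' = len (wprod l)].
Proof.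
elim: l => [|s l IH] /=; first by exists [::]; rewrite wprod_nil len1.
case/andP=> sJ lJ; have sS := memJS sJ; have [l' [l'J l'w sl']] := IH lJ.
have lW : wprod l \in W by apply: WJW; apply: wprod_gen.
rewrite wprod_cons; have [Dsl|Dsl] := boolP (D s (wprod l)).
  have [l1 [x [l2 [E Esw]]]] : exists l1 x l2, l' = l1 ++ x :: l2 /\
      s * wprod l' = wprod (l1 ++ l2).
    by apply: exchange; rewrite ?l'w //; apply: sub_all l'J.
  exists (l1 ++ l2); split; last 1 first.
  - by have := lenD sS lW Dsl; rewrite -sl' E !size_cat /= addnS => -[].
  - by move: l'J; rewrite E !all_cat /= => /and3P[-> _ ->].
  - by rewrite -Esw l'w.
exists (s :: l'); split; first by rewrite /= l'J andbT.
  by rewrite wprod_cons l'w.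
by rewrite /= sl' lenN.
Qed.

Lemma J_word u : u \in <<J>> ->
  exists l, [/\ all (mem J) l, wprod l = u & size l = len u].
Proof. by case/word_gen => l lJ <-; apply: reduced_word. Qed.

Lemma coset_min w : w \in W -> exists u d,
  [/\ u \in <<J>>, d \in W, w = u * d, len w = (len u + len d)%N &
      forall s, s \in J -> ~~ D s d].
Proof.
have [k] := ubnP (len w); elim: k w => // k IH w; rewrite ltnS => lek wW.
have [/existsP[s /andP[sJ Dsw]]|/existsPn noD] := boolP [exists s, (s \in J) && D s w].
  have sS := memJS sJ; have swW : s * w \in W by apply: SW.
  have lw := lenD sS wW Dsw.
  have [|//|u [d [uJ dW E El noDd]]] := IH (s * w); first by rewrite -lw.
  exists (s * u), d; split=> //; first by rewrite groupM // mem_gen.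
    by rewrite -mulgA -E mulSK.
  have : len w <= len (s * u) + len d.
    rewrite -{1}(mulSK w sS) E mulgA len_mul // SW //.
    exact: WJW.
  have := len_mulS sS (WJW uJ); lenlia len.
exists 1, w; split; rewrite ?group1 ?mul1g ?len1 //.
by move=> s sJ; have := noD s; rewrite sJ.
Qed.

(** If [s] were a descent of [wprod l * d], exchange would delete a letter of the concatenated word.
    A letter of [l] cannot go, since [s :: l] is reduced; a letter of [d] cannot go, since [d] is
    shortest in its coset. *)
Lemma coset_add_min d l : d \in W -> (forall v, v \in <<J>> -> len d <= len (v * d)) ->
  all (mem J) l -> len (wprod l) = size l -> len (wprod l * d) = (size l + len d)%N.
Proof.
move=> dW dmin; elim: l => [|s l IH] /=; first by rewrite wprod_nil mul1g.
case/andP=> sJ lJ; have sS := memJS sJ; rewrite wprod_cons => redl.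
have lW : wprod l \in W by apply/WJW/wprod_gen.
have lred : len (wprod l) = size l.
  have := len_mulS sS lW; have := cox_len_le cox (sub_all JS lJ); rewrite redl; lenlia len.
rewrite -mulgA addSn -IH //; apply: lenN; rewrite ?groupM //; apply/negP => Dsl.
have [ld [ldS ldw sld]] := cox_word cox dW.
have [||l1 [x [l2 [E Esw]]]] := @exchange s (l ++ ld) sS.
- by rewrite all_cat (sub_all JS lJ).
- by rewrite wprod_cat ldw.
rewrite wprod_cat ldw in Esw.
have [ltl|gel] := ltnP (size l1) (size l).
  have El : l = l1 ++ x :: take (size l - (size l1).+1) l2.
    have := congr1 (take (size l)) E; rewrite take_size_cat // take_cat ltnNge ltnW //=.
    by rewrite -(subnSK ltl).
  have El2 : l2 = take (size l - (size l1).+1) l2 ++ ld.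
    have := congr1 (drop (size l)) E; rewrite drop_size_cat // drop_cat ltnNge ltnW //=.
    by rewrite -(subnSK ltl) /= => ->; rewrite cat_take_drop.
  have : s * wprod l = wprod (l1 ++ take (size l - (size l1).+1) l2).
    apply: (mulIg d); rewrite -ldw -mulgA -!wprod_cat -catA -El2 wprod_cat ldw.
    exact: Esw.
  move/(congr1 len); rewrite redl => Elen.
  move: lJ; rewrite {1}El all_cat /= => /and3P[l1J _ l2J].
  have := cox_len_le cox (l := l1 ++ take (size l - (size l1).+1) l2).
  rewrite all_cat (sub_all JS l1J) (sub_all JS l2J) -Elen => /(_ isT).
  by have := congr1 size El; rewrite !size_cat /=; lenlia len.
(* The deleted letter now lies in the word of [d]; [d'] is what remains of that word. *)
have El1 : l1 = l ++ drop (size l) l1.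
  have := congr1 (take (size l)) E; rewrite take_size_cat // takel_cat // => {1}->.
  by rewrite cat_take_drop.
have Eld : ld = drop (size l) l1 ++ x :: l2.
  have := congr1 (drop (size l)) E; rewrite drop_size_cat // => ->.
  by rewrite {1}El1 -catA drop_size_cat.
set d' := wprod (drop (size l) l1 ++ l2).
have Ed : s * (wprod l * d) = wprod l * d'.
  by rewrite Esw {1}El1 -catA wprod_cat.
have ldd' : len d' < len d.
  rewrite -sld Eld size_cat /= addnS ltnS -size_cat; apply: (cox_len_le cox).
  by move: ldS; rewrite Eld !all_cat /= => /and3P[-> _ ->].
have /dmin : (wprod l)^-1 * s * wprod l \in <<J>>.
  by rewrite !groupM ?groupV ?(wprod_gen lJ) // mem_gen.
by rewrite -!mulgA Ed mulKg leqNgt ldd'.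
Qed.

(** It is enough that [d] is itself shortest in its coset. If [v * d] is shortest and [v] is
    nontrivial, the first letter of a reduced word of [v^-1] is a descent of [d] lying in [J]. *)
Lemma coset_add d u : d \in W -> (forall s, s \in J -> ~~ D s d) ->
  u \in <<J>> -> len (u * d) = (len u + len d)%N.
Proof.
move=> dW noD.
have [v vJ vmin] := arg_minnP (fun v => len (v * d)) (group1 <<J>>%G).
have vdW : v * d \in W by rewrite groupM // WJW.
have vdmin v' : v' \in <<J>> -> len (v * d) <= len (v' * (v * d)).
  by move=> v'J; rewrite mulgA; apply: vmin; apply: groupM.
suff v1 : v = 1.
  have dmin v' : v' \in <<J>> -> len d <= len (v' * d).
    by move/vdmin; rewrite v1 mul1g.
  case/J_word=> l [lJ <- sl].
  by rewrite -sl; apply: coset_add_min.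
have [l [lJ lv sl]] : exists l, [/\ all (mem J) l, wprod l = v^-1 & size l = len v^-1].
  by apply: J_word; rewrite groupV.
case: l lJ lv sl => [_|s l /= /andP[sJ lJ]].
  by rewrite wprod_nil => /esym/eqP; rewrite invg_eq1 => /eqP.
move=> lv sl; have sS := memJS sJ.
have : len (wprod (s :: l) * (v * d)) = ((size l).+1 + len (v * d))%N.
  by apply: coset_add_min; rewrite //= ?sJ // lv sl.
rewrite lv mulKg => ld.
have /negP[] := noD s sJ; rewrite D_len //.
have -> : s * d = wprod l * (v * d).
  by rewrite mulgA; congr (_ * _); rewrite -[v]invgK -lv wprod_cons invMg (invS sS) mulgA mulgV mul1g.
rewrite ld.
have := len_mul (WJW (wprod_gen lJ)) vdW; have := cox_len_le cox (sub_all JS lJ); lenlia len.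
Qed.

End Parabolic.
End Coxeter.

(** * The Hecke action on a perfect set of involutions *)

(** The last condition says [(s z)^4 = 1]; by closure under conjugation it extends from simple
    reflections to all reflections. These are perfect involutions in the sense of Rains and
    Vazirani. *)
Record perfect_set (gT : finGroupType) (S F : {set gT}) : Prop := PerfectSet {
  perf_gen : forall z, z \in F -> z \in <<S>>%g;
  perf_invol : forall z, z \in F -> (z * z = 1)%g;
  perf_conj : forall z s, z \in F -> s \in S -> (z ^ s)%g \in F;
  perf_comm : forall z s, z \in F -> s \in S -> commute s (z * s * z)%g }.

Fixpoint alt (T : Type) (k : nat) (s t : T) : seq T :=
  if k is k'.+1 then s :: alt k' t s else [::].

(** This is the letter that follows [alt k s t], that is, the last letter of [alt k.+1 s t]. *)
Fixpoint altlast (T : Type) (k : nat) (s t : T) : T :=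
  if k is k'.+1 then altlast k' t s else s.

Lemma alt_rcons (T : Type) k (s t : T) :
  alt k.+1 s t = rcons (alt k s t) (altlast k s t).
Proof. by elim: k s t => // k IH s t; rewrite [LHS]/= -/(alt k.+1 t s) IH. Qed.

Lemma size_alt (T : Type) k (s t : T) : size (alt k s t) = k.
Proof. by elim: k s t => //= k IH s t; rewrite IH. Qed.

Section Perfect.

Variables (gT : finGroupType) (S : {set gT}) (D : gT -> gT -> bool).
Variables (len : gT -> nat) (cox : coxeter_axioms S D len).
Variables (F : {set gT}) (perf : perfect_set S F).
Variables (R : comNzRingType) (c h : R) (c_quad : (c * c = 1 + h * c)%R).

Local Notation X := {z : gT | z \in F}.
Implicit Types (s t u v w : gT) (l : seq gT) (x y : X) (m : X -> R).
Local Open Scope group_scope.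
Local Notation W := <<S>>.

Let memSW s : s \in S -> s \in W. Proof. exact: mem_gen. Qed.
Let SW s w : s \in S -> w \in W -> s * w \in W.
Proof. by move=> sS wW; rewrite groupM // memSW. Qed.
Let WS s w : s \in S -> w \in W -> w * s \in W.
Proof. by move=> sS wW; rewrite groupM // memSW. Qed.
Let XW x : val x \in W. Proof. exact: (perf_gen perf (valP x)). Qed.
Let SK := mulSK cox. Let KS := mulKS cox.

Lemma conjS z s : s \in S -> z ^ s = s * z * s.
Proof. by move=> sS; rewrite conjgE (invS cox sS) mulgA. Qed.

Lemma XV x : (val x)^-1 = val x.
Proof. by apply/eqP; rewrite eq_invg_mul (perf_invol perf (valP x)). Qed.

Lemma XX x : val x * val x = 1.
Proof. exact: (perf_invol perf (valP x)). Qed.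

Lemma perf_conjW z w : z \in F -> w \in W -> z ^ w \in F.
Proof.
move=> zF /(cox_word cox) [l [lS <- _]].
elim: l z zF lS => [|s l IH] z zF /=; first by rewrite wprod_nil conjg1.
by case/andP=> sS lS; rewrite wprod_cons conjgM IH // (perf_conj perf).
Qed.

Definition xact u x : X := insubd x (val x ^ u).

Lemma val_act u x : u \in W -> val (xact u x) = val x ^ u.
Proof. by move=> uW; rewrite /xact val_insubd perf_conjW // (valP x). Qed.

Lemma val_actS s x : s \in S -> val (xact s x) = s * val x * s.
Proof. by move=> sS; rewrite val_act ?conjS // memSW. Qed.

Lemma act1 x : xact 1 x = x.
Proof. by apply: val_inj; rewrite val_act ?group1 // conjg1. Qed.

Lemma actM u v x : u \in W -> v \in W -> xact (u * v) x = xact v (xact u x).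
Proof. by move=> uW vW; apply: val_inj; rewrite !val_act ?groupM // conjgM. Qed.

Lemma actSK s x : s \in S -> xact s (xact s x) = x.
Proof.
by move=> sS; rewrite -actM ?memSW // (cox_invol cox sS) act1.
Qed.

Definition xcomm s x : bool := s * val x == val x * s.

Lemma act_comm s x : s \in S -> xcomm s x -> xact s x = x.
Proof.
by move=> sS /eqP sx; apply: val_inj; rewrite val_actS // sx KS.
Qed.

Lemma comm_act s x : s \in S -> xcomm s (xact s x) = xcomm s x.
Proof.
move=> sS; rewrite /xcomm val_actS // !mulgA (cox_invol cox sS) mul1g KS //.
Qed.

(** Multiplying by [s] on the left reverses the descent; multiplying by [s] on the right keeps it,
    because by folding a change would make [s] commute with [x]. *)
Lemma D_act s x : s \in S -> ~~ xcomm s x -> D s (val (xact s x)) = ~~ D s (val x).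
Proof.
move=> sS nsx; rewrite val_actS // -mulgA (cox_DM cox) ?WS //; congr (~~ _).
apply/eqP; apply: contraR nsx => Dne; apply/eqP.
exact: (cox_exchange cox sS sS (XW x) Dne).
Qed.

Lemma len_mulr s x : s \in S -> len (val x * s) = len (s * val x).
Proof.
by move=> sS; rewrite -(len_inv cox) ?WS // invMg XV (invS cox sS).
Qed.

Lemma len_act s x : s \in S -> ~~ xcomm s x -> ~~ D s (val x) ->
  len (val (xact s x)) = (len (val x)).+2.
Proof.
move=> sS nsx nD; rewrite val_actS // -mulgA (lenN cox) ?WS //.
  by rewrite len_mulr // (lenN cox).
by rewrite -(cox_DM cox) ?WS // mulgA -val_actS // D_act.
Qed.

Lemma len_actD s x : s \in S -> ~~ xcomm s x -> D s (val x) ->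
  len (val x) = (len (val (xact s x))).+2.
Proof.
move=> sS nsx Dsx; rewrite -{1}[x](actSK _ sS) len_act ?comm_act //.
by rewrite D_act // Dsx.
Qed.

(** The action of [T_s] read in coordinates: the value at [x] collects contributions from the basis
    vectors at [x] and at [s x s], so the term with [h] depends on whether the target [x] has the
    descent. *)
Definition Top s m x : R :=
  (if xcomm s x then c * m x
   else m (xact s x) + (if D s (val x) then h * m x else 0))%R.

Definition Tw l m : X -> R := foldr Top m l.

Lemma Tw_cat l1 l2 m : Tw (l1 ++ l2) m = Tw l1 (Tw l2 m).
Proof. by rewrite /Tw foldr_cat. Qed.

Lemma Tw_rcons l s m : Tw (rcons l s) m = Tw l (Top s m).
Proof. by rewrite -cats1 Tw_cat. Qed.

Lemma Top_lin s a b m m' :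
  Top s (fun x => a * m x + b * m' x)%R = (fun x => a * Top s m x + b * Top s m' x)%R.
Proof.
by apply: funext => x; rewrite /Top; case: ifP => _; last case: ifP => _; ring.
Qed.

Lemma Tw_lin l a b m m' :
  Tw l (fun x => a * m x + b * m' x)%R = (fun x => a * Tw l m x + b * Tw l m' x)%R.
Proof. by elim: l => //= s l ->; rewrite Top_lin. Qed.

Lemma Top_quad s m : s \in S -> Top s (Top s m) = (fun x => 1 * m x + h * Top s m x)%R.
Proof.
move=> sS; apply: funext => x; rewrite /Top comm_act //.
have [_|nsx] := boolP (xcomm s x).
  by transitivity (c * c * m x)%R; [ring | rewrite c_quad; ring].
by rewrite actSK // D_act //; case: (D s (val x)) => /=; ring.
Qed.

Lemma Top_comm s m x : xcomm s x -> Top s m x = (c * m x)%R.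
Proof. by rewrite /Top => ->. Qed.

Lemma Top_asc s m x : ~~ xcomm s x -> ~~ D s (val x) -> Top s m x = m (xact s x).
Proof. by rewrite /Top => /negbTE-> /negbTE->; rewrite addr0. Qed.

Lemma Top_act s m x : s \in S -> ~~ xcomm s x -> ~~ D s (val x) ->
  Top s m (xact s x) = (m x + h * m (xact s x))%R.
Proof.
by move=> sS nsx nD; rewrite /Top comm_act // (negbTE nsx) D_act // nD actSK.
Qed.

Lemma len_conj_le l x : all (mem S) l -> len (val x ^ wprod l) <= len (val x) + (size l).*2.
Proof.
elim: l x => [|s l IH] x /=; first by rewrite wprod_nil conjg1 addn0.
case/andP=> sS lS; rewrite wprod_cons conjgM -val_act ?memSW //.
apply: leq_trans (IH _ lS) _.
have [sx|nsx] := boolP (xcomm s x); first by rewrite act_comm //; lenlia len.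
have [Dsx|Dsx] := boolP (D s (val x)).
  by have := len_actD sS nsx Dsx; lenlia len.
by rewrite len_act //; lenlia len.
Qed.

(** A gain of two per letter is the largest possible, so every letter is a strict ascent and only
    the transport term of [Top] survives. *)
Lemma Tw_ascending l x m : all (mem S) l ->
  len (val x ^ wprod l) = (len (val x) + (size l).*2)%N ->
  Tw l m x = m (xact (wprod l) x).
Proof.
elim: l x => [|s l IH] x /=; first by rewrite wprod_nil act1.
case/andP=> sS lS; rewrite wprod_cons conjgM -val_act ?memSW // => El.
have := len_conj_le (xact s x) lS; rewrite El => lel.
have [sx|nsx] := boolP (xcomm s x).
  by move: lel; rewrite act_comm //; lenlia len.
have [Dsx|Dsx] := boolP (D s (val x)).
  by have := len_actD sS nsx Dsx; lenlia len.
rewrite /Top (negbTE nsx) (negbTE Dsx) addr0 IH //.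
  by rewrite actM ?(memSW sS) // wprod_gen.
by rewrite El len_act //; lenlia len.
Qed.

(** The descent [r] appears at some letter of the word over [J]; folding there expresses [r]
    conjugated by [z] as a conjugate of that letter inside the subgroup. *)
Lemma not_D_mul (J : {set gT}) r z l : J \subset S -> r \in S -> z \in W -> ~~ D r z ->
  all (mem J) l -> D r (z * wprod l) -> exists2 v, v \in <<J>> & r * z = z * v.
Proof.
move=> JS rS zW nD; elim/last_ind: l => [|l x IH].
  by rewrite wprod_nil mulg1 (negbTE nD).
rewrite all_rcons => /andP[xJ lJ]; rewrite wprod_rcons mulgA => Dx.
have [Dl|nDl] := boolP (D r (z * wprod l)); first exact: IH.
have lW : z * wprod l \in W by rewrite groupM // (sub_W JS) // wprod_gen.
have := cox_exchange cox rS (subsetP JS x xJ) lW.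
rewrite Dx (negbTE nDl) => /(_ isT) E.
exists (wprod l * x * (wprod l)^-1).
  by rewrite !groupM ?groupV ?wprod_gen // mem_gen.
by rewrite !mulgA -E -mulgA mulgK.
Qed.

(** * Braid relations for two generators *)

Section Dihedral.

Variables (s t : gT) (sS : s \in S) (tS : t \in S).
Local Notation J := [set s; t].

Let JS : J \subset S.
Proof. by apply/subsetP => x; rewrite !inE => /orP[]/eqP->. Qed.

Let sJ : s \in J. Proof. by rewrite !inE eqxx. Qed.
Let tJ : t \in J. Proof. by rewrite !inE eqxx orbT. Qed.

Lemma alt_all k (a b : gT) : a \in J -> b \in J -> all (mem J) (alt k a b).
Proof. by elim: k a b => //= k IH a b aJ bJ; rewrite aJ IH. Qed.

Section MinRep.

Variables (d : gT) (dW : d \in W) (dd : d * d = 1).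
Hypothesis nod : forall r, r \in J -> ~~ D r d.

Let dV : d^-1 = d. Proof. by apply/eqP; rewrite eq_invg_mul dd. Qed.

Lemma min_len_mulr q : q \in <<J>> -> len (d * q) = (len d + len q)%N.
Proof.
move=> qJ; have qW := sub_W JS qJ.
rewrite -(len_inv cox) ?groupM // invMg dV (coset_add cox JS) ?groupV //.
by rewrite (len_inv cox) // addnC.
Qed.

(** By lengths: [r * d] is one longer than [d], and lengths add in [d * v], so [v] is a single
    letter. *)
Lemma min_normal r v : r \in J -> v \in <<J>> -> r * d = d * v -> v \in J.
Proof.
move=> rJ vJ /(congr1 len); rewrite min_len_mulr //.
rewrite (lenN cox (subsetP JS r rJ) dW (nod rJ)) => E.
have [l [lJ <- sl]] : exists l, [/\ all (mem J) l, wprod l = v & size l = 1%N].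
  have [l [lJ lv sl]] := J_word cox JS vJ.
  by exists l; split=> //; lenlia len.
case: l lJ sl => [|a [|b l]] //= /andP[aJ _] _.
by rewrite wprod_cons wprod_nil mulg1.
Qed.

Lemma min_not_D r q : r \in J -> q \in <<J>> ->
  (forall v, v \in J -> r * d != d * v) -> ~~ D r (d * q).
Proof.
move=> rJ qJ ne; apply/negP => Dr; have [l lJ lq] := word_gen qJ.
have rS := subsetP JS r rJ.
have [|v vJ E] := not_D_mul JS rS dW (nod rJ) lJ; first by rewrite lq.
by have := ne v (min_normal rJ vJ E); rewrite E eqxx.
Qed.

Lemma min_len_double p q : p \in <<J>> -> q \in <<J>> ->
  (forall r, r \in J -> ~~ D r (d * q)) ->
  len (p * (d * q)) = (len p + len d + len q)%N.
Proof.
move=> pJ qJ nodq; have qW := sub_W JS qJ.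
by rewrite (coset_add cox JS) ?groupM // min_len_mulr // addnA.
Qed.

End MinRep.

Hypothesis nst : s != t.
Variable k : nat.
Local Notation p := (wprod (alt k s t)).
Hypothesis Ep : p = wprod (alt k t s).
Hypothesis lp : len p = k.

Let pJ : p \in <<J>>. Proof. by apply: wprod_gen; apply: alt_all. Qed.

(** Commuting distinct [s], [t] have braid length two, and [x s x = t] gives [s x s = t x t]: both
    words climb to the same element and come back. *)
Lemma braid_commuting x m : commute s t -> ~~ xcomm s x -> ~~ xcomm t x ->
  ~~ D s (val x) -> ~~ D t (val x) -> val x * s * val x = t ->
  Tw (alt k s t) m x = Tw (alt k t s) m x.
Proof.
move=> st nsx ntx nDs nDt xsx.
move: Ep lp; case: (k) => [|[|[|k']]] //=; last first.
- move=> _; rewrite !wprod_cons (mulgA s t) st -mulgA SK // => lk.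
  have := cox_len_le cox (l := t :: alt k' t s).
  rewrite /= tS (sub_all JS (alt_all k' tJ sJ)) size_alt wprod_cons => /(_ isT).
  by lenlia len.
- move=> _ _; have E : xact s x = xact t x.
    apply: val_inj; rewrite !val_actS // -{1}xsx -(mulgA _ (val x) (val x)) XX mulg1.
    by rewrite -(mulgA (val x) s t) st -xsx !mulgA XX mul1g.
  by rewrite (Top_asc _ nsx nDs) (Top_asc _ ntx nDt) {1}E Top_act // -E Top_act.
- by rewrite !wprod_cons wprod_nil !mulg1 => E; case/eqP: nst.
Qed.

(** Conjugation by [x] carries no letter to a letter, so lengths add in [p^-1 x p]: both words climb
    at every letter and end at the same conjugate. *)
Lemma braid_generic x m : ~~ xcomm s x -> ~~ xcomm t x ->
  ~~ D s (val x) -> ~~ D t (val x) -> val x * s * val x != t ->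
  Tw (alt k s t) m x = Tw (alt k t s) m x.
Proof.
move=> nsx ntx nDs nDt xsx.
have nod r : r \in J -> ~~ D r (val x) by rewrite !inE => /orP[]/eqP->.
have ne r v : r \in J -> v \in J -> r * val x != val x * v.
  rewrite !inE => /orP[]/eqP-> /orP[]/eqP-> //.
    by apply: contra xsx => /eqP E; rewrite -mulgA E mulgA XX mul1g.
  by apply: contra xsx => /eqP E; rewrite -E -mulgA XX mulg1.
have lx : len (val x ^ p) = (len (val x) + k.*2)%N.
  rewrite conjgE (min_len_double (XW x) (XX x)) ?groupV //.
    by rewrite (len_inv cox) ?(sub_W JS) // lp; lenlia len.
  by move=> r rJ; apply: min_not_D; rewrite ?XX // => v; apply: ne.
by rewrite !Tw_ascending ?(sub_all JS) ?alt_all -?Ep ?size_alt.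
Qed.

(** Here [x] is [s] times an element commuting with both letters, so [perf_comm] becomes
    [(s t)^4 = 1]. Since [s] and [t] do not commute, the only nontrivial braid length is four, and
    that case is computed directly. *)
Lemma braid_rank2_B x m d : d \in W -> d * d = 1 -> commute s d -> commute t d ->
  val x = s * d -> ~~ xcomm t x -> ~~ D t (val x) ->
  Tw (alt k s t) m x = Tw (alt k t s) m x.
Proof.
move=> dW dd sd td xE ntx nDt.
have tst : t * (s * (t * s)) = s * (t * (s * t)).
  have := perf_comm perf (valP x) tS; rewrite xE /commute.
  have -> : s * d * t * (s * d) = s * t * s.
    by rewrite -(mulgA s d t) -td !mulgA -(mulgA (s * t) d s) -sd mulgA -(mulgA _ d d)
      dd mulg1.
  by rewrite !mulgA.
have nst2 : s * t <> t * s.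
  move=> st; case/negP: ntx; apply/eqP.
  by rewrite xE mulgA -st -!mulgA td.
move: Ep lp; case: (k) => [|[|[|[|[|k']]]]] //=.
- by rewrite !wprod_cons wprod_nil !mulg1 => E; case/eqP: nst.
- by rewrite !wprod_cons wprod_nil !mulg1.
- rewrite !wprod_cons wprod_nil !mulg1 => E; case: nst2.
  by have := tst; rewrite E SK // -E SK.
- move=> _ _; have sx : xcomm s x.
    by apply/eqP; rewrite xE -(mulgA s d s) -sd.
  have sx1 : xcomm s (xact t x).
    apply/eqP; rewrite val_actS // xE.
    have -> : t * (s * d) * t = t * s * t * d by rewrite -!mulgA -td.
    rewrite -(mulgA _ d s) -sd !mulgA; congr (_ * _).
    by rewrite -!mulgA tst.
  rewrite Top_comm // !(Top_asc _ ntx nDt) Top_comm // Top_act // Top_comm //.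
  rewrite Top_act // !Top_comm //; ring.
(* With five or more letters, [s t s t s] equals [t s t], so the word is not reduced. *)
- move=> _; rewrite !wprod_cons => lk.
  have := cox_len_le cox (l := [:: t, s, t & alt k' t s]).
  rewrite /= !tS sS (sub_all JS (alt_all k' tJ sJ)) size_alt !wprod_cons => /(_ isT).
  move: lk; rewrite (_ : s * _ = t * (s * (t * wprod (alt k' t s)))); first by lenlia len.
  rewrite -[t * (s * (t * wprod _))]mulg1.
  transitivity (s * (t * (s * t)) * (s * wprod (alt k' t s))); first by rewrite !mulgA.
  by rewrite -tst -!mulgA SK // mulg1.
Qed.

(** Let [d] be the shorter of [x] and [s x]. If [t] commutes with [d], then [x = s d] and the
    previous case applies. Otherwise all letters but one climb strictly, and the remaining one
    commutes ([s] at [x], or its conjugate [r] at the top), so both sides are [c] times the value at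
    the top. *)
Lemma braid_half x m : xcomm s x -> ~~ xcomm t x -> ~~ D t (val x) ->
  Tw (alt k s t) m x = Tw (alt k t s) m x.
Proof.
move=> sx ntx nDt; have sxE := eqP sx.
pose d := if D s (val x) then s * val x else val x.
have dW : d \in W by rewrite /d; case: ifP => _; rewrite ?SW.
have sd : commute s d.
  by rewrite /d; case: ifP => _; rewrite /commute // -mulgA -sxE.
have dd : d * d = 1.
  rewrite /d; case: ifP => _; rewrite ?XX // {1}sxE -mulgA SK // XX.
  by [].
have nod r : r \in J -> ~~ D r d.
  rewrite !inE /d => /orP[]/eqP->; case: ifPn => // Ds.
    by rewrite (cox_DM cox) // Ds.
  apply: contraNN nst => Dt; apply/eqP; apply: (mulIg (val x)); rewrite sxE.
  apply/esym; apply: (cox_exchange cox tS sS (XW x)).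
  by rewrite -sxE Dt (negbTE nDt).
have [td|ntd] := eqVneq (t * d) (d * t).
  apply: (@braid_rank2_B x m d) => //; rewrite /d in td *.
  case: ifP td => [_ _|_ td]; first by rewrite SK.
  by case/eqP: ntx.
move: Ep lp; case: (k) => [|k']; first by [].
rewrite [alt k'.+1 t s]alt_rcons [alt _ s t]/=; set a := alt k' t s; set r := altlast k' t s.
set q := wprod a; rewrite wprod_cons wprod_rcons -/q => E lq.
have aJ : all (mem J) a by apply: alt_all.
have aS := sub_all JS aJ.
have qJ : q \in <<J>> by apply: wprod_gen.
have qW := sub_W JS qJ.
have lenq : len q = k'.
  have := cox_len_le cox aS; rewrite -/q size_alt.
  by have := len_mulS cox sS qW; rewrite lq; lenlia len.
have nodq r' : r' \in J -> ~~ D r' (d * q).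
  rewrite !inE => /orP[]/eqP->.
    rewrite (D_len cox) ?groupM // mulgA sd -mulgA.
    rewrite !(min_len_mulr dW dd) // ?groupM // ?mem_gen // lq lenq.
    by lenlia len.
  apply: min_not_D => // v; rewrite !inE => /orP[]/eqP-> //.
  by rewrite -sd; apply: contraNN nst => /eqP/mulIg->.
have lx : len (val x ^ q) = (len (val x) + k'.*2)%N.
  rewrite conjgE; have [Ds|nDs] := boolP (D s (val x)).
    have xE : val x = s * d by rewrite /d Ds SK.
    rewrite xE -!mulgA (mulgA q^-1) -[s in q^-1 * s](invS cox sS) -invMg.
    rewrite (min_len_double dW dd) ?groupV ?groupM // ?mem_gen //.
    rewrite (len_inv cox) ?SW // lq lenq (lenN cox) ?nod //.
    by lenlia len.
  have -> : val x = d by rewrite /d (negbTE nDs).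
  rewrite (min_len_double dW dd) ?groupV // (len_inv cox) // lenq.
  by lenlia len.
rewrite Tw_rcons /= Top_comm // !Tw_ascending ?size_alt //.
rewrite Top_comm // /xcomm val_act // -/q.
have -> : r = s ^ q by rewrite conjgE E mulKg.
by rewrite -!conjMg sxE.
Qed.

End Dihedral.

Lemma braid_min s t k x m : s \in S -> t \in S -> s != t ->
  wprod (alt k s t) = wprod (alt k t s) -> len (wprod (alt k s t)) = k ->
  xcomm s x || ~~ D s (val x) -> xcomm t x || ~~ D t (val x) ->
  Tw (alt k s t) m x = Tw (alt k t s) m x.
Proof.
move=> sS tS nst E lk; have nts : t != s by rewrite eq_sym.
have lk' : len (wprod (alt k t s)) = k by rewrite -E.
have [sx _|nsx /= nDs] := boolP (xcomm s x); have [tx _|ntx /= nDt] := boolP (xcomm t x).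
- have tw k' a b : xcomm a x -> xcomm b x -> Tw (alt k' a b) m x = (c ^+ k' * m x)%R.
    elim: k' a b => [|k' IH] a b ax bx /=; first by rewrite expr0 mul1r.
    by rewrite Top_comm // IH // exprS mulrA.
  by rewrite !tw.
- exact: braid_half.
- by apply/esym; apply: braid_half.
have [xsx|nxsx] := eqVneq (val x * s * val x) t; last exact: braid_generic.
apply: braid_commuting => //; rewrite -xsx.
exact: (perf_comm perf (valP x) sS).
Qed.

(** Induction on the length of [x]. At a descent [a], write [x = a y a] with [y] shorter: a value at
    [x] is a value of [Top a] at [y]. On one side this creates a square at once, on the other after
    moving the extra letter through by the induction hypothesis; the quadratic relation then makes
    the two sides equal. *)
Lemma braid s t k m : s \in S -> t \in S -> s != t ->
  wprod (alt k s t) = wprod (alt k t s) -> len (wprod (alt k s t)) = k ->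
  Tw (alt k s t) m = Tw (alt k t s) m.
Proof.
move=> sS tS nst E lk; apply: funext => x.
have [j] := ubnP (len (val x)); elim: j x m => // j IH x m; rewrite ltnS => lej.
have step a b : a \in S -> b \in S -> ~~ xcomm a x -> D a (val x) ->
    (forall m' y, len (val y) < j -> Tw (alt k a b) m' y = Tw (alt k b a) m' y) ->
    Tw (alt k a b) m x = Tw (alt k b a) m x.
  move=> aS bS nax Da IHa; set y := xact a x.
  have nay : ~~ xcomm a y by rewrite comm_act.
  have nDy : ~~ D a (val y) by rewrite D_act // Da.
  have ly : len (val y) < j.
    by have := len_actD aS nax Da; rewrite -/y; lenlia len.
  have xy m' : m' x = Top a m' y by rewrite Top_asc // actSK.
  rewrite (xy (Tw (alt k a b) m)) (xy (Tw (alt k b a) m)).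
  case: {E lk IH} k IHa => [//|k'] IHa.
  rewrite (_ : Top a (Tw (alt k'.+1 b a) m) = Tw (alt k'.+2 a b) m) //.
  rewrite [alt k'.+2 a b]alt_rcons Tw_rcons.
  rewrite (IHa (Top _ m)) // [alt k'.+1 b a]alt_rcons Tw_rcons [altlast k'.+1 a b]/=.
  rewrite [Top (altlast _ _ _) (Top _ m)]Top_quad; last first.
    have : all (mem S) (rcons (alt k' b a) (altlast k' b a)).
      rewrite -alt_rcons; apply: (sub_all (J := [set b; a])).
        by apply/subsetP => z; rewrite !inE => /orP[]/eqP->.
      by apply: alt_all; rewrite !inE eqxx ?orbT.
    by rewrite all_rcons => /andP[].
  rewrite [Tw (alt k'.+1 a b) m]/= Top_quad // Tw_lin -Tw_rcons -alt_rcons -IHa //.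
have [|] := boolP (xcomm s x || ~~ D s (val x)); last first.
  by rewrite negb_or negbK => /andP[nsx Ds]; apply: step => // m' y; apply: IH.
have [|] := boolP (xcomm t x || ~~ D t (val x)); last first.
  rewrite negb_or negbK => /andP[ntx Dt] _; apply/esym; apply: step => // m' y ly.
  by apply/esym; apply: IH.
by move=> tm sm; apply: braid_min.
Qed.

Lemma reduced_alt s t l : s \in S -> t \in S -> all (mem [set s; t]) l ->
  len (wprod l) = size l -> head s l = s -> l = alt (size l) s t.
Proof.
elim: l s t => [|a l IH] s t sS tS //= /andP[aJ lJ] + E; rewrite {}E in aJ *.
rewrite wprod_cons => redl; congr (_ :: _).
have lS : all (mem S) l.
  apply: (sub_all (J := [set s; t])) lJ.
  by apply/subsetP => z; rewrite !inE => /orP[]/eqP->.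
have lW : wprod l \in W by apply: wprod_gen.
have redl' : len (wprod l) = size l.
  by have := len_mulS cox sS lW; have := cox_len_le cox lS; rewrite redl; lenlia len.
apply: IH => //; first by rewrite setUC.
case: l lJ redl redl' lS lW => [|b l] //= /andP[bJ lJ] redl redl' lS lW.
move: bJ; rewrite !inE => /orP[/eqP bs|/eqP//].
have := cox_len_le cox (l := l); move: lS => /andP[_ ->] /(_ isT).
by move: redl; rewrite bs wprod_cons SK //; lenlia len.
Qed.

(** Write the common element as [u * d] with [u] in the dihedral group of the two first letters.
    Both letters are descents of [u], so both alternating words express it. Words with the same
    first letter are compared by induction, the two alternating words by the braid relation. *)
Theorem matsumoto l1 l2 m : all (mem S) l1 -> all (mem S) l2 ->
  wprod l1 = wprod l2 -> len (wprod l1) = size l1 -> size l2 = size l1 ->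
  Tw l1 m = Tw l2 m.
Proof.
have [k] := ubnP (size l1); elim: k l1 l2 m => // k IH [|s l1] [|t l2] m //=.
rewrite ltnS => lek /andP[sS l1S] /andP[tS l2S] E red1 [sl].
have red2 : len (wprod (t :: l2)) = (size l1).+1 by rewrite -E.
have tail a l : a \in S -> all (mem S) l -> len (wprod (a :: l)) = (size l).+1 ->
    len (wprod l) = size l.
  move=> aS lS; rewrite wprod_cons; have := len_mulS cox aS (wprod_gen lS).
  by have := cox_len_le cox lS; lenlia len.
have r1 := tail _ _ sS l1S red1.
have r2 : len (wprod l2) = size l2 by apply: (tail t) => //; rewrite sl.
have [st|nst] := eqVneq s t.
  subst t; congr (Top s _); apply: IH => //.
  by move: E; rewrite !wprod_cons => /mulgI.
have JS : [set s; t] \subset S by apply/subsetP => z; rewrite !inE => /orP[]/eqP->.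
have sJ : s \in [set s; t] by rewrite !inE eqxx.
have tJ : t \in [set s; t] by rewrite !inE eqxx orbT.
have pW : wprod (s :: l1) \in W by apply: wprod_gen; rewrite /= sS.
have [u [d [uJ dW Eud lud nod]]] := coset_min cox JS pW.
have [ld [ldS ldw sld]] := cox_word cox dW.
have uW := sub_W JS uJ.
have altu a b l : [set a; b] = [set s; t] -> a \in S -> b \in S -> all (mem S) l ->
    wprod (a :: l) = u * d -> size l = size l1 -> u = wprod (alt (len u) a b).
  move=> ab aS bS lS Eal sal.
  have auJ : a * u \in <<[set s; t]>> by rewrite groupM // -ab mem_gen // !inE eqxx.
  have [l' [l'J l'w sl']] := J_word cox JS auJ.
  have lau : len u = (len (a * u)).+1.
    have := coset_add cox JS dW nod auJ.
    rewrite -mulgA -Eal wprod_cons SK //.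
    have := cox_len_le cox lS; have := len_mulS cox aS uW.
    have : len (a * (a * u)) <= (len (a * u)).+1 by rewrite (len_mulS cox) ?SW.
    by rewrite SK //; lenlia len.
  have u' : u = wprod (a :: l') by rewrite wprod_cons l'w SK.
  have su : size (a :: l') = len u by rewrite /= sl' lau.
  rewrite {1}u' -su; congr wprod; apply: reduced_alt => //=.
    by rewrite ab l'J -ab !inE eqxx.
  by rewrite -u' -su.
have us : u = wprod (alt (len u) s t) by apply: (altu s t l1).
have ut : u = wprod (alt (len u) t s).
  by apply: (altu t s l2) => //; [rewrite setUC | rewrite -E].
have lu0 : 0 < len u.
  case: (posnP (len u)) => // lu0; have u1 := len_eq0 cox uW lu0.
  have dE : d = wprod (s :: l1) by rewrite Eud u1 mul1g.
  have := nod s sJ; rewrite (D_len cox) // dE {1}wprod_cons SK // r1 red1.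
  by rewrite ltnSn.
have via a b l : [set a; b] = [set s; t] -> a \in S -> b \in S -> all (mem S) l ->
    wprod (a :: l) = u * d -> size l = size l1 -> len (wprod l) = size l ->
    u = wprod (alt (len u) a b) -> Tw (a :: l) m = Tw (alt (len u) a b) (Tw ld m).
  move=> ab aS bS lS Eal sal redl ua; rewrite -Tw_cat.
  case: (len u) lu0 ua (lud) => // k' _ ua lud'; rewrite /= -/(Tw _ _); congr (Top a _).
  apply: IH; rewrite ?sal // ?all_cat ?ldS ?andbT //.
  - apply: (sub_all JS); rewrite -ab; apply: alt_all; rewrite !inE eqxx ?orbT //.
  - by apply: (mulgI a); rewrite -wprod_cons Eal {1}ua wprod_cat wprod_cons ldw mulgA.
  - by rewrite redl sal.
  - by rewrite size_cat size_alt sld; move: lud'; rewrite red1; lenlia len.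
have -> : Top s (Tw l1 m) = Tw (alt (len u) s t) (Tw ld m) by apply: (via s t l1).
have -> : Top t (Tw l2 m) = Tw (alt (len u) t s) (Tw ld m).
  by apply: (via t s l2) => //; [rewrite setUC | rewrite -E].
apply: braid => //; first by rewrite -us -ut.
by rewrite -us.
Qed.

(** * Inverse operators and bar images of basis vectors *)

Definition Tbar s m x : R := (Top s m x - h * m x)%R.

Definition Tbw l m : X -> R := foldr Tbar m l.

Lemma Tbar_scale s a m : Tbar s (fun x => a * m x)%R = (fun x => a * Tbar s m x)%R.
Proof.
apply: funext => x; rewrite /Tbar /Top.
by case: ifP => _; last case: ifP => _; ring.
Qed.

Lemma Tbw_scale l a m : Tbw l (fun x => a * m x)%R = (fun x => a * Tbw l m x)%R.
Proof. by elim: l => //= s l ->; rewrite Tbar_scale. Qed.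

Lemma TopK s m : s \in S -> Tbar s (Top s m) = m.
Proof.
move=> sS; apply: funext => x; rewrite /Tbar Top_quad //; ring.
Qed.

Lemma TbarK s m : s \in S -> Top s (Tbar s m) = m.
Proof.
move=> sS; have -> : Tbar s m = (fun x => 1 * Top s m x + (- h) * m x)%R.
  by apply: funext => x; rewrite /Tbar; ring.
by rewrite Top_lin Top_quad //; apply: funext => x; ring.
Qed.

Lemma Tbw_cat l1 l2 m : Tbw (l1 ++ l2) m = Tbw l1 (Tbw l2 m).
Proof. by rewrite /Tbw foldr_cat. Qed.

Lemma Tbw_rcons l s m : Tbw (rcons l s) m = Tbw l (Tbar s m).
Proof. by rewrite -cats1 Tbw_cat. Qed.

Lemma TwK l m : all (mem S) l -> Tbw l (Tw (rev l) m) = m.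
Proof.
elim: l m => //= s l IH m /andP[sS lS].
by rewrite rev_cons Tw_rcons IH // TopK.
Qed.

Lemma TbwK l m : all (mem S) l -> Tw (rev l) (Tbw l m) = m.
Proof.
elim: l m => //= s l IH m /andP[sS lS].
by rewrite rev_cons Tw_rcons TbarK // IH.
Qed.

Lemma matsumoto_bar l1 l2 m : all (mem S) l1 -> all (mem S) l2 ->
  wprod l1 = wprod l2 -> len (wprod l1) = size l1 -> size l2 = size l1 ->
  Tbw l1 m = Tbw l2 m.
Proof.
move=> l1S l2S E red sl.
rewrite -{1}(TbwK m l2S) (matsumoto (l2 := rev l1)) ?all_rev ?size_rev //.
- by rewrite TwK.
- by rewrite !(wprod_rev cox) // E.
- by rewrite (wprod_rev cox) // (len_inv cox) ?wprod_gen // -E red sl.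
Qed.

Definition xdelta x y : R := ((y == x)%:R)%R.

Lemma act_inj s x y : s \in S -> (xact s y == x) = (y == xact s x).
Proof.
by move=> sS; apply/eqP/eqP => [<-|->]; rewrite actSK.
Qed.

Lemma Tbar_delta_comm s x : s \in S -> xcomm s x ->
  Tbar s (xdelta x) = (fun y => (c - h) * xdelta x y)%R.
Proof.
move=> sS sx; apply: funext => y; rewrite /Tbar /Top /xdelta.
rewrite act_inj // (act_comm sS sx); have [->|_] := eqVneq y x.
  by rewrite sx /=; ring.
by case: ifP => _; last case: ifP => _; rewrite !mulr0 subr0 ?addr0.
Qed.

Lemma Top_delta_asc s x : s \in S -> ~~ xcomm s x -> ~~ D s (val x) ->
  Top s (xdelta x) = xdelta (xact s x).
Proof.
move=> sS nsx nD; apply: funext => y; rewrite /Top /xdelta act_inj //.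
have nxx : x != xact s x.
  by apply/eqP => xx; have := D_act sS nsx; rewrite -xx; case: (D s _).
have [->|nyx] := eqVneq y x; first by rewrite (negbTE nsx) (negbTE nD) addr0.
case: ifPn => [sy|_]; last by case: ifP => _; rewrite ?mulr0 addr0.
rewrite mulr0; have [yx|//] := eqVneq y (xact s x).
by move: sy; rewrite yx comm_act // (negbTE nsx).
Qed.

Definition xword x : seq gT := sval (cid (cox_word cox (XW x))).

Lemma xwordP x :
  [/\ all (mem S) (xword x), wprod (xword x) = val x & size (xword x) = len (val x)].
Proof. by rewrite /xword; case: cid. Qed.

(** Inverting each letter of a word of [x] in place gives the inverse of the operator of the
    reversed word, hence the inverse of [T_{x^-1}]. *)
Definition barM x : X -> R := Tbw (xword x) (xdelta x).

Lemma barM_word x l : all (mem S) l -> wprod l = val x -> size l = len (val x) ->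
  barM x = Tbw l (xdelta x).
Proof.
move=> lS lx sl; have [xS wx sx] := xwordP x.
by apply: matsumoto_bar; rewrite // ?wx ?lx ?sl.
Qed.

(** A reduced word of [s x s] is one of [x] between two letters [s]. The inner inverse undoes
    [M_{sxs} = T_s M_x]; the outer one remains. *)
Lemma barM_asc s x : s \in S -> ~~ xcomm s x -> ~~ D s (val x) ->
  barM (xact s x) = Tbar s (barM x).
Proof.
move=> sS nsx nD; have [xS wx sx] := xwordP x.
rewrite (@barM_word _ (s :: rcons (xword x) s)); first last.
- by rewrite len_act //= size_rcons sx.
- by rewrite wprod_cons wprod_rcons wx val_actS // mulgA.
- by rewrite /= sS all_rcons /= sS.
by rewrite /= -/(Tbw _ _) Tbw_rcons -Top_delta_asc // TopK.
Qed.

(** Since [s x = x s], a reduced word with [s] in front can be traded for one with [s] at the end,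
    so [T_s^-1] reaches [M_x] itself, where it is the scalar [c - h], the inverse of [c]. *)
Lemma barM_comm s x : s \in S -> xcomm s x ->
  Tbar s (barM x) = (fun y => (c - h) * barM x y)%R.
Proof.
move=> sS sx; have sxE := eqP sx; have [xS wx lx] := xwordP x.
have [Ds|nDs] := boolP (D s (val x)).
  have [l [lS lw sl]] := cox_word cox (SW sS (XW x)).
  have lx' := lenD cox sS (XW x) Ds.
  have -> : Tbar s (barM x) = Tbw (s :: l) (Tbar s (xdelta x)).
    rewrite (@barM_word x (rcons l s)) ?Tbw_rcons //.
    - by rewrite all_rcons /= sS.
    - by rewrite wprod_rcons lw sxE KS.
    - by rewrite size_rcons sl lx'.
  rewrite Tbar_delta_comm // Tbw_scale (@barM_word x (s :: l)) //.
  - by rewrite /= sS.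
  - by rewrite wprod_cons lw SK.
  - by rewrite /= sl lx'.
have -> : Tbar s (barM x) = Tbw (s :: xword x) (xdelta x) by [].
rewrite (@matsumoto_bar _ (rcons (xword x) s)).
- by rewrite Tbw_rcons Tbar_delta_comm // Tbw_scale.
- by rewrite /= sS.
- by rewrite all_rcons /= sS.
- by rewrite wprod_rcons wprod_cons wx.
- by rewrite wprod_cons wx (lenN cox) // [size _]/= lx.
- by rewrite size_rcons.
Qed.

Definition xmin x : Prop := forall s, s \in S -> xcomm s x || ~~ D s (val x).

(** Write [x = u d] with [u] in the parabolic subgroup of commuting reflections and [d] shortest.
    Then [x = d u] too, so a descent of [d] is a descent of [x]; by minimality it commutes with [x],
    which contradicts the choice of [d]. Hence [d = 1]. *)
Lemma xmin_gen x : xmin x -> val x \in <<[set s in S | xcomm s x]>>.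
Proof.
set J := [set s in S | xcomm s x] => xm.
have JS : J \subset S by apply/subsetP => s; rewrite inE => /andP[].
have [u [d [uJ dW E lE nod]]] := coset_min cox JS (XW x).
have ux : u * val x = val x * u.
  have /subsetP/(_ u uJ)/cent1P// : <<J>> \subset 'C[val x].
  rewrite gen_subG; apply/subsetP => s; rewrite inE => /andP[_ /eqP sx].
  exact/cent1P.
have xE : val x = d * u.
  by apply: (mulgI u); rewrite ux {1}E mulgA.
have [d1|d1] := eqVneq d 1; first by rewrite E d1 mulg1.
have [s sS Ds] := exists_descent cox dW d1.
have uW := sub_W JS uJ.
have Dx : D s (val x).
  rewrite (D_len cox) // {1}xE mulgA; have := len_mul cox (SW sS dW) uW.
  have := lenD cox sS dW Ds; lenlia len.
have sJ : s \in J by have := xm s sS; rewrite Dx orbF inE sS.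
by have := nod s sJ; rewrite Ds.
Qed.

Variable e : nat.
Hypothesis min_len : forall x, xmin x -> len (val x) = e.

Lemma barM_min x : xmin x -> barM x = (fun y => (c - h) ^+ e * xdelta x y)%R.
Proof.
move=> xm; have xJ := xmin_gen xm; set J := [set s in S | xcomm s x] in xJ.
have JS : J \subset S by apply/subsetP => s; rewrite inE => /andP[].
have [l [lJ lx sl]] := J_word cox JS xJ.
rewrite (barM_word (sub_all JS lJ)) // -(min_len xm) -{}sl {lx}.
elim: l lJ => [|s l IH] /=; first by move=> _; apply: funext => y; rewrite expr0 mul1r.
rewrite inE -andbA => /and3P[sS sx lJ]; rewrite IH //.
by rewrite Tbar_scale Tbar_delta_comm //; apply: funext => y; rewrite exprSr mulrA.
Qed.

Lemma not_xmin x : ~ xmin x -> exists s, [/\ s \in S, ~~ xcomm s x & D s (val x)].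
Proof.
move=> nm; have [/existsP[s /and3P[sS nsx Ds]]|/existsPn no] :=
  boolP [exists s, [&& s \in S, ~~ xcomm s x & D s (val x)]]; first by exists s.
case: nm => s sS; have := no s; rewrite sS /= negb_and negbK.
by [].
Qed.

(** [Tbar s] at [x] reads the value at [s x s], so the diagonal entry is carried up unchanged from a
    minimal element; all other terms vanish because one conjugation changes lengths by at most
    two. *)
Lemma barM_triangular x :
  barM x x = ((c - h) ^+ e)%R /\
  forall y, y != x -> len (val x) <= len (val y) -> barM x y = 0%R.
Proof.
have [k] := ubnP (len (val x)); elim: k x => // k IH x; rewrite ltnS => lek.
have [xm|/not_xmin[s [sS nsx Ds]]] := pselect (xmin x).
  rewrite barM_min // /xdelta eqxx mulr1; split=> // y /negbTE->.
  by rewrite mulr0.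
set y0 := xact s x; have lx := len_actD sS nsx Ds; rewrite -/y0 in lx.
have [|B0 B1] := IH y0; first by move: lx lek; lenlia len.
have -> : barM x = Tbar s (barM y0).
  by rewrite -{1}[x](actSK _ sS) -/y0 barM_asc ?comm_act // D_act // Ds.
have B0' y : len (val x) <= len (val y) -> barM y0 y = 0%R.
  move=> lxy; apply: B1; last by move: lx lxy; lenlia len.
  by apply: contraTneq lxy => ->; rewrite -ltnNge lx; lenlia len.
split.
  by rewrite /Tbar /Top (negbTE nsx) Ds -/y0 B0 (B0' x) // !mulr0 subr0 addr0.
move=> y nyx lxy; rewrite /Tbar /Top B0' // !mulr0 subr0 if_same addr0.
case: ifPn => // nsy; apply: B1.
  by rewrite act_inj // /y0 actSK.
have [Dy|nDy] := boolP (D s (val y)).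
  by have := len_actD sS nsy Dy; move: lx lxy; lenlia len.
by rewrite len_act //; move: lx lxy; lenlia len.
Qed.

End Perfect.

(** * Laurent polynomials and the bar involution *)

Local Open Scope ring_scope.

Lemma evalXinvD p q : evalXinv (p + q) = evalXinv p + evalXinv q.
Proof. by rewrite /evalXinv rmorphD hornerD. Qed.

Lemma evalXinvM p q : evalXinv (p * q) = evalXinv p * evalXinv q.
Proof. by rewrite /evalXinv rmorphM hornerM. Qed.

Lemma evalXinvC (a : int) : evalXinv a%:P = a%:~R.
Proof. by rewrite /evalXinv map_polyC hornerC. Qed.

Lemma evalXinvX : evalXinv 'X = Xf^-1.
Proof. by rewrite /evalXinv map_polyX hornerX. Qed.

Lemma evalXinv0 : evalXinv 0 = 0.
Proof. by rewrite /evalXinv rmorph0 horner0. Qed.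

Lemma evalXinv1 : evalXinv 1 = 1.
Proof. by rewrite /evalXinv rmorph1 hornerC. Qed.

Lemma evalXinvN p : evalXinv (- p) = - evalXinv p.
Proof. by rewrite /evalXinv rmorphN hornerN. Qed.

Lemma evalXinvXn k : evalXinv 'X^k = Xf ^- k.
Proof. by rewrite /evalXinv map_polyXn hornerXn exprVn. Qed.

Lemma tofrac_intr (a : int) : (a%:P : {poly int})%:F = a%:~R :> Kx.
Proof. by rewrite -[a in LHS]intz rmorph_int rmorph_int. Qed.

Lemma XfX k : ('X^k : {poly int})%:F = Xf ^+ k.
Proof. by rewrite tofracXn. Qed.

Lemma Xfn_neq0 k : Xf ^+ k != 0. Proof. by rewrite expf_neq0 // Xf_neq0. Qed.

Lemma laurent_evalXinv p : laurent_pred (evalXinv p).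
Proof.
elim/poly_ind: p => [|p a IH]; first by rewrite evalXinv0; apply: rpred0.
rewrite evalXinvD evalXinvM evalXinvX evalXinvC.
by apply: rpredD; [apply: rpredM IH laurent_Xinv | apply: rpred_int].
Qed.

(** Two representations of [f] are related by [p X^j = q X^k], a polynomial identity that survives
    the substitution of [x^-1]; so the pair selected by choice in [lbar] does not matter. *)
Lemma lbar_rep f k p : lval f * Xf ^+ k = p%:F ->
  lval (lbar f) = evalXinv p * Xf ^+ k.
Proof.
move=> E; rewrite /lbar; case: cid => -[j q] /= Eq.
have Epq : p * 'X^j = q * 'X^k.
  apply/eqP; rewrite -tofrac_eq !tofracM -E -Eq !XfX; apply/eqP; ring.
have := congr1 evalXinv Epq; rewrite !evalXinvM !evalXinvXn => E'.
have -> : evalXinv q * Xf ^+ j = evalXinv p * Xf ^+ k.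
  have /(congr1 (fun y => y * Xf ^+ j * Xf ^+ k)) := E'.
  rewrite -!mulrA (mulrA (Xf ^- j)) mulVf ?Xfn_neq0 // mul1r => ->.
  by rewrite (mulrCA (Xf ^- k)) mulVf ?Xfn_neq0 // mulr1.
rewrite insubdK //; apply: rpredM; first exact: laurent_evalXinv.
by apply: rpredX; apply: laurent_X.
Qed.

Definition polyrev k (a : {poly int}) : {poly int} := \poly_(i < k.+1) a`_(k - i).

Lemma evalXinvE k (a : {poly int}) : (size a <= k)%N ->
  evalXinv a = \sum_(i < k) (a`_i)%:~R * Xf ^- i.
Proof.
move=> sa; rewrite /evalXinv (horner_coef_wide _ (n := k)).
  by apply: eq_bigr => i _; rewrite coef_map exprVn.
exact: leq_trans (size_poly _ _) sa.
Qed.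

Lemma tofracE k (a : {poly int}) : (size a <= k)%N ->
  a%:F = \sum_(i < k) (a`_i)%:~R * Xf ^+ i :> Kx.
Proof.
move=> sa; have -> : a = \sum_(i < k) a`_i *: 'X^i.
  apply/polyP => j; rewrite coef_sum; have [jk|jk] := ltnP j k.
    rewrite (bigD1 (Ordinal jk)) //= big1 ?addr0 => [|i ni].
      by rewrite coefZ coefXn eqxx mulr1.
    rewrite coefZ coefXn; case: eqP => [E|_]; last by rewrite mulr0.
    by case/eqP: ni; apply: val_inj.
  rewrite nth_default ?(leq_trans sa) // big1 // => i _.
  by rewrite coefZ coefXn gtn_eqF ?mulr0 // (leq_trans (ltn_ord i)).
rewrite rmorph_sum /=; apply: eq_bigr => i _.
rewrite -mul_polyC tofracM tofrac_intr XfX; congr (_%:~R * _).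
rewrite coef_sum (bigD1 i) //= big1 ?addr0 => [|j ni].
  by rewrite coefZ coefXn eqxx mulr1.
rewrite coefZ coefXn; case: eqP => [E|_]; last by rewrite mulr0.
by case/eqP: ni; apply: val_inj.
Qed.

Lemma polyrevE k (a : {poly int}) : (size a <= k.+1)%N -> (polyrev k a)%:F = evalXinv a * Xf ^+ k.
Proof.
move=> sa; rewrite (tofracE (size_poly _ _)) (evalXinvE sa) big_distrl /=.
rewrite (reindex_inj rev_ord_inj) /=; apply: eq_bigr => i _.
have ik : (i <= k)%N by rewrite -ltnS.
rewrite coef_poly subSS ltnS leq_subr subKn //.
rewrite -mulrA; congr (_ * _); have -> : Xf ^+ k = Xf ^+ (k - i) * Xf ^+ i.
  by rewrite -exprD subnK.
by rewrite mulrCA mulVf ?Xfn_neq0 // mulr1.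
Qed.

Lemma polyrevK k (a : {poly int}) : (size a <= k.+1)%N -> evalXinv (polyrev k a) * Xf ^+ k = a%:F.
Proof.
move=> sa; rewrite -polyrevE ?size_poly //; congr (_%:F).
apply/polyP => i; rewrite !coef_poly; case: ltnP => ik; last first.
  by rewrite nth_default // (leq_trans sa).
by rewrite ltnS leq_subr subKn.
Qed.

Lemma lbar_val f (a b : {poly int}) : lval f = evalXinv a + b%:F ->
  lval (lbar f) = a%:F + evalXinv b.
Proof.
move=> E; rewrite (@lbar_rep f (size a) (polyrev (size a) a + b * 'X^(size a))).
  rewrite evalXinvD evalXinvM evalXinvXn mulrDl polyrevK ?leqnSn //.
  by rewrite -(mulrA (evalXinv b)) mulVf ?Xfn_neq0 // mulr1.
by rewrite E mulrDl tofracD tofracM XfX polyrevE ?leqnSn.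
Qed.

(** Induction on the exponent of the denominator: dividing by [x] sends the constant term [d] of the
    nonnegative part into the negative part. *)
Lemma laurent_split f : exists a b : {poly int}, a`_0 = 0 /\ lval f = evalXinv a + b%:F.
Proof.
have [[k p] /= E] := laurent_ex f.
suff H (g : Kx) : g * Xf ^+ k = p%:F ->
    exists a b : {poly int}, a`_0 = 0 /\ g = evalXinv a + b%:F by exact: H E.
elim: k g {f E} => [|k IH] g E.
  exists 0, p; rewrite coef0 evalXinv0 add0r; split=> //.
  by rewrite -E expr0 mulr1.
have [|a [b [a0 Eg]]] := IH (g * Xf); first by rewrite -mulrA -exprS.
have [b' [d Eb]] : exists b' (d : int), b = b' * 'X + d%:P.
  elim/poly_ind: b {Eg} => [|b' d _]; last by exists b', d.
  by exists 0, 0; rewrite mul0r add0r.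
exists ('X * a + d%:P * 'X), b'; split.
  by rewrite coefD coefXM coefMX addr0.
apply: (mulIf Xf_neq0); rewrite Eg Eb evalXinvD !evalXinvM evalXinvX evalXinvC.
rewrite tofracD tofracM tofrac_intr !mulrDl (mulrAC Xf^-1) -(mulrA _ Xf^-1).
by rewrite !mulVf ?Xf_neq0 // mul1r mulr1 -addrA (addrC d%:~R).
Qed.

(** After multiplication by [x^m], with [m] the size of [s], the right side is a polynomial of
    degree at most [m], which leaves [r] only a constant term. *)
Lemma evalXinv_tofrac (r s : {poly int}) : r%:F = evalXinv s -> (size r <= 1)%N.
Proof.
move=> E; have /(congr1 (fun y => y * Xf ^+ size s)) := E.
rewrite -polyrevE ?leqnSn // -XfX -tofracM => /eqP; rewrite tofrac_eq => /eqP E'.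
have [->|r0] := eqVneq r 0; first by rewrite size_poly0.
have : (size (polyrev (size s) s) <= (size s).+1)%N by apply: size_poly.
by rewrite -E' size_mulXn // -[X in (_ <= X)%N]addn1 leq_add2l.
Qed.

Lemma lval_inj : injective lval. Proof. exact: val_inj. Qed.

Lemma lbarD f g : lbar (f + g) = lbar f + lbar g.
Proof.
have [a [b [_ Ef]]] := laurent_split f; have [a' [b' [_ Eg]]] := laurent_split g.
apply: lval_inj; rewrite (@lbar_val (f + g) (a + a') (b + b')) /=.
  by rewrite (lbar_val Ef) (lbar_val Eg) evalXinvD tofracD; ring.
by rewrite /= Ef Eg evalXinvD tofracD; ring.
Qed.

Lemma lbarM f g : lbar (f * g) = lbar f * lbar g.
Proof.
have [[k p] /= Ef] := laurent_ex f; have [[j q] /= Eg] := laurent_ex g.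
apply: lval_inj; rewrite (@lbar_rep (f * g) (k + j) (p * q)) /=.
  by rewrite (lbar_rep Ef) (lbar_rep Eg) evalXinvM exprD; ring.
by rewrite tofracM -Ef -Eg exprD; ring.
Qed.

Lemma lbarK f : lbar (lbar f) = f.
Proof.
have [a [b [_ Ef]]] := laurent_split f; apply: lval_inj.
by rewrite (@lbar_val _ b a) ?(lbar_val Ef) ?Ef addrC.
Qed.

Lemma lbar0 : lbar 0 = 0.
Proof. by apply: (addrI (lbar 0)); rewrite -lbarD !addr0. Qed.

Lemma lbar1 : lbar 1 = 1.
Proof.
apply: lval_inj; rewrite (@lbar_val _ 0 1) ?evalXinv0 ?tofrac0 ?evalXinv1 ?add0r //.
Qed.

Lemma lbarN f : lbar (- f) = - lbar f.
Proof. by apply/eqP; rewrite -addr_eq0 -lbarD addNr lbar0. Qed.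

Lemma lbar_lx : lbar lx = lxi.
Proof.
by apply: lval_inj; rewrite (@lbar_val _ 0 'X) ?evalXinv0 ?tofrac0 ?add0r ?evalXinvX.
Qed.

Lemma lbar_lxi : lbar lxi = lx. Proof. by rewrite -lbar_lx lbarK. Qed.

Lemma lx_lxi : lx * lxi = 1.
Proof. by apply: lval_inj; rewrite /= mulfV ?Xf_neq0. Qed.

Lemma lbar_nat (b : bool) : lbar b%:R = b%:R.
Proof. by case: b; rewrite ?lbar1 ?lbar0. Qed.

Lemma lbar_sum (I : Type) (r : seq I) (P : pred I) (G : I -> laurent) :
  lbar (\sum_(i <- r | P i) G i) = \sum_(i <- r | P i) lbar (G i).
Proof. exact: (big_morph _ lbarD lbar0). Qed.

Lemma negpart0 : in_negpart 0.
Proof. by exists 0; rewrite coef0 evalXinv0. Qed.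

Lemma negpartB f g : in_negpart f -> in_negpart g -> in_negpart (f - g).
Proof.
move=> [p [p0 Ep]] [q [q0 Eq]]; exists (p - q).
by rewrite coefB p0 q0 subrr /= Ep Eq evalXinvD evalXinvN.
Qed.

Lemma negpart_bar_fixed f : in_negpart f -> lbar f = f -> f = 0.
Proof.
move=> [p [p0 Ep]] fb.
have E : p%:F = evalXinv p.
  by rewrite -Ep -fb (@lbar_val f p 0) ?evalXinv0 ?tofrac0 ?addr0.
have sp := evalXinv_tofrac E; apply: lval_inj; rewrite Ep.
by rewrite (size1_polyC sp) p0 evalXinv0.
Qed.

(** Antisymmetry makes [a + b] a polynomial both in [x] and in [x^-1], hence an integer constant
    equal to its own negative. So [b = - a], and the negative part of [f] serves as [g]. *)
Lemma negpart_decomp f : lbar f = - f -> exists2 g, in_negpart g & f = g - lbar g.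
Proof.
have [a [b [a0 Ef]]] := laurent_split f => fb.
have E : (a + b)%:F = evalXinv (- (a + b)).
  have := congr1 lval fb; rewrite (lbar_val Ef) /= Ef => E.
  apply/eqP; rewrite evalXinvN evalXinvD tofracD -subr_eq0; apply/eqP.
  rewrite -[RHS](subrr (a%:F + evalXinv b)) {2}E; ring.
have sab := evalXinv_tofrac E; rewrite (size1_polyC sab) -polyCN evalXinvC in E.
have ab0 : (a + b)`_0 = 0.
  move: E; rewrite -tofrac_intr => /eqP; rewrite tofrac_eq polyCN => /eqP/polyP/(_ 0%N).
  by rewrite coefN !coefC /=; lia.
have ba : b = - a.
  by apply/eqP; rewrite -addr_eq0 addrC (size1_polyC sab) ab0.
exists (Laurent (laurent_evalXinv a)); first by exists a.
apply: lval_inj; rewrite /= Ef ba tofracN; congr (_ - _).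
by rewrite (@lbar_val _ a 0) ?tofrac0 ?evalXinv0 ?addr0.
Qed.

(** * Canonical bases *)

Section KazhdanLusztig.

Variables (I : finType) (ln : I -> nat).
Local Notation V := {ffun I -> laurent}.
Implicit Types (m : V) (y z : I) (b : I -> V).

Definition fscale (a : laurent) m : V := [ffun y => a * m y].
Definition fdelta z : V := [ffun y => (y == z)%:R].

Lemma fdelta_sum m : m = \sum_z fscale (m z) (fdelta z).
Proof.
apply/ffunP => y; rewrite sum_ffunE (bigD1 y) //= big1 ?addr0 => [|z zy].
  by rewrite !ffunE eqxx mulr1.
by rewrite !ffunE eq_sym (negbTE zy) mulr0.
Qed.

Definition unitriangular b := forall z, b z z = 1 /\
  forall y, y != z -> (ln z <= ln y)%N -> b z y = 0.

(** Existence removes the longest layer of the support, by induction on a bound [k] for the lengths;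
    uniqueness kills the coefficients of a relation from the longest index downwards. *)
Lemma unitriangular_basis b : unitriangular b ->
  forall m, exists! a : I -> laurent, m = \sum_z fscale (a z) (b z).
Proof.
move=> ub m; have sumE (a : I -> laurent) y :
    (\sum_z fscale (a z) (b z)) y = \sum_z a z * b z y.
  by rewrite sum_ffunE; apply: eq_bigr => z _; rewrite ffunE.
have [a Ea] : exists a : I -> laurent, m = \sum_z fscale (a z) (b z).
  have [k mk] : exists k, forall y, (k <= ln y)%N -> m y = 0.
    exists (\max_y ln y).+1 => y; rewrite ltnNge.
    by rewrite (@leq_bigmax _ ln y).
  elim: k m mk => [|k IH] m mk.
    exists (fun=> 0); apply/ffunP => y; rewrite sumE big1 ?mk // => z _.
    by rewrite mul0r.
  pose m' : V := m - \sum_z fscale (if ln z == k then m z else 0) (b z).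
  have [y ky|a Ea] := IH m'.
    rewrite !ffunE sumE; apply/eqP; rewrite subr_eq0; apply/eqP.
    rewrite (bigD1 y) //= big1 ?addr0 => [|z zy]; last first.
      case: eqP => [lz|_]; last by rewrite mul0r.
      by rewrite (ub z).2 ?mulr0 ?lz // eq_sym.
    rewrite (ub y).1 mulr1; case: eqP => // nk; apply: mk; lia.
  exists (fun z => a z + (if ln z == k then m z else 0)).
  rewrite -[LHS](subrK (\sum_z fscale (if ln z == k then m z else 0) (b z))) -/m' Ea.
  by apply/ffunP => y; rewrite ffunE !sumE -big_split; apply: eq_bigr => z _; rewrite mulrDl.
exists a; split=> // a' Ea'; apply: funext => z; apply/eqP; rewrite -subr_eq0.
have E y : \sum_z (a z - a' z) * b z y = 0.
  under eq_bigr do rewrite mulrBl.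
  by rewrite sumrB -!sumE -Ea -Ea' subrr.
have [k] := ubnP (\max_y ln y - ln z)%N; elim: k z => // k IH z; rewrite ltnS => lek.
have := E z; rewrite (bigD1 z) //= (ub z).1 mulr1 big1 ?addr0 => [->//|w wz].
have [lw|lw] := leqP (ln w) (ln z); first by rewrite (ub w).2 ?mulr0 // eq_sym.
rewrite (eqP (IH w _)) ?mul0r //.
by have := @leq_bigmax _ ln w; lia.
Qed.

Record bar_involution (beta : V -> V) : Prop := BarInvolution {
  bi_add : forall m m', beta (m + m') = beta m + beta m';
  bi_scale : forall a m, beta (fscale a m) = fscale (lbar a) (beta m);
  bi_invol : forall m, beta (beta m) = m;
  bi_tri : unitriangular (fun z => beta (fdelta z)) }.

Variables (beta : V -> V) (bi : bar_involution beta).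

Lemma beta0 : beta 0 = 0.
Proof. by apply: (addrI (beta 0)); rewrite -(bi_add bi) !addr0. Qed.

Lemma betaB m m' : beta (m - m') = beta m - beta m'.
Proof.
apply/eqP; rewrite eq_sym subr_eq -(bi_add bi) subrK; exact/eqP.
Qed.

Lemma beta_sum (J : Type) (r : seq J) (P : pred J) (G : J -> V) :
  beta (\sum_(j <- r | P j) G j) = \sum_(j <- r | P j) beta (G j).
Proof. exact: (big_morph _ (bi_add bi) beta0). Qed.

Lemma betaE m y : beta m y = \sum_z lbar (m z) * beta (fdelta z) y.
Proof.
rewrite {1}[m]fdelta_sum beta_sum sum_ffunE.
by apply: eq_bigr => z _; rewrite (bi_scale bi) ffunE.
Qed.

(** On the highest layer of the support only diagonal entries contribute, so there [beta] merely
    bars the coefficients. *)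
Lemma beta_top m k y : (forall z, (k < ln z)%N -> m z = 0) -> (k <= ln y)%N ->
  beta m y = lbar (m y).
Proof.
move=> mk ky; rewrite betaE (bigD1 y) //= ((bi_tri bi) y).1 mulr1 big1 ?addr0 //.
move=> z zy; have [kz|kz] := ltnP k (ln z); first by rewrite mk // lbar0 mul0r.
by rewrite ((bi_tri bi) z).2 ?mulr0 1?eq_sym // (leq_trans kz).
Qed.

Definition canonical b := forall z, [/\ beta (b z) = b z, b z z = 1 &
  forall y, y != z -> if (ln y < ln z)%N then in_negpart (b z y) else b z y = 0].

Lemma canonical_unitriangular b : canonical b -> unitriangular b.
Proof.
move=> cb z; have [_ bzz bzy] := cb z; split=> // y yz lzy.
by have := bzy y yz; rewrite ltnNge lzy.
Qed.

(** The difference is bar invariant with coefficients in [x^-1 Z[x^-1]]; on its highest layer each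
    coefficient is fixed by [lbar], hence zero. *)
Lemma canonical_unique b b' : canonical b -> canonical b' -> forall z, b' z = b z.
Proof.
move=> cb cb' z; have [Bb bzz bn] := cb z; have [Bb' bzz' bn'] := cb' z.
pose d := b' z - b z; have Bd : beta d = d by rewrite betaB Bb Bb'.
have dneg y : in_negpart (d y).
  rewrite !ffunE; have [->|yz] := eqVneq y z; first by rewrite bzz bzz' subrr; apply: negpart0.
  have := bn y yz; have := bn' y yz; case: ifP => _ E E'; first exact: negpartB.
  by rewrite E E' subrr; apply: negpart0.
suff H k : forall y, (k <= ln y)%N -> d y = 0.
  by apply/eqP; rewrite -subr_eq0; apply/eqP/ffunP => y; rewrite (H 0%N) ?ffunE.
have [j] := ubnP ((\max_y ln y).+1 - k)%N; elim: j k => // j IH k; rewrite ltnS => lej y ky.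
have [kmax|kmax] := leqP k (\max_y ln y); last first.
  by have := @leq_bigmax _ ln y; lia.
apply: negpart_bar_fixed => //; rewrite -[RHS]/(d y) -{2}Bd; apply/esym.
by apply: (beta_top (k := k)) => // w kw; apply: (IH k.+1); lia.
Qed.

(** Start from the basis vector at [z] and correct one length at a time, downwards. The defect
    [q = beta v - v] satisfies [beta q = - q], so its highest layer has coefficients of the form
    [g - lbar g]; adding [g] there to [v] clears the layer. *)
Lemma canonical_exists : exists b, canonical b.
Proof.
suff H z : exists v : V, [/\ beta v = v, v z = 1 &
    forall y, y != z -> if (ln y < ln z)%N then in_negpart (v y) else v y = 0].
  by have [b bP] := choice H; exists b.
(* [j] is the number of layers below [z] already cleared. *)
suff H' j : (j <= ln z)%N -> exists v : V,
    [/\ forall y, (ln z - j <= ln y)%N -> (beta v - v) y = 0, v z = 1 &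
     forall y, y != z -> if (ln y < ln z)%N then in_negpart (v y) else v y = 0].
  have [v [v0 vz vy]] := H' (ln z) (leqnn _); exists v; split=> //.
  by apply/eqP; rewrite -subr_eq0; apply/eqP/ffunP => y; rewrite v0 ?subnn // ffunE.
elim: j => [_|j IH lej].
  exists (fdelta z); split=> [y ly||y yz].
  - rewrite !ffunE; have [->|yz] := eqVneq y z; first by rewrite ((bi_tri bi) z).1 subrr.
    by rewrite ((bi_tri bi) z).2 ?subr0 //; lia.
  - by rewrite ffunE eqxx.
  - by rewrite ffunE (negbTE yz); case: ifP => _ //; apply: negpart0.
have [v [v0 vz vy]] := IH (ltnW lej); set q := beta v - v in v0.
pose k := (ln z - j.+1)%N.
have qk y : (k < ln y)%N -> q y = 0 by move=> ky; apply: v0; rewrite /k in ky; lia.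
have Bq : beta q = - q by rewrite /q betaB (bi_invol bi) opprB.
have qbar y : (k <= ln y)%N -> lbar (q y) = - q y.
  by move=> ky; rewrite -(beta_top qk ky) Bq ffunE.
have [g gP] : exists g : I -> laurent, forall y, (k <= ln y)%N ->
    in_negpart (g y) /\ q y = g y - lbar (g y).
  suff /choice[g gP] : forall y, exists a, (k <= ln y)%N -> in_negpart a /\ q y = a - lbar a.
    by exists g.
  move=> y; have [ky|ky] := leqP k (ln y); last by exists 0.
  by have [a an E] := negpart_decomp (qbar y ky); exists a.
pose w : V := [ffun y => if ln y == k then g y else 0].
have wk y : (k < ln y)%N -> w y = 0 by rewrite ffunE; case: eqP => // ->; rewrite ltnn.
have kz : (k < ln z)%N by rewrite /k; lia.
exists (v + w); split=> [y ky||y yz].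
- have -> : beta (v + w) - (v + w) = q + (beta w - w).
    by rewrite (bi_add bi) /q opprD addrACA.
  have -> : (q + (beta w - w)) y = q y + (beta w y - w y).
    by rewrite ffunE; congr (_ + _); rewrite ffunE; congr (_ + _); rewrite ffunE.
  rewrite (beta_top wk) // [w y]ffunE.
  have [lyk|nk] := eqVneq (ln y) k; last first.
    by rewrite lbar0 oppr0 !addr0 qk // ltn_neqAle eq_sym nk.
  have [_ ->] := gP y ky; ring.
- by rewrite ffunE vz wk // addr0.
have := vy y yz; rewrite !ffunE; case: ifP => lyz.
  case: eqP => [lyk|_]; last by rewrite addr0.
  have [|gn _] := gP y; first by rewrite lyk.
  move=> vn; rewrite -[g y]opprK; apply: negpartB => //.
  by rewrite -[- _]add0r; apply: negpartB => //; apply: negpart0.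
by case: eqP => [lyk|_]; rewrite ?addr0 //; move: kz; rewrite -lyk lyz.
Qed.

End KazhdanLusztig.

(** * Signed permutations *)

Ltac split_ifs := repeat match goal with
  |- context [if @eq_op ?T ?x ?y then _ else _] =>
    lazymatch constr:((x, y)) with
    | context [if _ then _ else _] => fail
    | _ => case: (@eqP T x y) => ?
    end end.

(** * Length as the outcome of a bounded search *)

Section WordLength.

Variables (n : nat) (S : {set Perm n}).
Implicit Types (w : Perm n) (l : seq (Perm n)).

Lemma prodsP k w :
  w \in prods S k <-> exists l, [/\ all (mem S) l, wprod l = w & size l = k].
Proof.
elim: k w => [|k IH] w /=.
  rewrite inE; split=> [/eqP->|[l [_ <- /size0nil->]]]; last by rewrite wprod_nil.
  by exists [::]; rewrite wprod_nil.
split=> [/imset2P[s w' sS /IH[l [lS <- <-]] ->]|[l [lS <- sl]]].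
  exists (rcons l s); rewrite all_rcons lS /= sS size_rcons.
  by rewrite wprod_rcons.
case/lastP: l lS sl => // l s; rewrite all_rcons size_rcons => /andP[sS lS] [sl].
by apply/imset2P; exists s (wprod l); rewrite // ?wprod_rcons //; apply/IH; exists l.
Qed.

(** [clen] searches only up to the number of all permutations. A path in the Cayley graph without
    repeated vertices has fewer steps than that, so the search succeeds on the whole generated
    group. *)
Lemma short_word w : w \in <<S>>%g ->
  exists l, [/\ all (mem S) l, wprod l = w & (size l <= #|{: Perm n}|)%N].
Proof.
case/word_gen=> l lS <-.
pose e (x y : Perm n) := [exists s in S, y == (x * s)%g].
have pw x p : path e x p -> exists l',
    [/\ all (mem S) l', last x p = (x * wprod l')%g & size l' = size p].
  elim: p x => [|y p IH] x /=; first by exists [::]; rewrite wprod_nil mulg1.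
  case/andP=> /exists_inP[s sS /eqP->] /IH[l' [l'S -> <-]].
  by exists (s :: l'); rewrite /= l'S wprod_cons mulgA; split=> //; rewrite sS.
have [p ep lp] : exists2 p, path e 1%g p & last 1%g p = wprod l.
  suff [p ep E] : exists2 p, path e 1%g p & last 1%g p = (1 * wprod l)%g.
    by exists p => //; rewrite E mul1g.
  elim: l lS (1%g) => [|s l IH] /= lS x; first by exists [::]; rewrite // wprod_nil mulg1.
  case/andP: lS => sS lS; have [p ep E] := IH lS (x * s)%g.
  exists ((x * s)%g :: p); last by rewrite /= E wprod_cons mulgA.
  by rewrite /= ep andbT; apply/exists_inP; exists s.
case/shortenP: ep lp => p' ep' up' _ lp'.
have [l' [l'S E sl']] := pw _ _ ep'; exists l'; split=> //.
  by rewrite -lp' E mul1g.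
rewrite sl'; have := max_card (mem (1%g :: p')); rewrite (card_uniqP up') /=.
exact: ltnW.
Qed.

Lemma clen_le l : all (mem S) l -> (clen S (wprod l) <= size l)%N.
Proof.
move=> lS; have [l' [l'S E sl']] := short_word (wprod_gen lS).
have le l1 : all (mem S) l1 -> wprod l1 = wprod l -> (size l1 <= #|{: Perm n}|)%N ->
    (clen S (wprod l) <= size l1)%N.
  move=> l1S E1 s1; rewrite leqNgt; apply/negP => /(before_find 0%N).
  rewrite nth_iota ?add0n ?ltnS // => /negP[]; apply/prodsP.
  by exists l1.
have [sl|sl] := leqP (size l) #|{: Perm n}|; first exact: le.
by apply: leq_trans (le l' _ _ _) _; rewrite // ?E //; lia.
Qed.

Lemma clen_word w : w \in <<S>>%g ->
  exists l, [/\ all (mem S) l, wprod l = w & size l = clen S w].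
Proof.
case/short_word=> l [lS E sl]; apply/prodsP; rewrite /clen.
set P := fun k => _; set r := iota 0 _.
have hP : has P r.
  apply/hasP; exists (size l); first by rewrite mem_iota add0n ltnS.
  by apply/prodsP; exists l.
have := nth_find 0%N hP; rewrite /P nth_iota ?add0n //.
by move: hP; rewrite has_find size_iota.
Qed.

End WordLength.

Section SignedPermutations.

Variable n : nat.
Implicit Types (w z : Perm n) (v i j : int).

Definition inrange v : bool := (absz v <= 2 * n)%N.

Lemma ivalK (k : Amb n) : idx n (ival k) = k.
Proof.
apply: val_inj; rewrite /idx /ival /= inordK; have := ltn_ord k; lia.
Qed.

Lemma idxK v : inrange v -> ival (idx n v) = v.
Proof. by rewrite /inrange /idx /ival => vr; rewrite inordK; lia. Qed.

Lemma ival_inr (k : Amb n) : inrange (ival k).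
Proof. by rewrite /inrange /ival; have := ltn_ord k; lia. Qed.

Lemma sapp_inr w v : inrange (sapp w v). Proof. exact: ival_inr. Qed.

Lemma sapp_ival w (k : Amb n) : sapp w (ival k) = ival (w k).
Proof. by rewrite /sapp ivalK. Qed.

Lemma ival_inj : injective (@ival n).
Proof. by move=> k k' E; rewrite -[k]ivalK E ivalK. Qed.

Lemma sapp_inj w v v' : inrange v -> inrange v' -> sapp w v = sapp w v' -> v = v'.
Proof.
by move=> vr v'r /ival_inj/perm_inj E; rewrite -(idxK vr) E idxK.
Qed.

Lemma sappM w w' v : sapp (w * w')%g v = sapp w' (sapp w v).
Proof. by rewrite /sapp permM ivalK. Qed.

Lemma sapp1 v : inrange v -> sapp (1%g : Perm n) v = v.
Proof. by move=> vr; rewrite /sapp perm1 idxK. Qed.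

Lemma sappP w w' : (forall v, inrange v -> sapp w v = sapp w' v) -> w = w'.
Proof.
move=> E; apply/permP => k; apply: ival_inj.
by rewrite -!sapp_ival E // ival_inr.
Qed.

Lemma sapp_tr a b v : inrange a -> inrange b -> inrange v ->
  sapp (tr n a b) v = if v == a then b else if v == b then a else v.
Proof.
move=> ar br vr; rewrite /sapp /tr permE /=.
have E u u' : inrange u -> inrange u' -> (idx n u == idx n u') = (u == u').
  move=> ur u'r; apply/eqP/eqP => [E|->//].
  by rewrite -(idxK ur) E idxK.
by rewrite !E //; case: eqP => _; rewrite ?idxK //; case: eqP => _; rewrite idxK.
Qed.

(** [ra i < rb i] are points exchanged by the generator [i], ordered so that it is a descent of [w]
    exactly when [w] reverses them: the pair is -1, 1 for [s_0] and -2, 1 for [s_{-1}]. *)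
Definition ra i : int := if i == 0 then -1 else if i == -1 then -2 else i.
Definition rb i : int := if i == 0 then 1 else if i == -1 then 1 else i + 1.

Definition sref (a b v : int) : int :=
  if v == a then b else if v == b then a
  else if v == - a then - b else if v == - b then - a else v.

Lemma sapp_gen i v : (1 < n)%N -> -1 <= i -> i < (2 * n)%:Z -> inrange v ->
  sapp (gen n i) v = sref (ra i) (rb i) v.
Proof.
rewrite /inrange /gen /ra /rb /sref => n1 i1 i2 vr.
case: (i =P 0) => i0; last case: (i =P -1) => im; rewrite ?sappM !sapp_tr /inrange;
  split_ifs; lia.
Qed.

End SignedPermutations.

Definition vidx (t : ctype) (m : nat) (i : int) : bool :=
  ((0 < i) && (i < m%:Z)) ||
  match t with TA => false | TBC => i == 0 | TD => i == -1 end.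

Lemma gen_idxE t m i : (i \in gen_idx t m) = vidx t m i.
Proof.
rewrite /gen_idx mem_cat /vidx orbC; congr (_ || _); last by case: t; rewrite ?inE.
apply/mapP/idP => [[k]|/andP[i0 im]].
  by rewrite mem_iota => km ->; lia.
by exists `|i|%N; rewrite ?mem_iota; lia.
Qed.

Lemma gensP n t m (s : Perm n) :
  reflect (exists2 i, vidx t m i & s = gen n i) (s \in gens n t m).
Proof.
rewrite inE; apply: (iffP mapP) => -[i].
  by rewrite gen_idxE => vi ->; exists i.
by move=> vi ->; exists i; rewrite ?gen_idxE.
Qed.

(** A simple reflection reverses the order of two nonzero points only if it exchanges them. Opposite
    points must be excluded for [s_{-1}], which reverses 1 and -1 without exchanging them. *)
Lemma sref_flip (j p q : int) : -1 <= j -> p != q -> p != 0 -> q != 0 ->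
  (j = -1 -> p != - q) ->
  (sref (ra j) (rb j) q < sref (ra j) (rb j) p) != (q < p) ->
  [\/ p = ra j /\ q = rb j, p = rb j /\ q = ra j,
      p = - ra j /\ q = - rb j | p = - rb j /\ q = - ra j].
Proof.
move=> j1 pq p0 q0 pj flip.
suff : p = ra j /\ q = rb j \/ p = rb j /\ q = ra j \/ p = - ra j /\ q = - rb j \/
       p = - rb j /\ q = - ra j.
  by case=> [|[|[|]]] H; [constructor 1|constructor 2|constructor 3|constructor 4].
move: flip; rewrite /sref /ra /rb.
case: (j =P 0) => j0; last case: (j =P -1) => jm; split_ifs; lia.
Qed.

(** * The Coxeter axioms for signed permutations *)

Section Generators.

Variables (n : nat) (n1 : (1 < n)%N).
Implicit Types (w z s : Perm n) (v i j : int) (t : ctype).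
Local Notation inr := (inrange n).

Lemma vidx_bound t m i : (m <= 2 * n)%N -> vidx t m i -> -1 <= i /\ i < (2 * n)%:Z.
Proof. by rewrite /vidx; case: t; lia. Qed.

Lemma vidx_wide t i : vidx t n i -> vidx t (2 * n) i.
Proof. by rewrite /vidx; case: t; lia. Qed.

Lemma root_facts i : -1 <= i -> i < (2 * n)%:Z ->
  [/\ ra i < rb i, ra i != 0, rb i != 0, inr (ra i) & inr (rb i)].
Proof. by rewrite /ra /rb /inrange => i1 i2; split; split_ifs; lia. Qed.

Lemma inrN v : inr (- v) = inr v. Proof. by rewrite /inrange; lia. Qed.

Definition podd w : Prop := forall v, inr v -> sapp w (- v) = - sapp w v.

Lemma odd_gen i : -1 <= i -> i < (2 * n)%:Z -> podd (gen n i).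
Proof.
move=> i1 i2 v vr; rewrite !sapp_gen ?inrN // /sref.
have [ab a0 b0 _ _] := root_facts i1 i2; split_ifs; lia.
Qed.

Lemma oddM w w' : podd w -> podd w' -> podd (w * w')%g.
Proof. by move=> ow ow' v vr; rewrite !sappM ow // ow' // sapp_inr. Qed.

Lemma W_ind t m (P : Perm n -> Prop) : P 1%g ->
  (forall i w, vidx t m i -> P w -> P (gen n i * w)%g) ->
  forall w, w \in Wgrp n t m -> P w.
Proof.
move=> P1 PM w /word_gen[l lS <-].
elim: l lS => [|s l IH] /=; first by rewrite wprod_nil.
by case/andP=> /gensP[i vi ->] /IH; rewrite wprod_cons; apply: PM.
Qed.

Lemma odd_W t m w : (m <= 2 * n)%N -> w \in Wgrp n t m -> podd w.
Proof.
move=> mn; move: w; apply: (@W_ind t m podd) => [v vr|i w vi ow].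
  by rewrite !sapp1 ?inrN.
by have [i1 i2] := vidx_bound mn vi; apply: oddM => //; apply: odd_gen.
Qed.

Lemma pos_WA m w : (m <= 2 * n)%N -> w \in Wgrp n TA m ->
  forall v, inr v -> 0 < v -> 0 < sapp w v.
Proof.
move=> mn; move: w; apply: (@W_ind TA m (fun w => forall v, inr v -> 0 < v -> 0 < sapp w v))
  => [v vr|i w vi IH v vr v0]; first by rewrite sapp1.
have [i1 i2] := vidx_bound mn vi; rewrite sappM; apply: IH; first exact: sapp_inr.
rewrite sapp_gen // /sref /ra /rb; move: vi; rewrite /vidx orbF => vi.
by split_ifs; lia.
Qed.

Lemma inr0 : inr 0. Proof. by rewrite /inrange; lia. Qed.

Lemma odd_sapp0 w : podd w -> sapp w 0 = 0.
Proof. by move/(_ 0 inr0); rewrite oppr0; move: (sapp w 0) => x; lia. Qed.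

Lemma sapp_eq w v v' : inr v -> inr v' -> (sapp w v == sapp w v') = (v == v').
Proof.
by move=> vr v'r; apply/eqP/eqP => [|->//]; apply: sapp_inj.
Qed.

Lemma sapp_eqN w v v' : podd w -> inr v -> inr v' ->
  (sapp w v == - sapp w v') = (v == - v').
Proof. by move=> ow vr v'r; rewrite -ow // sapp_eq ?inrN. Qed.

Lemma sapp_eq0 w v : podd w -> inr v -> (sapp w v == 0) = (v == 0).
Proof. by move=> ow vr; rewrite -{1}(odd_sapp0 ow) sapp_eq ?inr0. Qed.

(** Phrased without the index of the generator, because the abstract descent predicate takes group
    elements. The encoding of points preserves order, and [s * w] applies [s] first. *)
Definition Ddes s w : bool := [exists k : Amb n, (k < s k)%N && (w (s k) < w k)%N].

Lemma ival_lt (k k' : Amb n) : (ival k < ival k') = (k < k')%N.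
Proof. by rewrite /ival; lia. Qed.

Lemma D_gen i w : -1 <= i -> i < (2 * n)%:Z -> podd w ->
  Ddes (gen n i) w = (sapp w (rb i) < sapp w (ra i)).
Proof.
move=> i1 i2 ow; have [ab a0 b0 ar br] := root_facts i1 i2.
apply/existsP/idP => [[k]|lt].
  rewrite -!ival_lt -!sapp_ival sapp_gen // ?ival_inr //.
  move: (ival k) (ival_inr k) => v vr /andP[vs].
  have [->|[->|vo]] : v = ra i \/ v = - rb i \/ ~ (v < sref (ra i) (rb i) v).
    by rewrite /sref; split_ifs; lia.
  - by rewrite /sref eqxx.
  - have -> : sref (ra i) (rb i) (- rb i) = - ra i by rewrite /sref; split_ifs; lia.
    by rewrite !ow //; lia.
  - by case: vo.
exists (idx n (ra i)); rewrite -!ival_lt -!sapp_ival idxK // sapp_gen //.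
have -> : sref (ra i) (rb i) (ra i) = rb i by rewrite /sref eqxx.
by rewrite ab.
Qed.

(** The appended generator [j] reverses the images of the pair of [i] only if, up to sign, they are
    the pair of [j]; then [w] conjugates one generator into the other. *)
Lemma exchange_gen t i j w : vidx t (2 * n) i -> vidx t (2 * n) j -> podd w ->
  Ddes (gen n i) (w * gen n j)%g != Ddes (gen n i) w ->
  (gen n i * w = w * gen n j)%g.
Proof.
move=> vi vj ow; have [i1 i2] := vidx_bound (leqnn _) vi.
have [j1 j2] := vidx_bound (leqnn _) vj.
have [ab a0 b0 ar br] := root_facts i1 i2.
rewrite !D_gen //; last by apply: oddM => //; apply: odd_gen.
rewrite !sappM !(sapp_gen _ j1 j2) ?sapp_inr // => flip.
have pq : sapp w (ra i) != sapp w (rb i) by rewrite sapp_eq //; lia.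
have p0 : sapp w (ra i) != 0 by rewrite sapp_eq0.
have q0 : sapp w (rb i) != 0 by rewrite sapp_eq0.
have pnq : j = -1 -> sapp w (ra i) != - sapp w (rb i).
  rewrite sapp_eqN // => jm; move: vi vj; rewrite jm /vidx /ra /rb.
  by case: t => //= vi _; split_ifs; lia.
have := sref_flip j1 pq p0 q0 pnq flip; move: pq p0 q0.
move Ep : (sapp w (ra i)) => p; move Eq : (sapp w (rb i)) => q pq p0 q0 H.
apply: sappP => v vr; rewrite !sappM !sapp_gen ?sapp_inr //.
have Ha : (sapp w v == p) = (v == ra i) by rewrite -Ep sapp_eq.
have Hb : (sapp w v == q) = (v == rb i) by rewrite -Eq sapp_eq.
have Hna : (sapp w v == - p) = (v == - ra i) by rewrite -Ep sapp_eqN.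
have Hnb : (sapp w v == - q) = (v == - rb i) by rewrite -Eq sapp_eqN.
have -> : sapp w (sref (ra i) (rb i) v) = sref p q (sapp w v).
  rewrite /sref Ha Hb Hna Hnb.
  by split_ifs; rewrite ?ow // ?Ep ?Eq.
move: (sapp w v) => x; clear -H p0 q0.
by case: H p0 q0 => -[-> ->] p0 q0; rewrite /sref; split_ifs; lia.
Qed.

Lemma gen_invol i : -1 <= i -> i < (2 * n)%:Z -> (gen n i * gen n i = 1)%g.
Proof.
move=> i1 i2; apply: sappP => v vr; rewrite sappM sapp1 //.
rewrite [sapp _ (sapp _ _)]sapp_gen ?sapp_inr // sapp_gen //.
have [ab a0 b0 ar br] := root_facts i1 i2; rewrite /sref; split_ifs; lia.
Qed.

Lemma cox_gens t : coxeter_axioms (gens n t (2 * n)) Ddes (glen t).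
Proof.
split.
- by move=> _ /gensP[i vi ->]; have [i1 i2] := vidx_bound (leqnn _) vi; apply: gen_invol.
- move=> _ /gensP[i vi ->]; have [i1 i2] := vidx_bound (leqnn _) vi.
  have [ab _ _ ar br] := root_facts i1 i2.
  rewrite D_gen //; last by move=> v vr; rewrite !sapp1 ?inrN.
  by rewrite !sapp1 //; lia.
- move=> _ w /gensP[i vi ->] wW; have [i1 i2] := vidx_bound (leqnn _) vi.
  have [ab _ _ ar br] := root_facts i1 i2; have ow := odd_W (leqnn _) wW.
  rewrite !D_gen //; last by apply: oddM => //; apply: odd_gen.
  rewrite !sappM !sapp_gen //.
  have -> : sref (ra i) (rb i) (ra i) = rb i by rewrite /sref eqxx.
  have -> : sref (ra i) (rb i) (rb i) = ra i by rewrite /sref; split_ifs; lia.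
  have : sapp w (ra i) != sapp w (rb i) by rewrite sapp_eq //; lia.
  by lia.
- move=> _ _ w /gensP[i vi ->] /gensP[j vj ->] wW.
  exact: exchange_gen vi vj (odd_W (leqnn _) wW).
- exact: clen_word.
- exact: clen_le.
Qed.

End Generators.

(** * Shapes of minimal involutions *)

(* [f k] stands for the value at [k > 0] of a signed involution without fixed
   or negated points, [N] for the size of its support. *)
Record fpf_fun (N : nat) (f : nat -> int) : Prop := FpfFun {
  ff_pos : forall k l : nat, (0 < k <= N)%N -> f k = l%:Z -> (0 < l <= N)%N /\ f l = k%:Z;
  ff_neg : forall k l : nat, (0 < k <= N)%N -> f k = - l%:Z -> (0 < l <= N)%N /\ f l = - k%:Z;
  ff_fix : forall k, (0 < k <= N)%N -> `|f k|%N != k }.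

Section MinimalShape.

Variables (N : nat) (f : nat -> int) (ff : fpf_fun N f) (m : nat) (mN : (m <= N)%N).
Hypothesis pos : forall k, (0 < k <= m)%N -> 0 < f k.
Hypothesis mono : forall k, (0 < k < m)%N -> f k < f k.+1 \/ f k = k.+1%:Z.

(** Strong induction. If [k + 1 < f k <= m], the position just before [f k] has a value below [k],
    and at that smaller position the induction hypothesis fails. *)
Lemma min_shape k : (0 < k <= m)%N ->
  [\/ m%:Z < f k, odd k /\ f k = k.+1%:Z | ~~ odd k /\ f k = k%:Z - 1].
Proof.
have [j] := ubnP k; elim: j k => // j IH k; rewrite ltnS => lej kr.
have [gt|le] := ltP m%:Z (f k); first by constructor 1.
have fk0 := pos kr; have kN : (0 < k <= N)%N by lia.
have fkn := ff_fix ff kN.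
have [a Ea] : exists a : nat, f k = a%:Z by exists `|f k|%N; lia.
have [aN fa] := ff_pos ff kN Ea.
have am : (0 < a <= m)%N by lia.
have [ltak|gtak|ak] := ltngtP a k; last by move: fkn; rewrite Ea ak; lia.
  have [|||] := IH a _ am; rewrite ?fa; try lia.
  - by case=> oa ka; constructor 3; split; lia.
have [ak1|nak1] := eqVneq a k.+1.
  constructor 2; rewrite Ea ak1; split=> //.
  have [k1|k1] := eqVneq k 1%N; first by rewrite k1.
  have [|||[ok fk1]|[ok fk1]] := IH k.-1; try lia.
  - have := mono (k := k.-1); rewrite prednK; lia.
  - have fk1' : f k.-1 = k%:Z by lia.
    have [_] := ff_pos ff (k := k.-1) ltac:(lia) fk1'; lia.
have [|lt|E] := mono (k := a.-1); first lia.
- rewrite prednK in lt; last lia.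
  have p1 : (0 < a.-1 <= m)%N by lia.
  have := pos p1 => h0; have [b Eb] : exists b : nat, f a.-1 = b%:Z by exists `|f a.-1|%N; lia.
  have [|bN fb] := ff_pos ff (k := a.-1) _ Eb; first lia.
  have [||||] := IH b; rewrite ?fb; try lia.
- rewrite prednK in E; last lia.
  by have [_] := ff_pos ff (k := a.-1) ltac:(lia) E; rewrite fa; lia.
Qed.

End MinimalShape.

(* The shape of the involutions in G: no visible descent above [n]. *)
Record gfun (n : nat) (f : nat -> int) : Prop := GFun {
  gf_fpf : fpf_fun (2 * n) f;
  gf_low : forall k, (n < k <= 2 * n)%N -> - k%:Z <= f k;
  gf_up : forall k, (n < k < 2 * n)%N -> f k.+1 < k%:Z -> f k <= f k.+1 }.

Definition lowered (n : nat) (f : nat -> int) (k : nat) : bool :=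
  (n < k <= 2 * n)%N && (`|f k| <= n)%N.

Section GShape.

Variables (n : nat) (f : nat -> int) (gf : gfun n f).
Let ff := gf_fpf gf.

(** If [f k = - l] with [l] also above [n], then [gf_low] at [k] and at [l] gives [k = l], a negated
    point. *)
Lemma gf_neg k : (n < k <= 2 * n)%N -> f k < 0 -> (`|f k| <= n)%N.
Proof.
move=> kr fk; have kN : (0 < k <= 2 * n)%N by lia.
have [l El] : exists l : nat, f k = - l%:Z by exists `|f k|%N; lia.
have [lN fl] := ff_neg ff kN El; have := ff_fix ff kN; have := gf_low gf kr.
have [ln|nl] := leqP l n; first lia.
have lr : (n < l <= 2 * n)%N by lia.
have := gf_low gf lr; lia.
Qed.

(** The absence of a visible descent at [k] bounds [f k] by [f k.+1], and [gf_neg] controls negative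
    values. Hence lowered points form an initial segment above [n], and [f] increases along it. *)
Lemma lowered_pred k : (n < k)%N -> lowered n f k.+1 -> lowered n f k /\ f k < f k.+1.
Proof.
rewrite /lowered => nk /andP[k1 fk1]; have kr : (n < k < 2 * n)%N by lia.
have kr' : (n < k <= 2 * n)%N by lia.
have kN : (0 < k <= 2 * n)%N by lia.
have := gf_up gf kr; have lt : f k.+1 < k%:Z by lia.
move=> /(_ lt) le.
have ne : f k != f k.+1.
  apply/eqP => E; have [f0|f0] := lerP 0 (f k).
    have [l El] : exists l : nat, f k = l%:Z by exists `|f k|%N; lia.
    have [_ E1] := ff_pos ff kN El.
    have [_ E2] := ff_pos ff (k := k.+1) ltac:(lia) (etrans (esym E) El); lia.
  have [l El] : exists l : nat, f k = - l%:Z by exists `|f k|%N; lia.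
  have [_ E1] := ff_neg ff kN El.
  have [_ E2] := ff_neg ff (k := k.+1) ltac:(lia) (etrans (esym E) El); lia.
split; last lia.
have [f0|f0] := ltP (f k) 0; first by have := gf_neg kr' f0; lia.
lia.
Qed.

Lemma lowered_down k l : (n < l <= k)%N -> lowered n f k -> lowered n f l.
Proof.
move=> lk; have [j E] : exists j, k = (l + j)%N by exists (k - l)%N; lia.
elim: j k E lk => [|j IH] k ->; first by rewrite addn0.
rewrite addnS => lk /lowered_pred[|h _]; first lia.
by apply: (IH (l + j)%N) => //; lia.
Qed.

Lemma lowered_mono k l : (n < l < k)%N -> lowered n f k -> f l < f k.
Proof.
move=> lk; have [j E] : exists j, k = (l + j).+1 by exists (k - l).-1; lia.
elim: j k E lk => [|j IH] k ->.
  by rewrite addn0 => lk /lowered_pred[|_]; lia.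
rewrite addnS => lk /lowered_pred[|h h']; first lia.
by have := IH (l + j).+1 (erefl _) _ h; lia.
Qed.

(** Beyond the lowered segment all values are again upper, and the argument of [min_shape] forces
    consecutive pairs. *)
Lemma upper_shape k : (n < k <= 2 * n)%N -> ~~ lowered n f k ->
  f k = k.+1%:Z \/ f k = k%:Z - 1.
Proof.
have [j] := ubnP k; elim: j k => // j IH k; rewrite ltnS => lej kr nlk.
have kN : (0 < k <= 2 * n)%N by lia.
have fk0 : 0 < f k.
  have := ff_fix ff kN; have := gf_neg kr; move: nlk; rewrite /lowered kr /=; lia.
have fkn : n%:Z < f k by move: nlk; rewrite /lowered kr /=; lia.
have [a Ea] : exists a : nat, f k = a%:Z by exists `|f k|%N; lia.
have [aN fa] := ff_pos ff kN Ea; have := ff_fix ff kN => fx.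
have ar : (n < a <= 2 * n)%N by lia.
have nla : ~~ lowered n f a by rewrite /lowered ar fa /=; lia.
have [ltak|gtak|ak] := ltngtP a k; last by lia.
  by have [||//||] := IH a; rewrite ?fa; lia.
have [ak1|nak] := eqVneq a k.+1; first by left; rewrite Ea ak1.
have pr : (n < a.-1 < 2 * n)%N by lia.
have pN : (0 < a.-1 <= 2 * n)%N by lia.
have := gf_up gf pr; rewrite prednK ?fa; last lia.
have lt : k%:Z < a.-1%:Z by lia.
move=> /(_ lt) le.
have nlp : ~~ lowered n f a.-1.
  apply: contra nlk => lp; apply: lowered_down lp; lia.
have fp0 : 0 < f a.-1.
  have := ff_fix ff pN; have := gf_neg (k := a.-1); move: nlp; rewrite /lowered; lia.
have [b Eb] : exists b : nat, f a.-1 = b%:Z by exists `|f a.-1|%N; lia.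
have [bN fb] := ff_pos ff pN Eb.
have nlb : (n < b)%N by move: nlp; rewrite /lowered; lia.
have bk : b != k by apply/eqP => E; move: fb; rewrite E; lia.
have [||||] := IH b; rewrite ?fb; try lia.
by rewrite /lowered fb; lia.
Qed.

End GShape.

Lemma up_mono n (f : nat -> int) :
  (forall k, (0 < k < n)%N -> f k < f k.+1 \/ f k = k.+1%:Z) ->
  forall k j, (0 < k)%N -> (k + j <= n)%N -> n%:Z < f k -> f k <= f (k + j)%N.
Proof.
move=> mono k j k0; elim: j => [|j IH] kj gt; first by rewrite addn0.
have le := IH ltac:(lia) gt.
by have := mono (k + j)%N ltac:(lia); rewrite addnS; lia.
Qed.

(** The point [a = f k] is lowered for [g] too, so [a = g l] with [l <= n]. If [l <= k], values
    above [n] grow, so [a <= g k]; if [l > k], agreement beyond [k] gives [f l = f k], which is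
    impossible. *)
Lemma gmin_le n f g (gf : gfun n f) (gg : gfun n g)
  (fpos : forall k, (0 < k <= n)%N -> 0 < f k)
  (gpos : forall k, (0 < k <= n)%N -> 0 < g k)
  (fmono : forall k, (0 < k < n)%N -> f k < f k.+1 \/ f k = k.+1%:Z)
  (gmono : forall k, (0 < k < n)%N -> g k < g k.+1 \/ g k = k.+1%:Z)
  (fg : forall k, lowered n f k = lowered n g k) k :
  (0 < k <= n)%N -> n%:Z < f k ->
  (forall l, (k < l <= n)%N -> f l = g l) -> f k <= g k.
Proof.
move=> kr fk IH; have kN : (0 < k <= 2 * n)%N by lia.
have [a Ea] : exists a : nat, f k = a%:Z by exists `|f k|%N; lia.
have [aN fa] := ff_pos (gf_fpf gf) kN Ea.
have : lowered n f a by rewrite /lowered fa; lia.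
rewrite fg /lowered => /andP[ar ga].
have aN' : (0 < a <= 2 * n)%N by lia.
have [l El] : exists l : nat, g a = l%:Z.
  have [l El] : exists l : nat, g a = - l%:Z \/ g a = l%:Z by exists `|g a|%N; lia.
  case: El => El; last by exists l.
  have [lN gl] := ff_neg (gf_fpf gg) aN' El.
  by have := gpos l; lia.
have [lN gl] := ff_pos (gf_fpf gg) aN' El.
have [lk|kl] := leqP l k.
  have := @up_mono n g gmono l (k - l) ltac:(lia) ltac:(lia) ltac:(lia).
  by rewrite subnKC // gl Ea.
have := IH l ltac:(lia); rewrite gl => fl.
by have [|_ E] := ff_pos (gf_fpf gf) (k := l) (l := a) _ fl; lia.
Qed.

(** Positions up to [n] with values above [n] are compared from [n] downwards, using [gmin_le] both
    ways. The other positions up to [n] follow the parity pattern of [min_shape], and upper points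
    are partners of lower ones or form consecutive pairs. *)
Lemma gmin_unique n f g (gf : gfun n f) (gg : gfun n g)
  (fpos : forall k, (0 < k <= n)%N -> 0 < f k)
  (gpos : forall k, (0 < k <= n)%N -> 0 < g k)
  (fmono : forall k, (0 < k < n)%N -> f k < f k.+1 \/ f k = k.+1%:Z)
  (gmono : forall k, (0 < k < n)%N -> g k < g k.+1 \/ g k = k.+1%:Z)
  (fg : forall k, lowered n f k = lowered n g k) k :
  (0 < k <= 2 * n)%N -> f k = g k.
Proof.
have nn : (n <= 2 * n)%N by lia.
have gf' k' : lowered n g k' = lowered n f k' by rewrite fg.
have low j : (j < n)%N -> n%:Z < f (n - j)%N \/ n%:Z < g (n - j)%N ->
    f (n - j)%N = g (n - j)%N.
  have [i] := ubnP j; elim: i j => // i IH j; rewrite ltnS => lei jn.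
  have above l (f0 : nat -> int) (mono : forall k, (0 < k < n)%N -> f0 k < f0 k.+1 \/ f0 k = k.+1%:Z) :
      n%:Z < f0 (n - j)%N -> (n - j < l <= n)%N -> n%:Z < f0 l.
    move=> gt lr; have := @up_mono n f0 mono (n - j) (l - (n - j)) ltac:(lia) ltac:(lia) gt.
    by rewrite subnKC; lia.
  have eqf : n%:Z < f (n - j)%N -> f (n - j)%N <= g (n - j)%N.
    move=> gt; apply: (gmin_le gf gg) => //; first lia.
    move=> l lr; have := IH (n - l)%N ltac:(lia) ltac:(lia).
    rewrite subKn; last lia.
    by apply; left; apply: (above _ _ fmono) gt lr.
  have eqg : n%:Z < g (n - j)%N -> g (n - j)%N <= f (n - j)%N.
    move=> gt; apply: (gmin_le gg gf) => //; first lia.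
    move=> l lr; have := IH (n - l)%N ltac:(lia) ltac:(lia).
    rewrite subKn; last lia.
    by move=> H; apply/esym; apply: H; right; apply: (above _ _ gmono) gt lr.
  by case=> gt; [have := eqf gt | have := eqg gt] => le;
    [have := eqg ltac:(lia) | have := eqf ltac:(lia)]; lia.
have lower k' : (0 < k' <= n)%N -> f k' = g k'.
  move=> kr; have := low (n - k')%N ltac:(lia); rewrite subKn; last lia.
  move=> E; case: (min_shape (gf_fpf gf) nn fpos fmono kr) => [gt|[ok fk]|[ok fk]].
  - by apply: E; left.
  - case: (min_shape (gf_fpf gg) nn gpos gmono kr) => [gt|[ok' gk]|[ok' gk]]; last 1 first.
    + by rewrite ok in ok'.
    + by apply: E; right.
    + by rewrite fk gk.
  - case: (min_shape (gf_fpf gg) nn gpos gmono kr) => [gt|[ok' gk]|[ok' gk]]; last 1 first.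
    + by rewrite fk gk.
    + by apply: E; right.
    + by rewrite ok' in ok.
have [j] := ubnP k; elim: j k => // j IH k; rewrite ltnS => lej kr.
have [kn|nk] := leqP k n; first by apply: lower; lia.
have nkr : (n < k <= 2 * n)%N by lia.
have [lk|nlk] := boolP (lowered n f k).
  have := lk; rewrite /lowered nkr /= => fk.
  have [l El] : exists l : nat, f k = l%:Z.
    have [l El] : exists l : nat, f k = - l%:Z \/ f k = l%:Z by exists `|f k|%N; lia.
    case: El => El; last by exists l.
    have [lN fl] := ff_neg (gf_fpf gf) kr El.
    by have := fpos l; lia.
  have [lN fl] := ff_pos (gf_fpf gf) kr El.
  have gl : g l = k%:Z by rewrite -lower //; lia.
  have [|_ gk] := ff_pos (gf_fpf gg) (k := l) (l := k) _ gl; first lia.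
  by rewrite El gk.
have nlg : ~~ lowered n g k by rewrite -fg.
(* Excludes pairings shifted by one: if one function pairs [k] with [k - 1], the other agrees with
   it at [k - 1] and so does the same. *)
have half (f0 g0 : nat -> int) (h : gfun n f0) (h' : gfun n g0) : (forall l, (l < k)%N -> (0 < l <= 2 * n)%N ->
    f0 l = g0 l) -> f0 k = k%:Z - 1 -> g0 k = k%:Z - 1.
  move=> E E0; have E0' : f0 k = k.-1%:Z by lia.
  have [pN fp] := ff_pos (gf_fpf h) kr E0'.
  have := E k.-1 ltac:(lia) pN; rewrite fp => /esym gp.
  have [_ ->] := ff_pos (gf_fpf h') pN gp; lia.
have IH' l : (l < k)%N -> (0 < l <= 2 * n)%N -> f l = g l by move=> lk; apply: IH; lia.
case: (upper_shape gf nkr nlk) => fk; case: (upper_shape gg nkr nlg) => gk.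
- by rewrite fk gk.
- by have := half g f gg gf (fun l lk lr => esym (IH' l lk lr)) gk; rewrite gk.
- by have := half f g gf gg IH' fk; rewrite fk.
- by rewrite fk gk.
Qed.

(** * Fixed-point-free signed involutions *)

Definition negc n (z : Perm n) (i : nat) : bool := sapp z i < - (i%:Z).

(* In type D the count runs over [2n], not over [n] as in [FD], so that the set is
   stable under conjugation by all generators of the group of rank [2n]. *)
Definition Xset n t : {set Perm n} :=
  [set z in Wgrp n t (2 * n) | [&& involution z,
     all (fun i : nat => absz (sapp z i) != i) (iota 1 (2 * n)) &
     if t is TD then ~~ odd (count (negc z) (iota 1 (2 * n))) else true]].

Lemma odd_count_swap N j (p p' : pred nat) : (0 < j < N)%N ->
  (forall k, (0 < k <= N)%N -> k <> j -> k <> j.+1 -> p k = p' k) ->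
  odd (p j + p j.+1) = odd (p' j + p' j.+1) ->
  odd (count p (iota 1 N)) = odd (count p' (iota 1 N)).
Proof.
move=> jN pp' odd2.
have -> : iota 1 N = iota 1 j.-1 ++ [:: j; j.+1] ++ iota j.+2 (N - j.+1).
  have E : N = (j.-1 + (2 + (N - j.+1)))%N by lia.
  rewrite {1}E !iotaD; congr (_ ++ _); rewrite (_ : 1 + j.-1 = j)%N; last lia.
  by rewrite (_ : j + 2 = j.+2)%N; last lia.
have E r : {in r, p =1 p'} -> count p r = count p' r by move/eq_in_count.
rewrite !count_cat !oddD; congr (_ (+) (_ (+) _)).
- by rewrite E // => k; rewrite mem_iota => kr; apply: pp'; lia.
- by move: odd2; rewrite /= !oddD /= !addbF.
- by rewrite E // => k; rewrite mem_iota => kr; apply: pp'; lia.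
Qed.

Definition insupp (a b v : int) : bool := [|| v == a, v == b, v == - a | v == - b].

Lemma sref_fix a b v : ~~ insupp a b v -> sref a b v = v.
Proof. by rewrite /insupp /sref; split_ifs; lia. Qed.

Lemma sref_in a b v : insupp a b v -> insupp a b (sref a b v).
Proof. by rewrite /insupp /sref; split_ifs; lia. Qed.

Lemma sref_comm a b p q v : ~~ insupp a b p -> ~~ insupp a b q ->
  sref a b (sref p q v) = sref p q (sref a b v).
Proof.
move=> pN qN; have dis x : insupp a b x -> ~~ insupp p q x.
  by rewrite /insupp in pN qN *; lia.
have [vab|vab] := boolP (insupp a b v).
  rewrite [sref p q v]sref_fix ?dis // [sref p q _]sref_fix //.
  by apply: dis; apply: sref_in.
rewrite [sref a b v]sref_fix //.
have [vpq|vpq] := boolP (insupp p q v); last by rewrite [sref p q v]sref_fix // sref_fix.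
rewrite sref_fix //; apply: contraTN (sref_in vpq); exact: dis.
Qed.

(** * Perfectness of the fixed-point-free signed involutions *)

Section PerfectModel.

Variables (n : nat) (n1 : (1 < n)%N).
Implicit Types (w z s y : Perm n) (v i j : int) (t : ctype).
Local Notation inr := (inrange n).

Record fpf z : Prop := Fpf {
  fp_odd : podd z;
  fp_inv : forall v, inr v -> sapp z (sapp z v) = v;
  fp_fix : forall v, inr v -> v != 0 -> sapp z v != v;
  fp_neg : forall v, inr v -> v != 0 -> sapp z v != - v }.

Lemma fpf_absz z : podd z ->
  (forall k : nat, (0 < k <= 2 * n)%N -> absz (sapp z k) != k) ->
  forall v, inr v -> v != 0 -> (sapp z v != v) /\ (sapp z v != - v).
Proof.
move=> oz zf v vr v0; have vr' : (`|v| <= 2 * n)%N by [].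
have := zf `|v|%N ltac:(lia); have [vp|vn] := ltP 0 v.
  have -> : `|v|%N%:Z = v by lia.
  by move: (sapp z v) => x; lia.
have -> : `|v|%N%:Z = - v by lia.
by rewrite oz //; move: (sapp z v) => x; lia.
Qed.

Lemma fpf_X t z : z \in Xset n t -> fpf z.
Proof.
rewrite inE => /andP[zW /and3P[/eqP zi /allP za _]].
have oz := odd_W n1 (leqnn _) zW.
have zf := fpf_absz oz (fun k kr => za k ltac:(rewrite mem_iota; lia)).
split=> // [v vr|v vr v0|v vr v0].
- by rewrite -sappM zi sapp1.
- by case: (zf v vr v0).
- by case: (zf v vr v0).
Qed.

Lemma inr_nat (k : nat) : (k <= 2 * n)%N -> inr k.
Proof. by rewrite /inrange; lia. Qed.

Lemma fpf_funP z : fpf z -> fpf_fun (2 * n) (fun k => sapp z k%:Z).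
Proof.
move=> fz; have oz := fp_odd fz.
have nz (k : nat) : (0 < k <= 2 * n)%N -> sapp z k != 0.
  by move=> kr; rewrite sapp_eq0 //; [lia | apply: inr_nat; lia].
split=> [k l kr E|k l kr E|k kr].
- have kr' : inr k by apply: inr_nat; lia.
  have := nz k kr; rewrite E; have := sapp_inr z k; rewrite E /inrange => lr l0.
  by split; [lia | rewrite -E fp_inv].
- have kr' : inr k by apply: inr_nat; lia.
  have := nz k kr; rewrite E; have := sapp_inr z k; rewrite E /inrange => lr l0.
  split; first lia.
  have -> : (l%:Z : int) = - sapp z k by rewrite E opprK.
  by rewrite oz ?sapp_inr // fp_inv.
- have kr' : inr k by apply: inr_nat; lia.
  have := fp_fix fz kr' ltac:(lia); have := fp_neg fz kr' ltac:(lia).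
  by move: (sapp z k) => x; lia.
Qed.

Lemma sapp_sref w i v : -1 <= i -> i < (2 * n)%:Z -> podd w -> inr v ->
  sapp w (sref (ra i) (rb i) v) = sref (sapp w (ra i)) (sapp w (rb i)) (sapp w v).
Proof.
move=> i1 i2 ow vr; have [ab a0 b0 ar br] := root_facts n1 i1 i2.
rewrite /sref !sapp_eq // !sapp_eqN //.
by split_ifs; rewrite ?ow.
Qed.

Lemma root_val z i : -1 <= i -> i < (2 * n)%:Z -> fpf z ->
  [/\ sapp z (ra i) != 0, sapp z (rb i) != 0, sapp z (ra i) != sapp z (rb i) &
   [/\ sapp z (ra i) != ra i, sapp z (ra i) != - ra i, sapp z (rb i) != rb i
    & sapp z (rb i) != - rb i]].
Proof.
move=> i1 i2 fz; have [ab a0 b0 ar br] := root_facts n1 i1 i2.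
have oz := fp_odd fz; rewrite !sapp_eq0 // sapp_eq //; split=> //; first lia.
by split; rewrite ?(fp_fix fz) ?(fp_neg fz).
Qed.

Lemma comm_genE z i : -1 <= i -> i < (2 * n)%:Z -> fpf z ->
  (gen n i * z == z * gen n i)%g = (sapp z (ra i) == rb i) || (sapp z (ra i) == - rb i).
Proof.
move=> i1 i2 fz; have [ab a0 b0 ar br] := root_facts n1 i1 i2; have oz := fp_odd fz.
have [za0 zb0 zab [zaa zaNa zbb zbNb]] := root_val i1 i2 fz.
apply/eqP/idP => [E|H].
  have := congr1 (fun w => sapp w (ra i)) E; rewrite !sappM !sapp_gen ?sapp_inr //.
  have -> : sref (ra i) (rb i) (ra i) = rb i by rewrite /sref eqxx.
  move: (sapp z (ra i)) (sapp z (rb i)) zab zaa zaNa => p q; rewrite /sref.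
  by split_ifs; lia.
apply: sappP => v vr; rewrite !sappM !sapp_gen ?sapp_inr // sapp_sref //.
have : (sapp z (ra i) = rb i /\ sapp z (rb i) = ra i) \/
       (sapp z (ra i) = - rb i /\ sapp z (rb i) = - ra i).
  case/orP: H => /eqP E; [left | right]; split=> //.
    by rewrite -E fp_inv.
  by rewrite -[rb i]opprK -E oz ?sapp_inr // fp_inv.
move: (sapp z v) => x; case=> -[-> ->]; clear -ab a0 b0;
  move: (ra i) (rb i) ab a0 b0 => a b ab a0 b0; rewrite /sref; split_ifs; lia.
Qed.

(** [z s z] is the reflection in the images of the pair of [s]. Since [z] neither fixes nor negates
    a point, either [s] commutes with [z] or these images avoid the pair up to sign, and reflections
    with disjoint supports commute. *)
Lemma perf_comm_gen z i : -1 <= i -> i < (2 * n)%:Z -> fpf z ->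
  commute (gen n i) (z * gen n i * z)%g.
Proof.
move=> i1 i2 fz; have [ab a0 b0 ar br] := root_facts n1 i1 i2; have oz := fp_odd fz.
have zz : (z * z = 1)%g.
  by apply: sappP => v vr; rewrite sappM sapp1 // fp_inv.
have [E|nE] := eqVneq (gen n i * z)%g (z * gen n i)%g.
  by rewrite /commute -E -(mulgA _ z z) zz mulg1.
rewrite comm_genE // negb_or in nE.
have [za0 zb0 zab [zaa zaNa zbb zbNb]] := root_val i1 i2 fz.
have nb : (sapp z (rb i) != ra i) && (sapp z (rb i) != - ra i).
  apply/andP; split; apply/negP => /eqP E; case/andP: (nE).
    by rewrite -E fp_inv // eqxx.
  by rewrite -[ra i]opprK -E oz ?sapp_inr // fp_inv // eqxx.
have zsz v : inr v -> sapp (z * gen n i * z)%g v = sref (sapp z (ra i)) (sapp z (rb i)) v.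
  by move=> vr; rewrite !sappM sapp_gen ?sapp_inr // sapp_sref ?sapp_inr // fp_inv.
apply: sappP => v vr; rewrite [LHS]sappM [RHS]sappM !zsz ?sapp_inr // !sapp_gen //.
  by apply/esym; apply: sref_comm; rewrite /insupp; move: nE nb; lia.
by rewrite -zsz // sapp_inr.
Qed.

Lemma conj_sapp z i v : -1 <= i -> i < (2 * n)%:Z -> inr v ->
  sapp (z ^ gen n i)%g v = sref (ra i) (rb i) (sapp z (sref (ra i) (rb i) v)).
Proof.
move=> i1 i2 vr; have V : ((gen n i)^-1 = gen n i)%g.
  by apply/eqP; rewrite eq_invg_mul gen_invol.
by rewrite conjgE V mulgA !sappM [sapp (gen n i) (sapp z _)]sapp_gen ?sapp_inr // sapp_gen.
Qed.

(** In the noncommuting case only two entries can change. For [i > 0] they are interchanged; for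
    [i = -1] the values at 1 and 2 become the opposites of those at 2 and 1, so the count [p] of the
    two becomes [2 - p]. *)
Lemma conj_count z i : vidx TD (2 * n) i -> fpf z ->
  odd (count (negc (z ^ gen n i)%g) (iota 1 (2 * n))) =
  odd (count (negc z) (iota 1 (2 * n))).
Proof.
move=> vi fz; have [i1 i2] := vidx_bound n1 (leqnn _) vi; have oz := fp_odd fz.
have [E|nE] := eqVneq (gen n i * z)%g (z * gen n i)%g.
  by congr (odd (count (negc _) _)); rewrite conjgE -E mulgA mulVg mul1g.
rewrite comm_genE // negb_or in nE.
have [ab a0 b0 ar br] := root_facts n1 i1 i2.
have [za0 zb0 zab [zaa zaNa zbb zbNb]] := root_val i1 i2 fz.
have nb : (sapp z (rb i) != ra i) && (sapp z (rb i) != - ra i).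
  apply/andP; split; apply/negP => /eqP E; case/andP: (nE).
    by rewrite -E fp_inv // eqxx.
  by rewrite -[ra i]opprK -E oz ?sapp_inr // fp_inv // eqxx.
have fixa : sref (ra i) (rb i) (sapp z (ra i)) = sapp z (ra i).
  by apply: sref_fix; rewrite /insupp; lia.
have fixb : sref (ra i) (rb i) (sapp z (rb i)) = sapp z (rb i).
  by apply: sref_fix; rewrite /insupp; lia.
have [im|ip] := eqVneq i (-1).
  have ra1 : ra i = -2 by rewrite /ra im.
  have rb1 : rb i = 1 by rewrite /rb im.
  rewrite ra1 rb1 in nE nb fixa fixb ab ar br zaa zaNa zbb zbNb za0 zb0.
  have r2 : inr 2 by rewrite /inrange; lia.
  have zm2 : sapp z (-2) = - sapp z 2 by rewrite -oz.
  have zm1 : sapp z (-1) = - sapp z 1 by rewrite -oz.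
  apply: (@odd_count_swap _ 1); first lia.
    move=> k kr k1 k2; rewrite /negc conj_sapp // ?ra1 ?rb1; last by apply: inr_nat; lia.
    rewrite [sref _ _ k]sref_fix; last by rewrite /insupp; lia.
    have := sapp_inr z k; move: (sapp z k) => x _; rewrite /sref; split_ifs; lia.
  rewrite /negc !conj_sapp // ra1 rb1.
  have -> : sref (-2) 1 1%:Z = -2 by [].
  have -> : sref (-2) 1 2%:Z = -1 by [].
  rewrite fixa zm1.
  have -> : sref (-2) 1 (- sapp z 1) = - sapp z 1.
    by apply: sref_fix; rewrite /insupp; lia.
  rewrite zm2 in nE zaa zaNa za0 *.
  by case: (ltP (- sapp z 2)); case: (ltP (- sapp z 1)); case: (ltP (sapp z 1));
    case: (ltP (sapp z 2)) => /=; lia.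
have [j Ej] : exists j : nat, i = j%:Z by exists `|i|%N; lia.
have jr : (0 < j < 2 * n)%N by move: vi; rewrite /vidx; clear -Ej ip; lia.
have ra1 : ra i = j%:Z by rewrite /ra; split_ifs; lia.
have rb1 : rb i = j.+1%:Z by rewrite /rb; split_ifs; lia.
rewrite ra1 rb1 in nE nb fixa fixb ab ar br zaa zaNa zbb zbNb za0 zb0.
apply: (@odd_count_swap _ j) => //.
  move=> k kr k1 k2; rewrite /negc conj_sapp // ?ra1 ?rb1; last by apply: inr_nat; lia.
  rewrite [sref _ _ k]sref_fix; last by rewrite /insupp; lia.
  by move: (sapp z k) => x; rewrite /sref; split_ifs; lia.
rewrite /negc !conj_sapp // ra1 rb1.
have -> : sref j%:Z j.+1%:Z j%:Z = j.+1%:Z by rewrite /sref eqxx.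
have -> : sref j%:Z j.+1%:Z j.+1%:Z = j%:Z by rewrite /sref; split_ifs; lia.
rewrite fixa fixb addnC; congr (odd (nat_of_bool _ + nat_of_bool _)); lia.
Qed.

Lemma fpf_conj z i : -1 <= i -> i < (2 * n)%:Z -> fpf z -> fpf (z ^ gen n i)%g.
Proof.
move=> i1 i2 fz; have og := odd_gen n1 i1 i2; have oz := fp_odd fz.
have V : ((gen n i)^-1 = gen n i)%g by apply/eqP; rewrite eq_invg_mul gen_invol.
have gg v : inr v -> sapp (gen n i) (sapp (gen n i) v) = v.
  by move=> vr; rewrite -sappM gen_invol // sapp1.
have E v : sapp (z ^ gen n i)%g v = sapp (gen n i) (sapp z (sapp (gen n i) v)).
  by rewrite conjgE V !sappM.
split.
- by rewrite conjgE V; apply: oddM => //; apply: oddM.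
- by move=> v vr; rewrite !E gg ?sapp_inr // fp_inv ?sapp_inr // gg.
- move=> v vr v0; rewrite E; apply: contraNneq (fp_fix fz (sapp_inr (gen n i) v) _).
    by move=> E'; rewrite -{2}E' gg ?sapp_inr.
  by rewrite sapp_eq0.
- move=> v vr v0; rewrite E; apply: contraNneq (fp_neg fz (sapp_inr (gen n i) v) _).
    by move=> E'; rewrite -og // -E' gg ?sapp_inr.
  by rewrite sapp_eq0.
Qed.

Lemma fpf_all z : fpf z -> all (fun i : nat => absz (sapp z i) != i) (iota 1 (2 * n)).
Proof.
move=> fz; apply/allP => k; rewrite mem_iota => kr.
by apply: (ff_fix (fpf_funP fz)); lia.
Qed.

Lemma perfect_X t : perfect_set (gens n t (2 * n)) (Xset n t).
Proof.
split.
- by move=> z; rewrite inE => /andP[].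
- by move=> z; rewrite inE => /andP[_ /and3P[/eqP]].
- move=> z _ zX /gensP[i vi ->]; have [i1 i2] := vidx_bound n1 (leqnn _) vi.
  have fz := fpf_X zX; have fz' := fpf_conj i1 i2 fz.
  have gW : gen n i \in Wgrp n t (2 * n) by apply: mem_gen; apply/gensP; exists i.
  move: zX; rewrite !inE => /andP[zW /and3P[/eqP zi _ zc]].
  rewrite groupJ // fpf_all //=; apply/andP; split; first by rewrite /involution -conjMg zi conj1g.
  by case: t vi zc {zW gW} => // vi; rewrite conj_count.
- move=> z _ zX /gensP[i vi ->]; have [i1 i2] := vidx_bound n1 (leqnn _) vi.
  exact: perf_comm_gen i1 i2 (fpf_X zX).
Qed.

End PerfectModel.

Lemma count_iota1 (p : pred nat) N : (0 < N)%N -> p 1%N ->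
  (forall k, (1 < k <= N)%N -> ~~ p k) -> count p (iota 1 N) = 1%N.
Proof.
case: N => // N _ p1 pk /=; rewrite p1; apply/eqP.
rewrite -[X in _ == X]addn0 eqn_add2l eqn0Ngt -has_count; apply/hasPn => k.
by rewrite mem_iota => kr; apply: pk; lia.
Qed.

(** * Minimal elements and the comparison of G with the big set *)

Section MinimalElements.

Variables (n : nat) (n1 : (1 < n)%N).
Implicit Types (w z s y : Perm n) (v i j : int) (t : ctype).
Local Notation inr := (inrange n).

Lemma sapp_ext z z' : podd z -> podd z' ->
  (forall k : nat, (0 < k <= 2 * n)%N -> sapp z k = sapp z' k) -> z = z'.
Proof.
move=> oz oz' E; apply: sappP => v vr; have vr' : (`|v| <= 2 * n)%N by [].
have [v0|v0|->] := ltgtP v 0; last by rewrite !odd_sapp0.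
  have [k Ek] : exists k : nat, v = - k%:Z by exists `|v|%N; lia.
  by rewrite Ek oz ?oz' ?E //; try apply: inr_nat; lia.
have [k Ek] : exists k : nat, v = k%:Z by exists `|v|%N; lia.
by rewrite Ek E //; lia.
Qed.

(** Used at two levels: [m = 2n] for minimal elements of [Xset], and [m = n] for elements of G with
    [Des^<] empty. *)
Definition lmin t m z : Prop := forall i, vidx t m i ->
  [|| sapp z (ra i) == rb i, sapp z (ra i) == - rb i | ~~ (sapp z (rb i) < sapp z (ra i))].

Section LevelMin.

Variables (t : ctype) (m : nat) (z : Perm n).
Hypotheses (m2 : (1 < m <= 2 * n)%N) (fz : fpf z) (zm : lmin t m z).
Local Notation f := (fun k : nat => sapp z k%:Z).
Let ff := fpf_funP n1 fz.

Lemma lmin_mono (k : nat) : (0 < k < m)%N -> f k < f k.+1 \/ f k = k.+1%:Z.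
Proof.
move=> kr; have vk : vidx t m k by rewrite /vidx; lia.
have := zm vk; have -> : ra k = k%:Z by rewrite /ra; split_ifs; lia.
have -> : rb k = k.+1%:Z by rewrite /rb; split_ifs; lia.
have ne : f k != f k.+1.
  rewrite sapp_eq; [lia|apply: inr_nat; lia|apply: inr_nat; lia].
case/or3P=> [/eqP|/eqP E|]; first by right.
  by left; have [_ /= ->] := ff_neg ff (k := k) ltac:(lia) E; rewrite E; lia.
by move=> lt; left; move: ne lt; move: (sapp z k) (sapp z k.+1) => x x'; lia.
Qed.

Lemma lmin_chain (k l : nat) : (0 < k <= l)%N -> (l <= m)%N -> 0 < f k -> 0 < f l.
Proof.
move=> kl; have [j E] : exists j : nat, l = (k + j)%N by exists (l - k)%N; lia.
elim: j l E kl => [|j IH] l ->; first by rewrite addn0.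
rewrite addnS => kl lm f0; have := IH (k + j)%N (erefl _) ltac:(lia) ltac:(lia) f0.
have := lmin_mono (k := (k + j)%N) ltac:(lia); case=> [|E]; first by rewrite /=; lia.
have [_ /= ->] := ff_pos ff (k := (k + j)%N) ltac:(lia) E; lia.
Qed.

Hypothesis zA : is_true (if t is TA then z \in Wgrp n TA (2 * n) else true).
Hypothesis zD : is_true (if t is TD then ~~ odd (count (negc z) (iota 1 (2 * n))) else true).
Hypothesis zup : forall k, (m < k <= 2 * n)%N -> ~~ negc z k.

(** By [lmin_chain] only the value at 1 matters. In type A it is positive anyway, in type BC a
    negative value makes [s_0] a forbidden descent, and in type D it would be the only entry counted
    by [negc], against even parity. *)
Lemma lmin_pos (k : nat) : (0 < k <= m)%N -> 0 < f k.
Proof.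
move=> kr; suff f1 : 0 < f 1%N by apply: lmin_chain f1; lia.
have r1 : inr 1 by rewrite /inrange; lia.
have r2 : inr 2 by rewrite /inrange; lia.
have oz := fp_odd fz.
have f10 : sapp z 1 != 0 by rewrite sapp_eq0.
have f1n := fp_neg fz r1 isT; have f1f := fp_fix fz r1 isT.
have zm1 : sapp z (-1) = - sapp z 1 by rewrite -oz.
have zm2 : sapp z (-2) = - sapp z 2 by rewrite -oz.
case: t zA zD zm => [zW _ _|_ _ /(_ 0 isT)|_ zc /(_ (-1) isT)].
- by apply: (pos_WA n1 (leqnn _) zW).
- rewrite /ra /rb /= zm1; move: f10 f1n f1f; move: (sapp z 1) => x; lia.
rewrite /ra /rb /= zm2 => H; rewrite ltNge; apply/negP => /= f1.
have m12 := lmin_mono (k := 1%N) ltac:(lia); rewrite /= in m12.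
suff [n1c nkc] : negc z 1 /\ forall l, (1 < l <= m)%N -> ~~ negc z l.
  have N0 : (0 < 2 * n)%N by lia.
  move: zc; rewrite (count_iota1 N0) // => l lr.
  by have [lm|ml] := leqP l m; [apply: nkc | apply: zup]; lia.
split; first by rewrite /negc; move: f1 f10 f1n; move: (sapp z 1) => x; lia.
have ge0 l : 0 < f l -> ~~ negc z l by rewrite /negc /=; move: (sapp z l) => x; lia.
have [f2|f2] := ltP 0 (sapp z 2).
  by move=> l lr; apply: ge0; apply: (lmin_chain (k := 2%N)); [lia|lia|exact: f2].
have f20 : sapp z 2 != 0 by rewrite sapp_eq0.
(* With both values negative, [s_{-1}] is a descent, so it commutes with [z]; this pairs 2 with -1,
   and the entry at 2 is not counted. *)
have f2m : sapp z 2 = - 1%N%:Z.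
  by move: H f1 f2 f20 m12; move: (sapp z 1) (sapp z 2) => x x'; lia.
move=> l lr; have [->|l2] := eqVneq l 2%N; first by rewrite /negc f2m.
apply: ge0; apply: (lmin_chain (k := 3%N)); [lia|lia|].
have r3 : inr 3 by rewrite /inrange; lia.
have f30 : sapp z 3 != 0 by rewrite sapp_eq0.
have := lmin_mono (k := 2%N) ltac:(lia); rewrite /= f2m.
by move: f30; move: (sapp z 3) => x; lia.
Qed.

End LevelMin.

Lemma X_mem t z : z \in Xset n t ->
  is_true (if t is TA then z \in Wgrp n TA (2 * n) else true) /\
  is_true (if t is TD then ~~ odd (count (negc z) (iota 1 (2 * n))) else true).
Proof. by rewrite inE => /andP[+ /and3P[_ _]]; case: t. Qed.

Lemma xmin_lmin t (x : {z | z \in Xset n t}) :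
  xmin (gens n t (2 * n)) (@Ddes n) x -> lmin t (2 * n) (val x).
Proof.
move=> xm i vi; have [i1 i2] := vidx_bound n1 (leqnn _) vi.
have fx := fpf_X n1 (valP x).
have gS : gen n i \in gens n t (2 * n) by apply/gensP; exists i.
have := xm _ gS; rewrite /xcomm comm_genE // D_gen //; last exact: fp_odd.
by rewrite orbA.
Qed.

(** Values are positive and at most [2n], so [min_shape] leaves only the involution exchanging 1
    with 2, 3 with 4, and so on. *)
Lemma xmin_unique t (x x' : {z | z \in Xset n t}) :
  xmin (gens n t (2 * n)) (@Ddes n) x -> xmin (gens n t (2 * n)) (@Ddes n) x' -> x = x'.
Proof.
have shape (y : {z | z \in Xset n t}) k : xmin (gens n t (2 * n)) (@Ddes n) y ->
    (0 < k <= 2 * n)%N -> sapp (val y) k = if odd k then k.+1%:Z else k%:Z - 1.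
  move=> ym kr; have fy := fpf_X n1 (valP y); have [yA yD] := X_mem (valP y).
  have nn : (1 < 2 * n <= 2 * n)%N by lia.
  have lm := xmin_lmin ym.
  have pos := lmin_pos nn fy lm yA yD (fun l lr => ltac:(lia)).
  have mono := lmin_mono nn fy lm.
  have := min_shape (fpf_funP n1 fy) (leqnn _) pos mono kr.
  case=> [|[-> ->]//|[/negbTE-> ->]//].
  by have := sapp_inr (val y) k; rewrite /inrange; move: (sapp _ _) => v /=; lia.
move=> xm xm'; apply: val_inj; apply: sapp_ext; rewrite ?(fp_odd (fpf_X n1 (valP _))) //.
- exact: fp_odd (fpf_X n1 (valP x)).
- exact: fp_odd (fpf_X n1 (valP x')).
- by move=> k kr; rewrite !shape.
Qed.

Lemma min_len_ex t : exists e, forall x : {z | z \in Xset n t},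
  xmin (gens n t (2 * n)) (@Ddes n) x -> glen t (val x) = e.
Proof.
have [[x xm]|no] := pselect (exists x : {z | z \in Xset n t},
    xmin (gens n t (2 * n)) (@Ddes n) x).
  by exists (glen t (val x)) => x' xm'; rewrite (xmin_unique xm' xm).
by exists 0%N => x xm; case: no; exists x.
Qed.

Lemma idx_neq v v' : inr v -> inr v' -> v != v' -> idx n v != idx n v'.
Proof.
by move=> vr vr'; apply: contra => /eqP E; rewrite -(idxK vr) E idxK.
Qed.

(** Every generator other than [s_0] is a product of two transpositions of ambient points, so the
    sign of the ambient permutation detects type D inside type BC. *)
Lemma odd_perm_gen i : -1 <= i -> i < (2 * n)%:Z -> odd_perm (gen n i) = (i == 0).
Proof.
move=> i1 i2; rewrite /gen /tr; case: (i =P 0) => [i0|i0].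
  by rewrite odd_tperm idx_neq // /inrange; lia.
by case: (i =P -1) => im; rewrite odd_permM !odd_tperm !idx_neq //= /inrange; lia.
Qed.

Lemma even_WD w : w \in Wgrp n TD (2 * n) -> odd_perm w = false.
Proof.
move: w; apply: W_ind => [|i w vi ow]; first by rewrite odd_perm1.
have [i1 i2] := vidx_bound n1 (leqnn _) vi.
by rewrite odd_permM ow odd_perm_gen // addbF; move: vi; rewrite /vidx; lia.
Qed.

Lemma gen0_conj i : 0 < i -> i < (2 * n)%:Z ->
  (gen n 0 * gen n i * gen n 0)%g = gen n (if i == 1 then -1 else i).
Proof.
move=> i0 i2; apply: sappP => v vr; have vr' : (`|v| <= 2 * n)%N by [].
have s0 u : inr u -> sapp (gen n 0) u = if u == 1 then -1 else if u == -1 then 1 else u.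
  move=> ur; rewrite sapp_gen //; try lia.
  by rewrite /sref /ra /rb /=; split_ifs; lia.
have -> : sapp (gen n (if i == 1 then -1 else i)) v =
    sref (ra (if i == 1 then -1 else i)) (rb (if i == 1 then -1 else i)) v.
  by apply: sapp_gen => //; case: ifP; lia.
have si u : inr u -> sapp (gen n i) u = sref (ra i) (rb i) u.
  by move=> ur; apply: sapp_gen => //; lia.
rewrite !sappM s0; last exact: sapp_inr.
rewrite si; last exact: sapp_inr.
rewrite (s0 v vr); clear s0 si vr vr'.
by rewrite /sref /ra /rb; case: (i =P 1) => i1; split_ifs; lia.
Qed.

(** Type D has index at most two: [s_0] normalizes it, exchanging [s_1] with [s_{-1}], so it can be
    moved to the front of any word. *)
Lemma WBC_split w : w \in Wgrp n TBC (2 * n) ->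
  w \in Wgrp n TD (2 * n) \/ (gen n 0 * w)%g \in Wgrp n TD (2 * n).
Proof.
have g00 : (gen n 0 * gen n 0 = 1)%g by rewrite gen_invol //; lia.
move: w; apply: W_ind => [|i w vi IH]; first by left; apply: group1.
have [->|i0] := eqVneq i 0.
  by case: IH => H; [right | left] => //; rewrite mulgA g00 mul1g.
have ip : 0 < i < (2 * n)%:Z by move: vi; rewrite /vidx; lia.
have gD j : vidx TD (2 * n) j -> gen n j \in Wgrp n TD (2 * n).
  by move=> vj; apply: mem_gen; apply/gensP; exists j.
case: IH => H; [left | right]; first by rewrite groupM // gD // /vidx; lia.
have -> : (gen n 0 * (gen n i * w) = gen n 0 * gen n i * gen n 0 * (gen n 0 * w))%g.
  by rewrite !mulgA -(mulgA _ (gen n 0) (gen n 0)) g00 mulg1.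
have [i1 i2] := andP ip; rewrite gen0_conj // groupM // gD // /vidx.
by case: (i =P 1); lia.
Qed.

Lemma WD_sub w : w \in Wgrp n TD (2 * n) -> w \in Wgrp n TBC (2 * n).
Proof.
have gB j : vidx TBC (2 * n) j -> gen n j \in Wgrp n TBC (2 * n).
  by move=> vj; apply: mem_gen; apply/gensP; exists j.
move: w; apply: W_ind => [|i w vi IH]; first exact: group1.
rewrite groupM //; have [->|im] := eqVneq i (-1).
  have := @gen0_conj 1 isT ltac:(lia); rewrite eqxx => <-.
  by apply: groupM; [apply: groupM|]; apply: gB; rewrite /vidx; lia.
by apply: gB; move: vi; rewrite /vidx; lia.
Qed.

(** Conjugation keeps the sign, so a minimal element suffices. That element is a product of
    generators commuting with it, and [s_0] is not among them because 1 would be fixed or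
    negated. *)
Lemma even_XBC z : z \in Xset n TBC -> odd_perm z = false.
Proof.
move=> zX; rewrite -[z]/(val (exist _ z zX : {z | z \in Xset n TBC})).
move: (exist _ z zX) => x {z zX}; have cox := cox_gens n1 TBC; have perf := perfect_X n1 TBC.
have [k] := ubnP (glen TBC (val x)); elim: k x => // k IH x; rewrite ltnS => lek.
have [xm|] := pselect (xmin (gens n TBC (2 * n)) (@Ddes n) x); last first.
  move/not_xmin=> [s [sS nsx Ds]]; have := len_actD cox perf sS nsx Ds => lx.
  have := IH (xact s x); rewrite lx in lek; move=> /(_ (ltnW lek)).
  by rewrite (val_act cox perf) ?mem_gen // odd_permJ.
have := xmin_gen cox perf xm; set J := [set s in _ | _] => xJ.
suff sJ : (<<J>> \subset [set w : Perm n | ~~ odd_perm w])%g.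
  by have := subsetP sJ _ xJ; rewrite inE => /negbTE.
have fx := fpf_X n1 (valP x).
apply/subsetP => w /word_gen[l lJ <-]; rewrite inE.
elim: l lJ => [|s l IHl] /=; first by rewrite wprod_nil odd_perm1.
rewrite inE -andbA => /and3P[/gensP[i vi ->] sx lJ].
have [i1 i2] := vidx_bound n1 (leqnn _) vi.
rewrite wprod_cons odd_permM (negbTE (IHl lJ)) addbF odd_perm_gen //.
move: sx; rewrite /xcomm comm_genE //; apply: contraL => /eqP i0.
have r1 : inr 1 by rewrite /inrange; lia.
have := fp_neg fx r1 isT; have := fp_fix fx r1 isT.
rewrite i0 /ra /rb /= (fp_odd fx) //; move: (sapp _ 1) => u; lia.
Qed.

Lemma FBC_X z : z \in FBC n -> z \in Xset n TBC.
Proof. by rewrite !inE => /and3P[-> -> ->]. Qed.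

Lemma XBC_WD z : z \in Xset n TBC -> z \in Wgrp n TD (2 * n).
Proof.
move=> zX; have := even_XBC zX; have := zX; rewrite inE => /andP[zW _] ze.
have [//|/even_WD] := WBC_split zW.
by rewrite odd_permM ze addbF odd_perm_gen //; clear -n1; lia.
Qed.

Definition novdes z : bool := all (fun k => ~~ vdes z k) (iota n.+1 n).

Lemma count_novdes z : novdes z ->
  count (negc z) (iota 1 (2 * n)) = count (negc z) (iota 1 n).
Proof.
move=> /allP nv; rewrite mul2n -addnn iotaD count_cat.
rewrite [X in (_ + X)%N](_ : _ = 0)%N ?addn0 //.
apply/eqP; rewrite eqn0Ngt -has_count; apply/hasPn => k kr.
have := nv k; rewrite -add1n => /(_ kr); rewrite /vdes negb_or => /andP[_].
by rewrite /negc.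
Qed.

(** Three discrepancies are settled here: in type A positivity rules out negated points; in type D
    the parity counts up to [n] and [2n] agree without visible descents above [n], and membership in
    the smaller group follows from even sign. *)
Lemma GsetE t z : (z \in Gset n t) = (z \in Xset n t) && novdes z.
Proof.
rewrite [in LHS]inE -/(novdes z); have [nv|] := boolP (novdes z); last by rewrite !andbF.
rewrite !andbT; case: t => /=.
- apply/idP/idP; rewrite !inE => /and3P[zW zi zf].
    rewrite zW zi /= andbT; apply/allP => k kr; have := allP zf k kr.
    have := pos_WA n1 (leqnn _) zW (v := k%:Z); move: kr; rewrite mem_iota => kr.
    have kr' : inr k by apply: inr_nat; lia.
    by move=> /(_ kr' ltac:(lia)); move: (sapp z k) => v; lia.
  rewrite zW zi /=; move: zf; rewrite andbT => /allP zf.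
  by apply/allP => k /zf; apply: contra => /eqP->.
- by rewrite !inE andbT.
rewrite !inE -(count_novdes nv); apply/idP/idP.
  case/andP=> zF zc; have /XBC_WD zW : z \in Xset n TBC by apply: FBC_X; rewrite inE.
  by case/and3P: zF => _ -> ->; rewrite zW zc.
by case/and4P=> zW -> -> ->; rewrite WD_sub.
Qed.

Lemma gfunP z : fpf z -> novdes z <-> gfun n (fun k => sapp z k%:Z).
Proof.
move=> fz; split=> [/allP nv|gf].
  split; first exact: fpf_funP.
    move=> k kr; have := nv k; rewrite mem_iota => /(_ ltac:(lia)).
    by rewrite /vdes negb_or => /andP[_]; rewrite -leNgt.
  move=> k kr lt; have := nv k; rewrite mem_iota => /(_ ltac:(lia)).
  rewrite /vdes negb_or lt_min lt => /andP[+ _].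
  by rewrite (_ : k < 2 * n)%N /= ?leNgt //; lia.
apply/allP => k; rewrite mem_iota => kr; rewrite /vdes negb_or lt_min.
have := gf_low gf (k := k) ltac:(lia); rewrite /= leNgt => ->; rewrite andbT.
have [k2|//] := ltnP k (2 * n); rewrite /=; have := gf_up gf (k := k) ltac:(lia).
by rewrite /= negb_and -!leNgt; case: ltP => //= _ ->; rewrite ?orbT.
Qed.

End MinimalElements.

(** * The set G *)

Definition lowpos n (z : Perm n) (k : nat) : bool := lowered n (fun k => sapp z k%:Z) k.

(** Requiring [j.+1] to be lowered suffices for elements of G: lowered points form an initial
    segment above [n], so [j] is lowered as well. *)
Definition Uset n (z : Perm n) : {set Perm n} :=
  [set g in [seq gen n (j%:Z) | j <- iota n.+1 n.-1 & lowpos z j.+1]].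

Lemma UsetP n (z u : Perm n) : reflect
  (exists j : nat, [/\ (n < j < 2 * n)%N, lowpos z j.+1 & u = gen n j%:Z]) (u \in Uset z).
Proof.
rewrite inE; apply: (iffP mapP) => [[j]|[j [jr lj ->]]].
  by rewrite mem_filter mem_iota => /andP[lj jr] ->; exists j; split=> //; lia.
by exists j; rewrite // mem_filter mem_iota lj; lia.
Qed.

Lemma ra_pos (j : nat) : (0 < j)%N -> ra j%:Z = j%:Z.
Proof. by move=> j0; rewrite /ra; split_ifs; lia. Qed.

Lemma rb_pos (j : nat) : (0 < j)%N -> rb j%:Z = j.+1%:Z.
Proof. by move=> j0; rewrite /rb; split_ifs; lia. Qed.

Lemma bigSP n (u : Perm n) : reflect (exists2 k : nat, (n < k < 2 * n)%N & u = gen n k%:Z) (u \in bigS n).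
Proof.
rewrite inE; apply: (iffP mapP) => -[k].
  by rewrite mem_iota => kr ->; exists k => //; lia.
by move=> kr ->; exists k; rewrite ?mem_iota //; lia.
Qed.

(** * The upper group and its interaction with the generators of rank n *)

Section UpperGroup.

Variables (n : nat) (n1 : (1 < n)%N) (z : Perm n) (fz : fpf z).
Hypothesis gz : gfun n (fun k => sapp z k%:Z).
Implicit Types (u v s : Perm n) (j k l : nat) (i : int).
Local Notation inr := (inrange n).

Lemma gen_pos_sapp j (x : int) : (0 < j < 2 * n)%N -> inr x ->
  sapp (gen n j%:Z) x = sref j%:Z j.+1%:Z x.
Proof.
move=> jr xr; rewrite sapp_gen //; try lia.
by congr (sref _ _ _); rewrite /ra /rb; split_ifs; lia.
Qed.

Lemma low_pred j : (n < j)%N -> lowpos z j.+1 -> lowpos z j.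
Proof. by move=> nj lj; have [] := lowered_pred gz nj lj. Qed.

Lemma U_sub u : u \in <<Uset z>>%g ->
  [/\ podd u, forall x : int, (`|x| <= n)%N -> sapp u x = x &
      forall k, lowpos z k -> exists2 k', lowpos z k' & sapp u k%:Z = k'%:Z].
Proof.
case/word_gen=> l lU <-; elim: l lU => [|s l IH] /= => [_|/andP[sU lU]].
  rewrite wprod_nil; split=> [v vr|x xn|k lk].
  - by rewrite !sapp1 ?inrN.
  - by rewrite sapp1 // /inrange; lia.
  - by exists k => //; rewrite sapp1 //; apply: inr_nat; move: lk; rewrite /lowpos /lowered; lia.
have [ol fl pl] := IH lU; have [j [jr lj ->]] := UsetP _ _ sU.
have lj' : lowpos z j by apply: low_pred lj; lia.
rewrite wprod_cons; split=> [|x xn|k lk].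
- by apply: oddM => //; apply: odd_gen => //; lia.
- rewrite sappM gen_pos_sapp; [|lia|by rewrite /inrange; lia].
  by rewrite sref_fix ?fl // /insupp; lia.
have kr : inr k by apply: inr_nat; move: lk; rewrite /lowpos /lowered; lia.
rewrite sappM gen_pos_sapp //; last lia.
have [->|kj] := eqVneq k j.
  have -> : sref j%:Z j.+1%:Z j%:Z = j.+1%:Z by rewrite /sref eqxx.
  exact: pl.
have [->|kj1] := eqVneq k j.+1.
  have -> : sref j%:Z j.+1%:Z j.+1%:Z = j%:Z by rewrite /sref; clear; split_ifs; lia.
  exact: pl.
by rewrite sref_fix; [apply: pl | rewrite /insupp; lia].
Qed.

Lemma U_bigS t u : u \in Uset z -> u \in gens n t (2 * n).
Proof.
by case/UsetP=> j [jr _ ->]; apply/gensP; exists j%:Z => //; rewrite /vidx; lia.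
Qed.

Lemma low_lt k l : lowpos z k -> lowpos z l -> (sapp z k%:Z < sapp z l%:Z) = (k < l)%N.
Proof.
move=> lk ll; have kr : (n < k)%N by case/andP: lk => /andP[].
have lr : (n < l)%N by case/andP: ll => /andP[].
have [kl|lk'|->] := ltngtP k l; last by rewrite ltxx.
  by have := lowered_mono gz (l := k) (k := l) ltac:(lia) ll => /= ->.
have := lowered_mono gz (l := l) (k := k) ltac:(lia) lk => /=.
by move: (sapp z k) (sapp z l) => x y; lia.
Qed.

Section Upper.

Variables (u : Perm n) (uU : u \in <<Uset z>>%g) (j : nat).
Hypotheses (jr : (n < j < 2 * n)%N) (lj : lowpos z j.+1).

Let lj' : lowpos z j. Proof. by apply: low_pred; first lia. Qed.
Let j1 : -1 <= j%:Z. Proof. lia. Qed.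
Let j2 : j%:Z < (2 * n)%:Z. Proof. lia. Qed.

Lemma conj_low k : lowpos z k ->
  exists2 k', lowpos z k' & sapp (u^-1)%g k%:Z = k'%:Z /\ sapp (z ^ u)%g k%:Z = sapp z k'%:Z.
Proof.
move=> lk; have uV : (u^-1)%g \in <<Uset z>>%g by rewrite groupV.
have [ou fu pu] := U_sub uU; have [_ _ pV] := U_sub uV.
have [k' lk' Ek'] := pV k lk; exists k' => //; split=> //.
rewrite conjgE !sappM Ek' fu //; by case/andP: lk'.
Qed.

(** [z] increases along lowered points and the upper group fixes their images, so comparing two
    values of [z ^ u] amounts to comparing two values of [u^-1]. *)
Lemma upper_D : fpf (z ^ u)%g ->
  Ddes (gen n j%:Z) (z ^ u)%g = Ddes (gen n j%:Z) (u^-1)%g.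
Proof.
move=> fzu; have uV : (u^-1)%g \in <<Uset z>>%g by rewrite groupV.
have [oV _ _] := U_sub uV.
rewrite !D_gen //; last exact: fp_odd fzu.
rewrite ra_pos ?rb_pos; try lia.
have [k lk [-> ->]] := conj_low lj'; have [l ll [-> ->]] := conj_low lj.
by rewrite low_lt // ltz_nat.
Qed.

Lemma upper_noncomm : fpf (z ^ u)%g ->
  (gen n j%:Z * (z ^ u) == (z ^ u) * gen n j%:Z)%g = false.
Proof.
move=> fzu; rewrite comm_genE // ra_pos ?rb_pos; try lia.
have [k /andP[_ lk] [_ ->]] := conj_low lj'.
by apply/negbTE; move: lk => /=; move: (sapp z k) => x; lia.
Qed.

End Upper.

Section Lower.

Variables (t : ctype) (i : int) (vi : vidx t n i).
Let vi2 := vidx_wide n1 vi.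
Let i1 : -1 <= i. Proof. by have [] := vidx_bound n1 (leqnn _) vi2. Qed.
Let i2 : i < (2 * n)%:Z. Proof. by have [] := vidx_bound n1 (leqnn _) vi2. Qed.
Local Notation a := (ra i).
Local Notation b := (rb i).
Local Notation s := (gen n i).

Lemma low_root : [/\ a < b, a != 0, b != 0, (`|a| <= n)%N & (`|b| <= n)%N].
Proof.
have [ab a0 b0 _ _] := root_facts n1 i1 i2; split=> //.
  by move: vi; rewrite /vidx /ra; case: t; split_ifs; lia.
by move: vi; rewrite /vidx /rb; case: t; split_ifs; lia.
Qed.

Let ar : inr a. Proof. by have [_ _ _] := low_root; rewrite /inrange; lia. Qed.
Let br : inr b. Proof. by have [_ _ _] := low_root; rewrite /inrange; lia. Qed.

Lemma low_comm_upper u : u \in <<Uset z>>%g -> (s * u = u * s)%g.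
Proof.
case/word_gen=> l lU <-; elim: l lU => [|v l IH] /= => [_|/andP[vU lU]].
  by rewrite wprod_nil mul1g mulg1.
have [j [jr lj ->]] := UsetP _ _ vU; rewrite wprod_cons mulgA.
suff -> : (s * gen n j%:Z = gen n j%:Z * s)%g by rewrite -mulgA IH // mulgA.
have [ab a0 b0 an bn] := low_root.
have jr0 : (0 < j < 2 * n)%N by clear -jr; lia.
apply: sappP => x xr; rewrite !sappM gen_pos_sapp ?sapp_inr //.
rewrite [sapp s (sapp _ _)]sapp_gen ?sapp_inr // sapp_gen // gen_pos_sapp //.
by apply: sref_comm; rewrite /insupp; clear -jr a0 b0 an bn; lia.
Qed.

Definition ascpair k : Prop := (sapp z a = k%:Z /\ sapp z b = k.+1%:Z) \/
  (sapp z a = - k.+1%:Z /\ sapp z b = - k%:Z).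

Lemma zsz_sapp (x : int) : inr x -> sapp (z * s * z)%g x = sref (sapp z a) (sapp z b) x.
Proof.
by move=> xr; rewrite !sappM sapp_gen ?sapp_inr // sapp_sref ?sapp_inr ?(fp_inv fz) //;
  apply: fp_odd fz.
Qed.

Lemma ascpair_gen k : (n < k < 2 * n)%N -> ascpair k -> (z * s * z)%g = gen n k%:Z.
Proof.
move=> kr H; apply: sappP => x xr; rewrite zsz_sapp // gen_pos_sapp //; last lia.
by case: H => -[-> ->]; rewrite /sref; clear -kr; split_ifs; lia.
Qed.

Lemma z_of_za (k : nat) (x : int) : inr x -> sapp z x = k%:Z -> sapp z k%:Z = x.
Proof. by move=> xr <-; rewrite (fp_inv fz). Qed.

Lemma z_of_zaN (k : nat) (x : int) : inr x -> sapp z x = - k%:Z -> sapp z k%:Z = - x.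
Proof.
move=> xr E; rewrite -[k%:Z]opprK -E (fp_odd fz) ?sapp_inr //.
by rewrite (fp_inv fz).
Qed.

Lemma ascpair_low k : (n < k < 2 * n)%N -> ascpair k -> lowpos z k.+1.
Proof.
have [_ _ _ an bn] := low_root => kr; rewrite /lowpos /lowered.
by case=> -[za zb]; [rewrite (z_of_za br zb) | rewrite (z_of_zaN ar za)]; lia.
Qed.

(** The equation [z s z = s_k] allows four placements of the images of the pair; the two
    order-reversing ones contradict the growth of [z] along lowered points. *)
Lemma bigS_ascpair : (z * s * z)%g \in bigS n ->
  exists2 k, (n < k < 2 * n)%N & ascpair k.
Proof.
case/bigSP=> k kr E; exists k => //.
have [ab a0 b0 an bn] := low_root.
have kr' : inr k by apply: inr_nat; lia.
have kr1 : inr k.+1 by apply: inr_nat; lia.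
have [za0 zb0 zab _] := root_val n1 i1 i2 fz.
have := zsz_sapp kr'; have := zsz_sapp kr1; rewrite E !gen_pos_sapp //; try lia.
have -> : sref k%:Z k.+1%:Z k%:Z = k.+1%:Z by rewrite /sref eqxx.
have -> : sref k%:Z k.+1%:Z k.+1%:Z = k%:Z by rewrite /sref; split_ifs; lia.
move=> E1 E2.
have lowk (x : int) (l : nat) : inr x -> (`|x| <= n)%N -> (n < l <= 2 * n)%N ->
    (sapp z x == l%:Z) || (sapp z x == - l%:Z) -> lowpos z l.
  move=> xr xn lr /orP[/eqP H|/eqP H]; rewrite /lowpos /lowered lr /=.
    by rewrite (z_of_za xr H).
  by rewrite (z_of_zaN xr H); lia.
have H : [\/ sapp z a = k%:Z /\ sapp z b = k.+1%:Z, sapp z a = k.+1%:Z /\ sapp z b = k%:Z,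
     sapp z a = - k%:Z /\ sapp z b = - k.+1%:Z | sapp z a = - k.+1%:Z /\ sapp z b = - k%:Z].
  move: E1 E2 za0 zb0 zab; move: (sapp z a) (sapp z b) => p q E1 E2 p0 q0 pq.
  have : p = k%:Z /\ q = k.+1%:Z \/ p = k.+1%:Z /\ q = k%:Z \/ p = - k%:Z /\ q = - k.+1%:Z
      \/ p = - k.+1%:Z /\ q = - k%:Z.
    by move: E1 E2; rewrite /sref; clear -p0 q0 pq kr; split_ifs; lia.
  by case=> [|[|[|]]] h; [constructor 1|constructor 2|constructor 3|constructor 4].
have lk1 : lowpos z k.+1.
  case: H => -[za zb]; [apply: (lowk b)|apply: (lowk a)|apply: (lowk b)|apply: (lowk a)];
    rewrite ?za ?zb ?eqxx ?orbT //; lia.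
have lk : lowpos z k by apply: low_pred lk1; lia.
have := low_lt lk lk1; rewrite ltnSn => lt.
case: H => -[za zb]; rewrite /ascpair; try by [left|right].
- by move: lt; rewrite (z_of_za br zb) (z_of_za ar za); lia.
- by move: lt; rewrite (z_of_zaN ar za) (z_of_zaN br zb); lia.
Qed.

(** If both images were upper with the same sign, a lowered point between them would have its value
    strictly between the two ends of a root; normally there is none, so the images are consecutive
    and [s] lies in [Asc^=]. Only the pair -2, 1 leaves room, and then the sign of the image of 1
    gives a contradiction. *)
Lemma upper_upper : (z * s * z)%g \notin bigS n ->
  ~ (n%:Z < sapp z a /\ n%:Z < sapp z b) /\ ~ (sapp z a < - n%:Z /\ sapp z b < - n%:Z).
Proof.
move=> nb; have [ab a0 b0 an bn] := low_root.
have noasc k : (n < k < 2 * n)%N -> ~ ascpair k.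
  by move=> kr H; case/negP: nb; rewrite (ascpair_gen kr H); apply/bigSP; exists k.
have zar := sapp_inr z a; have zbr := sapp_inr z b.
have between l : lowpos z l -> a < sapp z l%:Z -> sapp z l%:Z < b -> sapp z b < 0.
  move=> ll al lb; have /andP[/andP[nl l2n] _] := ll.
  have lr : inr l by apply: inr_nat.
  have l0 : sapp z l%:Z != 0 by rewrite (sapp_eq0 _ (fp_odd fz)) //; clear -nl; lia.
  have [bm zl] : b = 1 /\ sapp z l%:Z = -1.
    move: al lb l0; move: (sapp z l%:Z) => x; rewrite /ra /rb; clear.
    by split_ifs; lia.
  have -> : sapp z b = - l%:Z.
    rewrite bm; have -> : (1 : int) = - sapp z l%:Z by rewrite zl.
    by rewrite (fp_odd fz) ?sapp_inr // (fp_inv fz).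
  by clear -nl; lia.
split=> -[za zb].
  have [k Ek] : exists k : nat, sapp z a = k%:Z by exists `|sapp z a|%N; lia.
  have [l El] : exists l : nat, sapp z b = l%:Z by exists `|sapp z b|%N; lia.
  have zk := z_of_za ar Ek; have zl := z_of_za br El.
  rewrite Ek /inrange in zar za; rewrite El /inrange in zbr zb.
  have lk : lowpos z k by rewrite /lowpos /lowered zk; lia.
  have ll : lowpos z l by rewrite /lowpos /lowered zl; lia.
  have := low_lt lk ll; rewrite zk zl ab => /esym kl.
  have [E|ne] := eqVneq l k.+1; first by apply: (noasc k); [lia | left; rewrite Ek El E].
  have lk1 : lowpos z k.+1 by apply: (lowered_down gz _ ll); lia.
  have := between k.+1 lk1; rewrite -zk -zl !low_lt // zl El; lia.
have [k Ek] : exists k : nat, sapp z a = - k%:Z by exists `|sapp z a|%N; lia.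
have [l El] : exists l : nat, sapp z b = - l%:Z by exists `|sapp z b|%N; lia.
have zk := z_of_zaN ar Ek; have zl := z_of_zaN br El.
rewrite Ek /inrange in zar za; rewrite El /inrange in zbr zb.
have lk : lowpos z k by rewrite /lowpos /lowered zk; lia.
have ll : lowpos z l by rewrite /lowpos /lowered zl; lia.
have := low_lt ll lk; rewrite zk zl ltrN2 ab => /esym lk'.
have [E|ne] := eqVneq k l.+1; first by apply: (noasc l); [lia | right; rewrite Ek El E].
have ll1 : lowpos z l.+1 by apply: (lowered_down gz _ lk); lia.
have h1 : sapp z l%:Z < sapp z l.+1%:Z by rewrite low_lt //; lia.
have h2 : sapp z l.+1%:Z < sapp z k%:Z by rewrite low_lt //; lia.
have l0 : sapp z l.+1%:Z != 0 by rewrite (sapp_eq0 _ (fp_odd fz)) //; apply: inr_nat; lia.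
have [am [bm zl1]] : a = -2 /\ b = 1 /\ sapp z l.+1%:Z = 1.
  move: h1 h2 l0; rewrite zk zl; move: (sapp z l.+1%:Z) => x; rewrite /ra /rb; clear.
  by split_ifs; lia.
have l1r : inr l.+1 by apply: inr_nat => //; clear -zar lk'; lia.
have := z_of_za (k := 1) l1r zl1.
by rewrite bm in El; rewrite El; clear; lia.
Qed.

(** [u] moves only lowered points and keeps them upper, so it could alter the comparison of the two
    images only if both were upper with the same sign. *)
Lemma lower_D u : (z * s * z)%g \notin bigS n -> u \in <<Uset z>>%g -> fpf (z ^ u)%g ->
  Ddes s (z ^ u)%g = Ddes s z.
Proof.
move=> nb uU fzu; have [ou fu pu] := U_sub uU.
rewrite !D_gen //; [|exact: fp_odd fz|exact: fp_odd fzu].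
have [ab a0 b0 an bn] := low_root.
have E x : (`|x| <= n)%N -> sapp (z ^ u)%g x = sapp u (sapp z x).
  have [_ fV _] : [/\ podd (u^-1)%g, forall x : int, (`|x| <= n)%N -> sapp (u^-1)%g x = x &
    forall k, lowpos z k -> exists2 k', lowpos z k' & sapp (u^-1)%g k%:Z = k'%:Z].
    by apply: U_sub; rewrite groupV.
  by move=> xn; rewrite conjgE !sappM fV.
have up x : inr x -> (`|x| <= n)%N -> [\/ sapp u (sapp z x) = sapp z x /\ (`|sapp z x| <= n)%N,
    n%:Z < sapp u (sapp z x) /\ n%:Z < sapp z x |
    sapp u (sapp z x) < - n%:Z /\ sapp z x < - n%:Z].
  move=> xr xn; have zxr := sapp_inr z x.
  have [le|gt] := leqP `|sapp z x|%N n; first by constructor 1; rewrite fu.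
  have [p|m] := ltP 0 (sapp z x).
    have [k Ek] : exists k : nat, sapp z x = k%:Z by exists `|sapp z x|%N; lia.
    rewrite Ek /inrange in zxr gt *; have zk := z_of_za xr Ek.
    have lk : lowpos z k by rewrite /lowpos /lowered zk; lia.
    have [k' /andP[k'r _] ->] := pu k lk; constructor 2; lia.
  have [k Ek] : exists k : nat, sapp z x = - k%:Z by exists `|sapp z x|%N; lia.
  rewrite Ek /inrange in zxr gt *; have zk := z_of_zaN xr Ek.
  have lk : lowpos z k by rewrite /lowpos /lowered zk; lia.
  have kr : inr k by apply: inr_nat; lia.
  have [k' /andP[k'r _] E'] := pu k lk; constructor 3; rewrite ou // E'; lia.
rewrite !E //; have [nu nd] := upper_upper nb.
have := up a ar an; have := up b br bn.
move: (sapp u (sapp z a)) (sapp u (sapp z b)) (sapp z a) (sapp z b) nu nd => p' q' p q nu nd.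
by case=> -[h1 h2]; case=> -[h3 h4]; lia.
Qed.

Lemma lower_D_asc u k : (n < k < 2 * n)%N -> ascpair k -> u \in <<Uset z>>%g ->
  fpf (z ^ u)%g -> Ddes s (z ^ u)%g = Ddes (gen n k%:Z) u.
Proof.
move=> kr H uU fzu; have [ou fu pu] := U_sub uU.
have [ab a0 b0 an bn] := low_root.
have uV : (u^-1)%g \in <<Uset z>>%g by rewrite groupV.
have [_ fV _] := U_sub uV.
have k1 : -1 <= k%:Z by clear; lia.
have k2 : k%:Z < (2 * n)%:Z by clear -kr; lia.
rewrite (D_gen n1 i1 i2 (fp_odd fzu)) (D_gen n1 k1 k2 ou).
rewrite ra_pos ?rb_pos; try lia.
rewrite conjgE !sappM !fV //.
by case: H => -[-> ->] //; rewrite !ou ?ltrN2 //; apply: inr_nat; lia.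
Qed.

Lemma ascpair_noncomm k : (n < k)%N -> ascpair k -> (s * z == z * s)%g = false.
Proof.
move=> kr H; have [ab a0 b0 an bn] := low_root.
by rewrite comm_genE //; case: H => -[-> _]; lia.
Qed.

(** [s] permutes the points up to [n], so the lowered set is unchanged. It could reverse two
    consecutive lowered values only if they formed its own pair, which would put it in [Asc^=]. *)
Lemma gfun_conj : (z * s * z)%g \notin bigS n ->
  gfun n (fun k => sapp (z ^ s)%g k%:Z) /\ forall k, lowpos (z ^ s)%g k = lowpos z k.
Proof.
move=> nb; have [ab a0 b0 an bn] := low_root.
have fs x : (n < `|x|)%N -> sref a b x = x.
  by move=> xn; apply: sref_fix; rewrite /insupp; lia.
have low x : (`|x| <= n)%N -> (`|sref a b x| <= n)%N by rewrite /sref; split_ifs; lia.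
have E k : (n < k <= 2 * n)%N -> sapp (z ^ s)%g k%:Z = sref a b (sapp z k%:Z).
  move=> kr; rewrite conj_sapp //; last by apply: inr_nat; lia.
  by rewrite (fs k%:Z) //; clear -kr; lia.
have lowE k : lowpos (z ^ s)%g k = lowpos z k.
  rewrite /lowpos /lowered; case: (boolP (n < k <= 2 * n)%N) => //= kr; rewrite E //.
  have [le|gt] := leqP `|sapp z k|%N n; first exact: low.
  by rewrite fs // leqNgt gt.
split=> //; split; first by apply: fpf_funP => //; apply: fpf_conj.
  move=> k kr; rewrite /= E //; have := gf_low gz kr => /=.
  have [le|gt] := leqP `|sapp z k|%N n; last by rewrite fs.
  by have := low _ le; move: (sref _ _ _) => x; lia.
move=> k kr; rewrite /= !E //; try lia.
have kr' : (n < k <= 2 * n)%N by lia.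
have k1r : (n < k.+1 <= 2 * n)%N by lia.
have [lk1|nlk1] := boolP (lowpos z k.+1).
  move=> _; have lk : lowpos z k by apply: low_pred lk1; lia.
  have lt : sapp z k%:Z < sapp z k.+1%:Z by rewrite low_lt.
  have kin : inr k by apply: inr_nat; lia.
  have k1in : inr k.+1 by apply: inr_nat; lia.
  rewrite leNgt; apply/negP => flip.
  have oz := fp_odd fz.
  have noasc : ~ ascpair k.
    by move=> H; case/negP: nb; rewrite (ascpair_gen kr H); apply/bigSP; exists k.
  have pq : sapp z k%:Z != sapp z k.+1%:Z by rewrite lt_eqF.
  have p0 : sapp z k%:Z != 0 by rewrite (sapp_eq0 n1) //; clear -kr; lia.
  have q0 : sapp z k.+1%:Z != 0 by rewrite (sapp_eq0 n1).
  have pnq : i = -1 -> sapp z k%:Z != - sapp z k.+1%:Z.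
    by move=> _; rewrite (sapp_eqN n1 oz) //; clear -kr; lia.
  have := @sref_flip i (sapp z k%:Z) (sapp z k.+1%:Z) i1 pq p0 q0 pnq.
  rewrite flip (lt_gtF lt) => /(_ isT) [] [h1 h2].
  - by apply: noasc; left; rewrite -h1 -h2 !(fp_inv fz).
  - by move: lt; rewrite h1 h2 (lt_gtF ab).
  - by move: lt; rewrite h1 h2 ltrN2 (lt_gtF ab).
  - apply: noasc; right; split.
      by rewrite -[a]opprK -h2 oz ?sapp_inr // (fp_inv fz).
    by rewrite -[b]opprK -h1 oz ?sapp_inr // (fp_inv fz).
have gt : (n < `|sapp z k.+1|)%N.
  by move: nlk1; rewrite /lowpos /lowered k1r /= -ltnNge.
have pos : n%:Z < sapp z k.+1%:Z.
  by have := gf_neg gz k1r => /=; move: gt; move: (sapp z k.+1%:Z) => x; lia.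
rewrite [sref a b (sapp z k.+1)]fs // => lt; have := gf_up gz kr lt => /=.
have [le|gtk] := leqP `|sapp z k|%N n; last by rewrite [sref a b (sapp z k)]fs.
by have := low _ le; move: (sref _ _ _) => x; lia.
Qed.

End Lower.
End UpperGroup.

(** * The bar operators *)

Section GelfandModel.

Variables (n : nat) (n1 : (1 < n)%N) (t : ctype) (kd : mkind).
Local Notation S := (gens n t n).
Local Notation SN := (gens n t (2 * n)).
Local Notation X := {z : Perm n | z \in Xset n t}.
Local Notation G := (Gidx n t).
Implicit Types (s u v : Perm n) (x : X) (y z g : G) (m : Mod n t) (B : X -> laurent).

(* [ceq] and [eeq] are the eigenvalues attached to Des^= and Asc^=. *)
Definition hq : laurent := lx - lxi.
Definition ceq : laurent := if kd is KM then lx else - lxi.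
Definition eeq : laurent := if kd is KM then - lxi else lx.

Lemma ceq_quad : ceq * ceq = 1 + hq * ceq.
Proof. by rewrite /ceq /hq -lx_lxi; case: kd; ring. Qed.

Lemma eeq_quad : eeq * eeq = 1 + hq * eeq.
Proof. by rewrite /eeq /hq -lx_lxi; case: kd; ring. Qed.

Lemma ceqV : ceq * (ceq - hq) = 1.
Proof. by rewrite mulrBr ceq_quad; ring. Qed.

Lemma lbar_ceq : lbar ceq = ceq - hq.
Proof. by rewrite /ceq /hq; case: kd; rewrite ?lbarN ?lbar_lx ?lbar_lxi; ring. Qed.

Lemma lbar_eeq : lbar eeq = eeq - hq.
Proof. by rewrite /eeq /hq; case: kd; rewrite ?lbarN ?lbar_lx ?lbar_lxi; ring. Qed.

Lemma lbar_hq : lbar hq = - hq.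
Proof. by rewrite /hq lbarD lbarN lbar_lx lbar_lxi; ring. Qed.

Let cox := cox_gens n1 t.
Let perf := perfect_X n1 t.

Let subS s : s \in S -> s \in SN.
Proof. by case/gensP=> i vi ->; apply/gensP; exists i => //; apply: vidx_wide. Qed.

Let memW s : s \in SN -> s \in <<SN>>%g. Proof. exact: mem_gen. Qed.

Lemma G_X y : val y \in Xset n t.
Proof. by have := valP y; rewrite (GsetE n1) => /andP[]. Qed.

Lemma G_novdes y : novdes (val y).
Proof. by have := valP y; rewrite (GsetE n1) => /andP[]. Qed.

Lemma G_fpf y : fpf (val y). Proof. exact: (@fpf_X n n1 t _ (G_X y)). Qed.

Lemma G_gfun y : gfun n (fun k => sapp (val y) k%:Z).
Proof. by apply/(gfunP n1 (G_fpf y)); apply: G_novdes. Qed.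

Definition xof y : X := exist _ (val y) (G_X y).

Lemma xof_inj y z : xof y = xof z -> y = z.
Proof. by move/(congr1 val) => /= E; apply: val_inj. Qed.

Definition isAsc s y : bool := (val y * s * val y)%g \in bigS n.

Lemma isAsc_noncomm s y : s \in S -> isAsc s y -> ~~ xcomm s (xof y).
Proof.
case/gensP=> i vi -> /(bigS_ascpair n1 (G_fpf y) (G_gfun y) vi)[k kr H].
rewrite /xcomm /= (ascpair_noncomm n1 (G_fpf y) vi _ H) //.
by case/andP: kr.
Qed.

Lemma isAsc_notD s y : s \in S -> isAsc s y -> ~~ Ddes s (val y).
Proof.
case/gensP=> i vi -> /(bigS_ascpair n1 (G_fpf y) (G_gfun y) vi)[k kr H].
have [i1 i2] := vidx_bound n1 (leqnn _) (vidx_wide n1 vi).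
rewrite D_gen //; last exact: fp_odd (G_fpf y).
by case: H => -[-> ->]; lia.
Qed.

Definition gact s y : G := insubd y (val y ^ s)%g.

Lemma gconj s y : s \in S -> ~~ isAsc s y ->
  (val y ^ s)%g \in Gset n t /\ forall k, lowpos (val y ^ s)%g k = lowpos (val y) k.
Proof.
move=> sS nA; have [i vi Es] := gensP _ _ _ sS; rewrite Es in nA *.
have [gf low] := gfun_conj n1 (G_fpf y) (G_gfun y) vi nA.
have yX : (val y ^ gen n i)%g \in Xset n t.
  by apply: (perf_conj perf (G_X y)); rewrite -Es; apply: subS.
split=> //; rewrite (GsetE n1) yX /=.
by apply/(gfunP n1 (fpf_X n1 yX)).
Qed.

Lemma val_gact s y : s \in S -> ~~ isAsc s y -> val (gact s y) = (val y ^ s)%g.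
Proof. by move=> sS nA; rewrite /gact val_insubd (gconj sS nA).1. Qed.

Lemma xof_gact s y : s \in S -> ~~ isAsc s y -> xof (gact s y) = xact s (xof y).
Proof.
move=> sS nA; apply: val_inj; rewrite /= val_gact // (val_act cox perf) //.
by apply/memW/subS.
Qed.

Lemma isAsc_gact s y : s \in S -> ~~ isAsc s y -> isAsc s (gact s y) = isAsc s y.
Proof.
move=> sS nA; have sS' := subS sS; rewrite [LHS]/isAsc val_gact // (conjS cox) //.
have [bs|] := boolP (s * val y * s * s * (s * val y * s) \in bigS n)%g; last first.
  by rewrite (negbTE nA).
have E : (s * val y * s * s * (s * val y * s) = s * (val y * s * val y) * s)%g.
  by rewrite (mulKS cox) // !mulgA.
have [k kr Ek] := bigSP _ bs; rewrite E in Ek.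
apply/esym; rewrite /isAsc; have -> : (val y * s * val y = s * gen n k * s)%g.
  by rewrite -Ek -!mulgA (mulSK cox) // (cox_invol cox) // mulg1.
have [i vi Es] := gensP _ _ _ sS.
suff -> : (s * gen n k * s = gen n k)%g by apply/bigSP => //; exists k.
have [ab a0 b0 an bn] := low_root n1 vi.
have [i1 i2] := vidx_bound n1 (leqnn _) (vidx_wide n1 vi).
rewrite Es; suff -> : (gen n i * gen n k = gen n k * gen n i)%g.
  by rewrite -mulgA gen_invol // mulg1.
have kr0 : (0 < k < 2 * n)%N by lia.
apply: sappP => p pr; rewrite !sappM (gen_pos_sapp n1) ?sapp_inr //.
rewrite [sapp (gen n i) (sapp _ _)]sapp_gen ?sapp_inr // sapp_gen // (gen_pos_sapp n1) //.
by apply: sref_comm; rewrite /insupp; clear -kr a0 b0 an bn; lia.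
Qed.

Lemma xcomm_gact s y : s \in S -> ~~ isAsc s y ->
  xcomm s (xof (gact s y)) = xcomm s (xof y).
Proof. by move=> sS nA; rewrite xof_gact // (comm_act cox perf) // subS. Qed.

Lemma gactK s y : s \in S -> ~~ isAsc s y -> gact s (gact s y) = y.
Proof.
move=> sS nA; apply: xof_inj; rewrite !xof_gact ?isAsc_gact //.
by rewrite (actSK cox perf) // subS.
Qed.

(** The label of the piece of the module containing [y], stored as a finite set so that equality of
    pieces can be tested. *)
Definition Kset y : {set 'I_(2 * n).+1} := [set k : 'I_(2 * n).+1 | lowpos (val y) k].

Lemma KsetP y z : Kset y = Kset z <-> forall k, lowpos (val y) k = lowpos (val z) k.
Proof.
split=> [/setP E k|E]; last by apply/setP => k; rewrite !inE E.
have [k2|k2] := ltnP k (2 * n).+1; first by have := E (Ordinal k2); rewrite !inE.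
by rewrite /lowpos /lowered (leqNgt k) k2 !andbF.
Qed.

Lemma Kset_gact s y : s \in S -> ~~ isAsc s y -> Kset (gact s y) = Kset y.
Proof. by move=> sS nA; apply/KsetP => k; rewrite val_gact // (gconj sS nA).2. Qed.

Lemma Kset_Uset y z : Kset y = Kset z -> Uset (val y) = Uset (val z).
Proof.
move/KsetP=> E; apply/setP => u; rewrite !inE; congr (u \in map _ _).
by apply: eq_filter => k; apply: E.
Qed.

Section Sets.

Variables (s : Perm n) (sS : s \in S) (y : G).

Lemma mem_DesEq : (s \in DesEq t (val y)) = xcomm s (xof y).
Proof. by rewrite inE sS /= /cmp /xcomm eq_sym. Qed.

Lemma mem_AscEq : (s \in AscEq t (val y)) = isAsc s y.
Proof. by rewrite inE sS. Qed.

Let gl : glen t (cmp s (val y)) = glen t (s * val y)%g.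
Proof. exact: (len_mulr cox perf (xof y) (subS sS)). Qed.

Lemma mem_DesLt :
  (s \in DesLt t (val y)) = [&& ~~ xcomm s (xof y), ~~ isAsc s y & Ddes s (val y)].
Proof.
rewrite in_setD in_setU mem_DesEq mem_AscEq negb_or -andbA inE sS /= gl.
by rewrite (D_len cox (subS sS)) //; apply: (perf_gen perf (G_X y)).
Qed.

Lemma mem_AscLt :
  (s \in AscLt t (val y)) = [&& ~~ xcomm s (xof y), ~~ isAsc s y & ~~ Ddes s (val y)].
Proof.
rewrite in_setD in_setU mem_DesEq mem_AscEq negb_or -andbA inE sS /= gl.
have yW := perf_gen perf (G_X y); have [D|D] := boolP (Ddes s (val y)).
  by rewrite (lenD cox (subS sS) yW D) ltnNge leqnSn.
by rewrite (lenN cox (subS sS) yW D) ltnSn.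
Qed.

End Sets.

(** [coefH] lists the matrix of [H_s] by source [z]; here it is read by target [y], as needed for
    coordinates. *)
Lemma coefHE s z y : s \in S -> coefH t kd s (val z) (val y) =
  if xcomm s (xof y) then ceq * (z == y)%:R
  else if isAsc s y then eeq * (z == y)%:R
  else (z == gact s y)%:R + (if Ddes s (val y) then hq * (z == y)%:R else 0).
Proof.
move=> sS; rewrite /coefH mem_AscLt // mem_DesLt // mem_AscEq // mem_DesEq //.
have vE : (val y == val z) = (z == y) by rewrite eq_sym.
have sS' := subS sS.
have cE : cmp s (cmp (val z) s) = (val z ^ s)%g by rewrite /cmp (conjS cox).
rewrite cE vE -/hq -/ceq -/eeq.
have Ez : ~~ isAsc s z -> (val y == val z ^ s)%g = (y == gact s z).
  by move=> nA; rewrite -val_gact.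
have comm_act' : xcomm s (xof z) -> (val z ^ s)%g = val z.
  by move=> sz; have := act_comm cox perf sS' sz => /(congr1 val); rewrite (val_act cox perf) // memW.
have [sz|nsz] := boolP (xcomm s (xof z)).
  have nAz : ~~ isAsc s z by apply: contraL sz; apply: isAsc_noncomm.
  rewrite /= (negbTE nAz); have [zy|nzy] := eqVneq z y; first by rewrite -zy sz.
  rewrite !mulr0; have [_|nsy] := ifPn; first by [].
  have [_|nAy] := ifPn; first by [].
  have [zy|_] := eqVneq z (gact s y); last by rewrite if_same addr0.
  by move: sz nsy; rewrite zy xcomm_gact // => ->.
have [Az|nAz] := boolP (isAsc s z).
  rewrite /=; have [zy|nzy] := eqVneq z y.
    by rewrite -zy (negbTE nsz) Az.
  rewrite !mulr0; have [_|nsy] := ifPn; first by [].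
  have [_|nAy] := ifPn; first by [].
  have [zy|_] := eqVneq z (gact s y); last by rewrite if_same addr0.
  by move: Az nAy; rewrite zy => Az nAy; move: Az; rewrite isAsc_gact // (negbTE nAy).
rewrite /= Ez //.
have yz : (y == gact s z) = ~~ xcomm s (xof y) && ~~ isAsc s y && (z == gact s y).
  apply/eqP/idP => [->|/andP[/andP[_ nA] /eqP->]]; last by rewrite gactK.
  by rewrite xcomm_gact // isAsc_gact // nsz nAz gactK //= eqxx.
have [zy|nzy] := eqVneq z y.
  rewrite -zy (negbTE nsz) (negbTE nAz) !mulr1; rewrite -zy in yz.
  rewrite yz nsz nAz /=; case: (Ddes s (val z)) => //=; last by rewrite addr0.
rewrite !mulr0 addr0 yz !if_same addr0; case: (Ddes s (val z)) => /=;
  by case: (xcomm s (xof y)) => //=; case: (isAsc s y).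
Qed.

Lemma actSE s m y : s \in S -> actS kd s m y =
  if xcomm s (xof y) then ceq * m y
  else if isAsc s y then eeq * m y
  else m (gact s y) + (if Ddes s (val y) then hq * m y else 0).
Proof.
move=> sS; rewrite ffunE; under eq_bigr do rewrite coefHE //.
have pick z0 (a : laurent) : \sum_z m z * (a * (z == z0)%:R) = a * m z0.
  rewrite (bigD1 z0) //= eqxx mulr1 big1 ?addr0 1?mulrC // => z nz.
  by rewrite (negbTE nz) !mulr0.
have [_|nsy] := ifPn; first exact: pick.
have [_|nA] := ifPn; first exact: pick.
under eq_bigr do rewrite mulrDr; rewrite big_split /=; congr (_ + _).
  have := pick (gact s y) 1; rewrite mul1r => <-.
  by apply: eq_bigr => z _; rewrite mul1r.
case: ifP => _; first exact: pick.
by rewrite big1 // => z _; rewrite mulr0.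
Qed.

(** * Coinvariants under the upper group *)

Local Notation TX := (Top (@Ddes n) ceq hq).
Local Notation TbX := (Tbar (@Ddes n) ceq hq).
Local Notation Uy y := (<<Uset (val y)>>%g).

(* The coordinate at [y] of the image of [B] in the coinvariants under [Uset y]. *)
Definition coinv B y : laurent :=
  \sum_(u in Uy y) eeq ^+ glen t u * B (xact u (xof y)).

Let UW y u : u \in Uy y -> u \in <<SN>>%g.
Proof.
apply: subsetP u; rewrite gen_subG; apply/subsetP => u uU.
by apply: mem_gen; apply: U_bigS uU.
Qed.

Let XW x : val x \in <<SN>>%g. Proof. exact: (perf_gen perf (valP x)). Qed.

Lemma xact_fpf u y : u \in Uy y -> fpf (val y ^ u)%g.
Proof.
move=> uU; have := fpf_X n1 (valP (xact u (xof y))).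
by rewrite (val_act cox perf) // (UW uU).
Qed.

(* Both the upper generators and the ascending equalities shift the summation
   index of [coinv] by one letter; this is the resulting rank-one identity. *)
Lemma eeq_shift (a b : nat) (d : bool) : d = (a < b)%N -> (a = b.+1 \/ b = a.+1) ->
  eeq ^+ a + (if d then hq * eeq ^+ b else 0) = eeq * eeq ^+ b.
Proof.
move=> -> [->|->]; first by rewrite ltnNge leqnSn addr0 exprS.
rewrite ltnSn exprS; transitivity (eeq * eeq * eeq ^+ a); last by ring.
by rewrite eeq_quad; ring.
Qed.

Let lenS1 s w : s \in SN -> w \in <<SN>>%g ->
  glen t (s * w)%g = (glen t w).+1 \/ glen t w = (glen t (s * w)%g).+1.
Proof.
move=> sS wW; have [D|D] := boolP (Ddes s w); first by right; apply: (lenD cox).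
by left; apply: (lenN cox).
Qed.

Let lenS2 s w : s \in SN -> w \in <<SN>>%g ->
  glen t (w * s)%g = (glen t w).+1 \/ glen t w = (glen t (w * s)%g).+1.
Proof.
move=> sS wW; have wV : (w^-1)%g \in <<SN>>%g by rewrite groupV.
have wsW : (w * s)%g \in <<SN>>%g by rewrite groupM // memW.
have := lenS1 sS wV; rewrite -[s in (s * _)%g](invS cox sS) -invMg.
by rewrite !(len_inv cox).
Qed.

(** [v] is a descent at the conjugate by [u] exactly when [u * v] is shorter than [u], so after the
    shift [u -> u * v] every summand is an instance of [eeq_shift]. *)
Lemma coinv_upper v B y : v \in Uset (val y) -> coinv (TX v B) y = eeq * coinv B y.
Proof.
move=> vU; have [j [jr lj vE]] := UsetP _ _ vU.
have vS : v \in SN by apply: U_bigS vU.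
have vG : v \in Uy y by apply: mem_gen.
have TE u : u \in Uy y -> TX v B (xact u (xof y)) = B (xact (u * v)%g (xof y)) +
    (if (glen t (u * v)%g < glen t u)%N then hq * B (xact u (xof y)) else 0).
  move=> uU; have uW := UW uU; have fu := xact_fpf uU.
  rewrite /Top /xcomm (val_act cox perf) //= {1 2}vE.
  rewrite (upper_noncomm n1 (G_gfun y) uU jr lj fu) (actM cox perf) ?(memW vS) //.
  by rewrite vE (upper_D n1 (G_gfun y) uU jr lj fu) -vE (D_lenr cox).
have -> : coinv (TX v B) y = \sum_(u in Uy y) (eeq ^+ glen t u * B (xact (u * v)%g (xof y)) +
  (if (glen t (u * v)%g < glen t u)%N then hq * eeq ^+ glen t u else 0) * B (xact u (xof y))).
  apply: eq_bigr => u uU; rewrite TE // mulrDr; congr (_ + _).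
  by case: ifP => _; rewrite ?mulr0 ?mul0r // mulrCA mulrA.
rewrite big_split /= (reindex_inj (mulIg v)) /=.
rewrite (eq_bigl (mem (Uy y))); last by move=> u /=; rewrite groupMr.
rewrite -big_split mulr_sumr; apply: eq_bigr => u uU /=.
rewrite (mulKS cox) // -mulrDl mulrA; congr (_ * _).
by apply: eeq_shift => //; apply: lenS2 => //; apply: UW uU.
Qed.

Let s_upper s y u : s \in S -> u \in Uy y -> (s * u = u * s)%g.
Proof. by case/gensP=> i vi -> uU; apply: (low_comm_upper n1 vi uU). Qed.

Let act_swap s y u : s \in S -> u \in Uy y ->
  xact s (xact u (xof y)) = xact u (xact s (xof y)).
Proof.
move=> sS uU; have uW := UW uU; have sW := memW (subS sS).
by rewrite -!(actM cox perf) // (s_upper sS uU).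
Qed.

Let comm_conj s y u : s \in S -> u \in Uy y ->
  xcomm s (xact u (xof y)) = xcomm s (xof y).
Proof.
move=> sS uU; rewrite /xcomm (val_act cox perf) /=; last exact: UW uU.
have {1 2}-> : s = (s ^ u)%g by rewrite conjgE (s_upper sS uU) mulKg.
by rewrite -!conjMg (inj_eq (conjg_inj u)).
Qed.

(** With [v = z s z] one has [s z = z v] and [z s = v z], hence [s z s = z v s = z s v = v z v]. *)
Lemma isAsc_upper s y : s \in S -> isAsc s y -> exists v,
  [/\ v \in Uset (val y), xact s (xof y) = xact v (xof y) &
      forall u, u \in Uy y -> Ddes s (val y ^ u)%g = Ddes v u].
Proof.
move=> sS A; have [i vi Es] := gensP _ _ _ sS; rewrite /isAsc Es in A.
have [k kr H] := bigS_ascpair n1 (G_fpf y) (G_gfun y) vi A.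
have vU : gen n k%:Z \in Uset (val y).
  by apply/UsetP; exists k; split=> //; apply: (ascpair_low n1 (G_fpf y) vi kr H).
exists (gen n k%:Z); split=> //; last first.
  move=> u uU; rewrite Es.
  by apply: (lower_D_asc n1 (G_gfun y) vi kr H uU); apply: xact_fpf.
have vS : gen n k%:Z \in SN by apply: U_bigS vU.
have sv : (s * gen n k%:Z = gen n k%:Z * s)%g by apply: (@s_upper _ y); rewrite ?mem_gen.
have E : (val y * s * val y = gen n k%:Z)%g.
  by rewrite Es; apply: (ascpair_gen n1 (G_fpf y) vi kr H).
have yy : (val y * val y = 1)%g := XX perf (xof y).
have E1 : (s * val y = val y * gen n k%:Z)%g by rewrite -E !mulgA yy mul1g.
have E2 : (val y * s = gen n k%:Z * val y)%g by rewrite -E -!mulgA yy mulg1.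
apply: val_inj; rewrite !(val_actS cox perf) //=; last exact: subS.
by rewrite E1 -E2 -!mulgA sv.
Qed.

Lemma coinv_lower s B y : s \in S -> coinv (TX s B) y =
  if xcomm s (xof y) then ceq * coinv B y
  else if isAsc s y then eeq * coinv B y
  else coinv B (gact s y) + (if Ddes s (val y) then hq * coinv B y else 0).
Proof.
move=> sS; have sS' := subS sS.
have [sy|nsy] := ifPn.
  rewrite /coinv mulr_sumr; apply: eq_bigr => u uU.
  by rewrite Top_comm ?comm_conj // mulrCA.
have TE u : u \in Uy y -> TX s B (xact u (xof y)) = B (xact u (xact s (xof y))) +
    (if Ddes s (val y ^ u)%g then hq * B (xact u (xof y)) else 0).
  move=> uU; rewrite /Top comm_conj // (negbTE nsy) act_swap //.
  by rewrite (val_act cox perf) //; apply: UW uU.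
have [A|nA] := ifPn.
  have [v [vU sv Dv]] := isAsc_upper sS A.
  have vS : v \in SN by apply: U_bigS vU.
  have vG : v \in Uy y by apply: mem_gen.
  have -> : coinv (TX s B) y = \sum_(u in Uy y) (eeq ^+ glen t u * B (xact (v * u)%g (xof y)) +
    (if (glen t (v * u)%g < glen t u)%N then hq * eeq ^+ glen t u else 0) * B (xact u (xof y))).
    apply: eq_bigr => u uU; have uW := UW uU.
    rewrite TE // Dv // (D_len cox) // sv -(actM cox perf) ?(memW vS) //.
    by rewrite mulrDr; congr (_ + _); case: ifP => _; rewrite ?mulr0 ?mul0r // mulrCA mulrA.
  rewrite big_split /= (reindex_inj (mulgI v)) /=.
  rewrite (eq_bigl (mem (Uy y))); last by move=> u /=; rewrite groupMl.
  rewrite -big_split mulr_sumr; apply: eq_bigr => u uU /=.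
  rewrite (mulSK cox) // -mulrDl mulrA; congr (_ * _).
  by apply: eeq_shift => //; apply: lenS1 => //; apply: UW uU.
have EU : Uset (val (gact s y)) = Uset (val y) by apply/Kset_Uset/Kset_gact.
rewrite /coinv EU xof_gact //.
have [D|D] := ifPn; last first.
  rewrite addr0; apply: eq_bigr => u uU; rewrite TE //.
  have [i vi Es] := gensP _ _ _ sS; rewrite /isAsc Es in nA D *.
  rewrite (lower_D n1 (G_fpf y) (G_gfun y) vi nA uU (xact_fpf uU)).
  by rewrite (negbTE D) addr0.
rewrite mulr_sumr -big_split; apply: eq_bigr => u uU; rewrite TE //.
have [i vi Es] := gensP _ _ _ sS; rewrite /isAsc Es in nA D *.
by rewrite (lower_D n1 (G_fpf y) (G_gfun y) vi nA uU (xact_fpf uU)) D /= mulrDr [in X in _ + X]mulrCA.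
Qed.

Lemma coinv_sub B B' (a : laurent) y :
  coinv (fun x => B x - a * B' x) y = coinv B y - a * coinv B' y.
Proof.
by rewrite /coinv mulr_sumr -sumrB; apply: eq_bigr => u _; rewrite mulrBr mulrCA.
Qed.

Lemma coinv_scale B (a : laurent) y : coinv (fun x => a * B x) y = a * coinv B y.
Proof. by rewrite /coinv mulr_sumr; apply: eq_bigr => u _; rewrite mulrCA. Qed.

Variable lam : laurent.

(** [lam] is later taken to be [ceq ^+ e], which cancels the diagonal entry of [barM]. *)
Definition pcol (K : {set 'I_(2 * n).+1}) B : Mod n t :=
  [ffun y => if K == Kset y then lam * coinv B y else 0].

Lemma actSinvE s m y : actSinv kd s m y = actS kd s m y - hq * m y.
Proof. by rewrite !ffunE. Qed.

Lemma pcol_Tbar s K B : s \in S -> pcol K (TbX s B) = actSinv kd s (pcol K B).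
Proof.
move=> sS; apply/ffunP => y; rewrite actSinvE actSE // !ffunE.
have -> : coinv (TbX s B) y = coinv (TX s B) y - hq * coinv B y.
  by rewrite -coinv_sub.
rewrite coinv_lower //; have [_|nsy] := boolP (xcomm s (xof y)).
  by move: (coinv B y) => w; case: (K == _); ring.
have [_|nA] := boolP (isAsc s y); first by move: (coinv B y) => w; case: (K == _); ring.
rewrite Kset_gact //; move: (coinv B y) (coinv B (gact s y)) => w w'.
by case: (K == _); case: (Ddes s _); ring.
Qed.

(** * The descended bar operator *)

Local Notation bM := (barM cox perf ceq hq).

Definition bcol g : Mod n t := pcol (Kset g) (bM (xof g)).

Let bM_asc := barM_asc cox perf ceq_quad.

Lemma bcol_comm s g : s \in S -> xcomm s (xof g) ->
  actSinv kd s (bcol g) = msc (lbar ceq) (bcol g).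
Proof.
move=> sS sg; rewrite -pcol_Tbar // (barM_comm cox perf ceq_quad) ?subS //.
apply/ffunP => y; rewrite !ffunE coinv_scale lbar_ceq.
by move: (coinv _ y) => w; case: (_ == _); ring.
Qed.

Lemma bcol_isAsc s g : s \in S -> isAsc s g ->
  actSinv kd s (bcol g) = msc (lbar eeq) (bcol g).
Proof.
move=> sS A; have [v [vU sv Dv]] := isAsc_upper sS A.
have vS : v \in SN by apply: U_bigS vU.
have nD := isAsc_notD sS A; have ns := isAsc_noncomm sS A.
have nDv : ~~ Ddes v (val g).
  have [j [jr lj vE]] := UsetP _ _ vU.
  have := upper_D n1 (G_gfun g) (group1 <<Uset (val g)>>%G) jr lj.
  rewrite conjg1 => /(_ (G_fpf g)); rewrite -vE => ->.
  by rewrite invg1; apply: (cox_D1 cox).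
have nv : ~~ xcomm v (xof g).
  have [j [jr lj vE]] := UsetP _ _ vU.
  have := upper_noncomm n1 (G_gfun g) (group1 <<Uset (val g)>>%G) jr lj.
  by rewrite conjg1 => /(_ (G_fpf g)); rewrite -vE /xcomm /= => ->.
rewrite -pcol_Tbar // -bM_asc ?subS // sv bM_asc //.
(* [T_s^-1] has been traded for [T_v^-1]. Outside the piece of [g] both sides vanish; inside it [v]
   belongs to [Uset (val y)], so [coinv_upper] applies. *)
apply/ffunP => y; rewrite !ffunE; case: eqP => [K|_]; last by rewrite mulr0.
have -> : coinv (TbX v (bM (xof g))) y = coinv (TX v (bM (xof g))) y - hq * coinv (bM (xof g)) y.
  by rewrite -coinv_sub.
rewrite coinv_upper -?(Kset_Uset K) // lbar_eeq.
by move: (coinv _ y) => w; ring.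
Qed.

Lemma bcol_asc s g : s \in S -> ~~ xcomm s (xof g) -> ~~ isAsc s g -> ~~ Ddes s (val g) ->
  actSinv kd s (bcol g) = bcol (gact s g).
Proof.
move=> sS ns nA nD; rewrite -pcol_Tbar // /bcol Kset_gact // xof_gact //.
by rewrite bM_asc // subS.
Qed.

Lemma D_gact s g : s \in S -> ~~ xcomm s (xof g) -> ~~ isAsc s g ->
  Ddes s (val (gact s g)) = ~~ Ddes s (val g).
Proof.
move=> sS ns nA; rewrite -[val (gact s g)]/(val (xof (gact s g))) xof_gact //.
by rewrite (D_act cox perf) // subS.
Qed.

Lemma bcol_des s g : s \in S -> ~~ xcomm s (xof g) -> ~~ isAsc s g -> Ddes s (val g) ->
  actSinv kd s (bcol g) = bcol (gact s g) + msc (lbar hq) (bcol g).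
Proof.
move=> sS ns nA D; set g' := gact s g.
have Eg : xof g = xact s (xof g') by rewrite -xof_gact ?isAsc_gact // gactK.
have EB : bM (xof g) = TbX s (bM (xof g')).
  by rewrite Eg bM_asc ?subS ?xcomm_gact ?isAsc_gact ?D_gact ?D.
have EB' : bM (xof g') = TX s (bM (xof g)).
  by rewrite EB (TbarK cox perf ceq_quad) // subS.
rewrite -pcol_Tbar // /bcol Kset_gact // EB'.
apply/ffunP => y; rewrite !ffunE.
have -> : coinv (TbX s (bM (xof g))) y = coinv (TX s (bM (xof g))) y - hq * coinv (bM (xof g)) y.
  by rewrite -coinv_sub.
rewrite lbar_hq; move: (coinv (bM (xof g)) y) (coinv (TX s _) y) => w w'.
by case: (_ == _); ring.
Qed.

Definition betaop m : Mod n t := \sum_g msc (lbar (m g)) (bcol g).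

Lemma betaopE m y : betaop m y = \sum_g lbar (m g) * bcol g y.
Proof. by rewrite sum_ffunE; apply: eq_bigr => g _; rewrite ffunE. Qed.

Lemma actS_basis s g y : actS kd s (basisv g) y = coefH t kd s (val g) (val y).
Proof.
rewrite ffunE (bigD1 g) //= ffunE eqxx mul1r big1 ?addr0 // => z nz.
by rewrite ffunE (negbTE nz) mul0r.
Qed.

(** Compatibility with [H_s] on a single basis vector: the left side is the bar image of
    [H_s M_g]. *)
Lemma betaop_coef s g y : s \in S ->
  \sum_z lbar (coefH t kd s (val g) (val z)) * bcol z y = actSinv kd s (bcol g) y.
Proof.
move=> sS; have pick z0 (a : laurent) :
    \sum_z lbar (a * (z == z0)%:R) * bcol z y = lbar a * bcol z0 y.
  rewrite (bigD1 z0) //= eqxx mulr1 big1 ?addr0 // => z nz.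
  by rewrite (negbTE nz) mulr0 lbar0 mul0r.
have coefHE' z : coefH t kd s (val g) (val z) =
    if xcomm s (xof g) then ceq * (z == g)%:R
    else if isAsc s g then eeq * (z == g)%:R
    else 1 * (z == gact s g)%:R + (if Ddes s (val g) then hq else 0) * (z == g)%:R.
  rewrite /coefH mem_AscLt // mem_DesLt // mem_AscEq // mem_DesEq //.
  have -> : cmp s (cmp (val g) s) = (val g ^ s)%g by rewrite /cmp (conjS cox) // subS.
  rewrite -/hq -/ceq -/eeq; have [sg|_] := boolP (xcomm s (xof g)); rewrite /=.
    by case: (boolP (isAsc s g)) => // /(isAsc_noncomm sS); rewrite sg.
  case: (boolP (isAsc s g)) => //= nA; rewrite -val_gact // mul1r.
  by case: (Ddes s (val g)) => //=; rewrite mul0r addr0.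
under eq_bigr do rewrite coefHE'.
have [sg|ns] := boolP (xcomm s (xof g)).
  by rewrite pick bcol_comm // [in RHS]ffunE.
have [A|nA] := boolP (isAsc s g); first by rewrite pick bcol_isAsc // [in RHS]ffunE.
set a := (if Ddes s (val g) then hq else 0).
transitivity (lbar 1 * bcol (gact s g) y + lbar a * bcol g y).
  have <- := pick (gact s g) 1; have <- := pick g a.
  by rewrite -big_split; apply: eq_bigr => z _; rewrite lbarD mulrDl.
rewrite lbar1 mul1r /a; have [D|D] := boolP (Ddes s (val g)).
  by rewrite bcol_des // [in RHS]ffunE; congr (_ + _); rewrite [in RHS]ffunE.
by rewrite bcol_asc // lbar0 mul0r addr0.
Qed.

Lemma betaop_actS s m : s \in S -> betaop (actS kd s m) = actSinv kd s (betaop m).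
Proof.
move=> sS; apply/ffunP => y; rewrite betaopE.
under eq_bigr => z _ do rewrite ffunE lbar_sum mulr_suml.
rewrite exchange_big /= actSinvE ffunE.
under [X in _ = X - _]eq_bigr => z _ do rewrite betaopE mulr_suml.
rewrite [X in _ = X - _]exchange_big /= betaopE mulr_sumr -sumrB.
apply: eq_bigr => g _; under eq_bigr => z _ do rewrite lbarM -mulrA.
rewrite -mulr_sumr betaop_coef // actSinvE ffunE mulrBr mulr_sumr mulrCA; congr (_ - _).
by apply: eq_bigr => z _; rewrite mulrA.
Qed.

Lemma glen_gact s g : s \in S -> ~~ xcomm s (xof g) -> ~~ isAsc s g -> Ddes s (val g) ->
  glen t (val g) = (glen t (val (gact s g))).+2.
Proof.
move=> sS ns nA D; rewrite -[val (gact s g)]/(val (xof (gact s g))) xof_gact //.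
exact: (len_actD cox perf (x := xof g) (subS sS) ns D).
Qed.

Lemma basis_ind (P : G -> Prop) :
  (forall z, DesLt t (val z) = set0 -> P z) ->
  (forall s z, s \in S -> ~~ xcomm s (xof z) -> ~~ isAsc s z -> Ddes s (val z) ->
     P (gact s z) -> P z) -> forall z, P z.
Proof.
move=> P0 PS z; have [k] := ubnP (glen t (val z)).
elim: k z => // k IH z; rewrite ltnS => lek.
have [E|[s sD]] := set_0Vmem (DesLt t (val z)); first exact: P0.
have sS : s \in S by move: sD; rewrite !inE => /andP[_ /andP[]].
move: sD; rewrite mem_DesLt // => /and3P[ns nA D].
apply: (PS s) => //; apply: IH; rewrite (glen_gact sS ns nA D) in lek.
exact: ltnW lek.
Qed.

(** Generators in [Asc^=] are never descents, so when [Des^<] is empty every descent commutes with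
    [y]. *)
Lemma G_lmin y : DesLt t (val y) = set0 -> lmin t n (val y).
Proof.
move=> D0 i vi; have [i1 i2] := vidx_bound n1 (leqnn _) (vidx_wide n1 vi).
have sS : gen n i \in S by apply/gensP; exists i.
have nD := D_gen n1 i1 i2 (fp_odd (G_fpf y)).
have := mem_DesLt sS y; rewrite D0 inE nD => /esym/negbT; rewrite !negb_and !negbK.
case/or3P => [|A|->]; last by rewrite !orbT.
- by rewrite /xcomm /= (comm_genE n1 i1 i2 (G_fpf y)) orbA => ->.
- by have := isAsc_notD sS A; rewrite nD => ->; rewrite !orbT.
Qed.

Lemma G_min_unique y y' : DesLt t (val y) = set0 -> DesLt t (val y') = set0 ->
  Kset y = Kset y' -> y = y'.
Proof.
move=> D D' /KsetP K; have nn : (1 < n <= 2 * n)%N by lia.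
have pos z : DesLt t (val z) = set0 -> forall k : nat, (0 < k <= n)%N -> 0 < sapp (val z) k%:Z.
  move=> Dz; have [zA zD] := X_mem (G_X z).
  apply: (lmin_pos n1 nn (G_fpf z) (G_lmin Dz) zA zD) => k kr.
  by rewrite /negc -leNgt; apply: (gf_low (G_gfun z) kr).
have mono z : DesLt t (val z) = set0 -> forall k : nat, (0 < k < n)%N ->
    sapp (val z) k%:Z < sapp (val z) k.+1%:Z \/ sapp (val z) k%:Z = k.+1%:Z.
  by move=> Dz; apply: (lmin_mono n1 nn (G_fpf z) (G_lmin Dz)).
apply: val_inj; apply: (sapp_ext n1) => [||k kr].
- exact: fp_odd (G_fpf y).
- exact: fp_odd (G_fpf y').
exact: (gmin_unique (G_gfun y) (G_gfun y') (pos _ D) (pos _ D') (mono _ D) (mono _ D') K kr).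
Qed.

(** Conjugating [y'] down by elements of [Des^<] stays in the piece, shortens at each step, and
    stops only at the unique minimal element. *)
Lemma G_min_lt y y' : DesLt t (val y) = set0 -> Kset y = Kset y' -> y' != y ->
  (glen t (val y) < glen t (val y'))%N.
Proof.
move=> D; elim/basis_ind: y' => [y' D' K /eqP[]|s z sS ns nA Ds IH K zy].
  by apply/esym; apply: G_min_unique.
have lz := glen_gact sS ns nA Ds; have K' := Kset_gact sS nA.
have [E|ne] := eqVneq (gact s z) y; first by rewrite lz E ltnS leqnSn.
by apply: ltn_trans (IH _ ne) _; rewrite ?K' // lz ltnS leqnSn.
Qed.

(** Along a reduced word of [u] each letter fails to commute and, by [upper_D], is an ascent, so
    each conjugation adds two. *)
Lemma glen_upper y u : u \in Uy y ->
  glen t (val (xact u (xof y))) = (glen t (val y) + (glen t u).*2)%N.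
Proof.
have JS : Uset (val y) \subset SN by apply/subsetP => v; apply: U_bigS.
case/(J_word cox JS)=> l [lU <- sl]; rewrite -sl; move: lU sl.
elim/last_ind: l => [|l v IH]; first by rewrite wprod_nil (act1 cox perf) addn0.
rewrite all_rcons size_rcons wprod_rcons => /andP[vU lU] sl.
have vS : v \in SN by apply: U_bigS vU.
have lG : wprod l \in Uy y by apply: wprod_gen.
have lW := UW lG.
have sl' : size l = glen t (wprod l).
  have := cox_len_le cox (sub_all JS lU); have := lenS2 vS lW; rewrite -sl.
  by lenlia (@glen n t).
have [j [jr lj vE]] := UsetP _ _ vU; have fl := xact_fpf lG.
rewrite (actM cox perf) ?(memW vS) // (len_act cox perf) //.
- by rewrite IH // doubleS !addnS.
- rewrite /xcomm (val_act cox perf) //= vE.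
  by rewrite (upper_noncomm n1 (G_gfun y) lG jr lj fl).
- rewrite (val_act cox perf) //= vE (upper_D n1 (G_gfun y) lG jr lj fl) -vE.
  by rewrite -(D_lenr cox) // -sl -sl' ltnNge leqnSn.
Qed.

Variable e : nat.
Hypothesis emin : forall x : X, xmin SN (@Ddes n) x -> glen t (val x) = e.
Hypothesis lamE : lam = ceq ^+ e.

Lemma betaop_basis g : betaop (basisv g) = bcol g.
Proof.
apply/ffunP => y; rewrite betaopE (bigD1 g) //= ffunE eqxx lbar1 mul1r big1 ?addr0 //.
by move=> z nz; rewrite ffunE (negbTE nz) lbar0 mul0r.
Qed.

(** All conjugates entering [coinv] in the piece of [y] are longer than [y], except [y] itself, so
    triangularity leaves one term; its coefficient [(ceq - hq) ^+ e] is cancelled by [lam]. *)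
Lemma betaop_min y : DesLt t (val y) = set0 -> betaop (basisv y) = basisv y.
Proof.
move=> D; rewrite betaop_basis; apply/ffunP => y'; rewrite !ffunE.
have [B1 B0] := barM_triangular cox perf ceq_quad emin (xof y).
have [E|ne] := eqVneq y' y.
  rewrite E eqxx /coinv (bigD1 1%g) ?group1 //= (act1 cox perf) B1 (len1 cox) expr0 mul1r.
  rewrite big1 ?addr0 => [|u /andP[uU nu]].
    by rewrite lamE -exprMn ceqV expr1n.
  have lu := glen_upper uU.
  have u0 : (0 < glen t u)%N.
    by rewrite lt0n; apply: contraNN nu => /eqP/(len_eq0 cox (UW uU))->.
  have gt : (glen t (val y) < glen t (val (xact u (xof y))))%N.
    by rewrite lu; clear -u0; lia.
  rewrite B0 ?mulr0 //; last exact: ltnW gt.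
  by apply: contraTneq gt => ->; rewrite ltnn.
case: eqP => // K; have gt := G_min_lt D K ne.
rewrite /coinv big1 ?mulr0 // => u uU; have lu := glen_upper uU.
have gt' : (glen t (val y) < glen t (val (xact u (xof y'))))%N.
  by rewrite lu; apply: leq_trans gt (leq_addr _ _).
rewrite B0 ?mulr0 //; last exact: ltnW gt'.
by apply: contraTneq gt' => ->; rewrite ltnn.
Qed.

End GelfandModel.

(** * Existence, uniqueness and triangularity of bar operators *)

Section BarOperators.

Variables (n : nat) (n1 : (1 < n)%N) (t : ctype) (kd : mkind).
Local Notation S := (gens n t n).
Local Notation G := (Gidx n t).
Local Notation M := (Mod n t).
Implicit Types (s w : Perm n) (y z : G) (a m : M).

Definition antilinear (beta : M -> M) : Prop :=
  (forall a b, beta (a + b) = beta a + beta b) /\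
  (forall c a, beta (msc c a) = msc (lbar c) (beta a)).

Lemma antilinear_sum beta (I : Type) (r : seq I) (F : I -> M) : antilinear beta ->
  beta (\sum_(i <- r) F i) = \sum_(i <- r) beta (F i).
Proof.
move=> [bD _]; apply: (big_morph _ bD).
by apply: (addrI (beta 0)); rewrite -bD !addr0.
Qed.

Lemma redw_gens w : all (mem S) (redw t w).
Proof.
rewrite /redw; move: (wlen t w) => f; elim: f w => //= f IH w.
by case: pickP => //= s /andP[sS _]; rewrite sS IH.
Qed.

Let cox := cox_gens n1 t.
Let subS s : s \in S -> s \in gens n t (2 * n).
Proof. by case/gensP=> i vi ->; apply/gensP; exists i => //; apply: vidx_wide. Qed.

Lemma redw_gen s : s \in S -> redw t s = [:: s].
Proof.
move=> sS; have ss := cox_invol cox (subS sS).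
have l1 : wlen t (1%g : Perm n) = 0%N.
  by have := clen_le (S := S) (l := [::]) isT; rewrite wprod_nil leqn0 => /eqP.
have eq1 w : w \in <<S>>%g -> wlen t w = 0%N -> w = 1%g.
  move=> wW w0; have [l [_ lw]] := clen_word wW.
  by rewrite -/(wlen t w) w0 => /size0nil l0; rewrite -lw l0 wprod_nil.
have s1 : wlen t s = 1%N.
  have := clen_le (S := S) (l := [:: s]); rewrite /= sS wprod_cons wprod_nil mulg1 => /(_ isT).
  rewrite -/(wlen t s); case E : (wlen t s) => [|[|k]] // _.
  have s1 := eq1 s (mem_gen sS) E; have := cox_DM cox (subS sS) (group1 _).
  by rewrite mulg1 s1; case: (Ddes _ _).
rewrite /redw s1 /=; case: pickP => [s' /andP[s'S]|/(_ s)].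
  rewrite s1 ltnS leqn0 => /eqP/eq1 E.
  have : cmp s' s = 1%g by apply: E; rewrite /cmp groupM ?mem_gen.
  by rewrite /cmp -ss => /mulgI->.
by rewrite /= sS /cmp ss l1 s1.
Qed.

(** [actHw] and [actbarHw] run through the same word, so compatibility passes letter by letter.
    Conversely, the basis element of [s] acts by the one-letter word [[:: s]]. *)
Lemma compatible_gens beta : antilinear beta ->
  (forall (h : Hecke n t) a, beta (actH kd h a) = actbarH kd h (beta a)) <->
  (forall s a, s \in S -> beta (actS kd s a) = actSinv kd s (beta a)).
Proof.
move=> alin; have [_ bZ] := alin; split=> H.
  move=> s a sS; pose w0 : Widx n t := exist _ s (mem_gen sS).
  pose h : Hecke n t := [ffun w => (w == w0)%:R].
  have E (f : Perm n -> M) : \sum_(w : Widx n t) msc (h w) (f (val w)) = f s.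
    rewrite (bigD1 w0) //= big1 ?addr0 => [|w nw].
      by apply/ffunP => y; rewrite !ffunE eqxx mul1r.
    by apply/ffunP => y; rewrite !ffunE (negbTE nw) mul0r.
  have E' (f : Perm n -> M) : \sum_(w : Widx n t) msc (lbar (h w)) (f (val w)) = f s.
    rewrite -(E f); apply: eq_bigr => w _; congr (msc _ _).
    by rewrite ffunE lbar_nat.
  have := H h a; rewrite /actH /actbarH.
  rewrite (E (fun w => actHw kd w a)) (E' (fun w => actbarHw kd w (beta a))).
  by rewrite /actHw /actbarHw redw_gen.
move=> h a; rewrite /actH /actbarH antilinear_sum //; apply: eq_bigr => w _.
rewrite bZ; congr (msc _ _); rewrite /actHw /actbarHw.
by elim: (redw t _) (redw_gens (val w)) => //= s l IH /andP[sS lS]; rewrite H // IH.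
Qed.

Lemma bar_op_exists : exists beta : M -> M, is_bar_op kd beta.
Proof.
have [e emin] := min_len_ex n1 t; pose lam := ceq kd ^+ e.
exists (betaop n1 kd lam).
have bD (a b : M) : betaop n1 kd lam (a + b) = betaop n1 kd lam a + betaop n1 kd lam b.
  apply/ffunP => y; rewrite ffunE !betaopE -big_split; apply: eq_bigr => g _ /=.
  by rewrite ffunE lbarD mulrDl.
have bZ (c : laurent) (a : M) : betaop n1 kd lam (msc c a) = msc (lbar c) (betaop n1 kd lam a).
  apply/ffunP => y; rewrite ffunE !betaopE mulr_sumr; apply: eq_bigr => g _.
  by rewrite ffunE lbarM mulrA.
split=> //.
- by apply/compatible_gens => // s a sS; apply: betaop_actS.
- by move=> z; apply: (@betaop_min n n1 t kd lam e emin (erefl _)).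
Qed.

Section AnyBarOperator.

Variables (beta : M -> M) (bop : is_bar_op kd beta).

Let alin : antilinear beta. Proof. by case: bop. Qed.
Let bS s a : s \in S -> beta (actS kd s a) = actSinv kd s (beta a).
Proof. by case: bop => _ _ H _ sS; apply: (compatible_gens alin).1. Qed.
Let bmin z : DesLt t (val z) = set0 -> beta (basisv z) = basisv z.
Proof. by case: bop => _ _ _; apply. Qed.

Lemma basis_step s z : s \in S -> ~~ xcomm s (xof n1 z) -> ~~ isAsc s z -> Ddes s (val z) ->
  actS kd s (basisv (gact s z)) = basisv z.
Proof.
move=> sS ns nA D; apply/ffunP => y; rewrite actS_basis ffunE /coefH (mem_AscLt n1 sS).
rewrite (xcomm_gact n1) // (isAsc_gact n1) // ns nA (D_gact (n1 := n1)) // D /=.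
have -> : cmp s (cmp (val (gact s z)) s) = val z.
  rewrite -[in RHS](gactK n1 sS nA) [RHS](val_gact n1 sS) ?(isAsc_gact n1 sS nA) //.
  by rewrite (conjS cox _ (subS sS)).
by rewrite val_eqE.
Qed.

(** The square of [beta] commutes with every [H_s]: barring [H_s^-1 = H_s - h] gives
    [H_s^-1 + h = H_s], as [h] changes sign. It is linear and fixes the minimal basis vectors, from
    which all others are generated. *)
Lemma beta_involutive m : beta (beta m) = m.
Proof.
have [bD bZ] := alin.
have basis z : beta (beta (basisv z)) = basisv z.
  move: z; apply: (@basis_ind n n1 t) => [z D|s z sS ns nA D IH]; first by rewrite !bmin.
  rewrite -(basis_step sS ns nA D); move: (basisv (gact s z)) IH => a IH.
  rewrite bS // /actSinv.
  have -> : actS kd s (beta a) - msc (lx - lxi) (beta a) =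
      actS kd s (beta a) + msc (- (lx - lxi)) (beta a).
    by congr (_ + _); apply/ffunP => y; rewrite !ffunE mulNr.
  rewrite bD bZ bS // IH; apply/ffunP => y.
  rewrite ffunE actSinvE [msc _ a y]ffunE -/hq lbarN lbar_hq.
  by move: (actS kd s a y) (a y) => p q; ring.
rewrite {1}[m]fdelta_sum !antilinear_sum // [RHS]fdelta_sum; apply: eq_bigr => z _.
rewrite -[fscale _ _]/(msc (m z) (basisv z)) !bZ lbarK basis.
by [].
Qed.

(** As for the big module, but derived from the axioms of a bar operator alone, so it holds for any
    such operator and not only for [betaop]. *)
Lemma beta_unitriangular :
  unitriangular (fun y : G => glen t (val y)) (fun z => beta (basisv z)).
Proof.
apply: (@basis_ind n n1 t) => [z D|s z sS ns nA D [IH1 IH0]].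
  rewrite bmin //; split=> [|y nyz _]; first by rewrite ffunE eqxx.
  by rewrite ffunE (negbTE nyz).
have lz := glen_gact sS ns nA D; set z' := gact s z in lz IH1 IH0 *.
rewrite -(basis_step sS ns nA D) -/z' bS //; set b := beta (basisv z') in IH1 IH0 *.
have b0 y : (glen t (val z) <= glen t (val y))%N -> b y = 0.
  rewrite lz => ly; apply: IH0; last by clear -ly; lia.
  by apply: contraTneq ly => ->; clear; lia.
split.
  by rewrite actSinvE (actSE n1) // (negbTE ns) (negbTE nA) D (b0 z (leqnn _)) !mulr0 subr0 addr0.
move=> y nyz ly; rewrite actSinvE (actSE n1) // (b0 y ly) !mulr0 subr0 if_same addr0.
have [//|nsy] := boolP (xcomm s (xof n1 y)); have [//|nAy] := boolP (isAsc s y).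
apply: IH0.
  by apply: contraNneq nyz => E; rewrite -(gactK n1 sS nAy) E (gactK n1).
have [Dy|nDy] := boolP (Ddes s (val y)).
  by have := glen_gact sS nsy nAy Dy; move: ly; rewrite lz; clear; lia.
have D' : Ddes s (val (gact s y)) by rewrite (D_gact (n1 := n1)).
have := glen_gact (n1 := n1) sS _ _ D'; rewrite (xcomm_gact n1) // (isAsc_gact n1) // (gactK n1) //.
by move=> /(_ nsy nAy); move: ly; rewrite lz; clear; lia.
Qed.

Lemma beta_bar_involution : bar_involution (fun y : G => glen t (val y)) beta.
Proof.
have [bD bZ] := alin; split=> //; first exact: beta_involutive.
exact: beta_unitriangular.
Qed.

End AnyBarOperator.

Lemma bar_op_unique (beta beta' : M -> M) : is_bar_op kd beta -> is_bar_op kd beta' ->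
  forall m, beta m = beta' m.
Proof.
move=> B B' m; have [[bD bZ bH bm] [bD' bZ' bH' bm']] := (B, B').
have basis z : beta (basisv z) = beta' (basisv z).
  move: z; apply: (@basis_ind n n1 t) => [z D|s z sS ns nA D IH]; first by rewrite bm ?bm'.
  rewrite -(basis_step sS ns nA D).
  rewrite ((compatible_gens (conj bD bZ)).1 bH) // ((compatible_gens (conj bD' bZ')).1 bH') //.
  by rewrite IH.
rewrite [m]fdelta_sum !antilinear_sum //; apply: eq_bigr => z _.
by rewrite -[fscale _ _]/(msc (m z) (basisv z)) bZ bZ' basis.
Qed.

End BarOperators.

(* For W = S_n (t = TA), W^BC_n (t = TBC), W^D_n (t = TD), n >= 2, and for the
   module M (k = KM) or N (k = KN):
   (1) an H-compatible bar operator fixing the basis elements indexed by z with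
       Des^<(z) empty exists, (2) it is unique, (3) it is an involution, and
   (4) there is a unique basis {b_z} with bar(b_z) = b_z in
       M_z + sum_{l(y) < l(z)} x^-1 Z[x^-1] M_y  (resp. with N). *)
Theorem mainTheorem3 (n : nat) (t : ctype) (k : mkind) :
  (2 <= n)%N ->
  [/\ exists beta : Mod n t -> Mod n t, @is_bar_op n t k beta,
      forall beta beta' : Mod n t -> Mod n t,
        @is_bar_op n t k beta -> @is_bar_op n t k beta' ->
        forall m, beta m = beta' m,
      forall beta : Mod n t -> Mod n t,
        @is_bar_op n t k beta -> forall m, beta (beta m) = m
    & forall beta : Mod n t -> Mod n t, @is_bar_op n t k beta ->
        exists b : Gidx n t -> Mod n t,
          [/\ @is_basis n t b, @canonical_fam n t beta b
            & forall b' : Gidx n t -> Mod n t,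
                @is_basis n t b' -> @canonical_fam n t beta b' -> forall z, b' z = b z]].
Proof.
move=> n1; split.
- exact: bar_op_exists.
- exact: bar_op_unique.
- exact: beta_involutive.
move=> beta /(beta_bar_involution n1) bi; have [b cb] := canonical_exists bi.
exists b; split=> //.
- exact: (unitriangular_basis (canonical_unitriangular cb)).
- by move=> b' _ cb'; apply: (canonical_unique bi cb cb').
Qed.
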